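(* Fix an integer $L\ge 1$ and a number $A>0$. For $N\ge 1$ let $p_N$ be the density of zeros of the random polynomial $\psi_N$ defined in the context. Then, as $N\to\infty$, \[ N^{-2}\,p_N\!\left(\Bigl(1+\frac{s}{N}\Bigr)^{1/2}e^{i\theta}\right)=\frac1\pi\left[\frac{g^{(L)}(s)}{g^{(L-1)}(s)}\right]'+O(N^{-1}), \] where the error term is bounded by $C(A,L)N^{-1}$ uniformly in $s\in[-A,A]$ and $\theta\in\mathbb R$, the prime denotes $d/ds$, and \[ g(s)=\frac{e^s-1}{s}=\sum_{j\ge0}\frac{s^j}{(j+1)!},\qquad g^{(j)}(s)=\frac{d^j g}{ds^j}(s). \] Equivalently, the leading term equals $\frac1\pi\bigl[\log g^{(L-1)}(s)\bigr]''$.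
   Context: A standard complex Gaussian random variable $a$ satisfies $Ea=0$, $E|a|^2=1$, $Ea^2=0$. Let $(a_m)_{m\ge0}$ be independent standard complex Gaussian random variables and $L\ge1$ a fixed integer. The $SU(1,1)$ random polynomial of degree $N$ is \[ \psi_N(z)=\sum_{m=0}^N\sqrt{\binom{m+L-1}{m}}\,a_m z^m,\qquad \binom{m+L-1}{m}=\frac{(m+L-1)!}{(L-1)!\,m!}. \] Its density of zeros $p_N:\mathbb C\to[0,\infty)$ is the function such that for every smooth compactly supported test function $\phi$ on $\mathbb C$, $E\bigl(\sum_{j=1}^N\phi(z_j)\bigr)=\int_{\mathbb C}p_N(z)\phi(z)\,dx\,dy$, where $z_1,\dots,z_N$ are the zeros of $\psi_N$ (counted with multiplicity). *)

(* Defs.v *)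
From HB Require Import structures.
From mathcomp Require Import all_boot all_order all_algebra.
From mathcomp Require Import all_classical all_reals all_analysis.
From mathcomp Require Import complex.

Set Implicit Arguments.
Unset Strict Implicit.
Unset Printing Implicit Defensive.

Import Order.TTheory GRing.Theory Num.Theory.
Import numFieldTopology.Exports numFieldNormedType.Exports.
Local Open Scope classical_set_scope.
Local Open Scope ring_scope.
Local Open Scope complex_scope.

Section Defs.
Variable R : realType.

Definition Cpt (x y : R) : R[i] := (x +i* y)%C.

Definition su11_coef (L m : nat) : R := Num.sqrt ('C(m + L - 1, m))%:R.

Definition su11_poly (L N : nat) (a : nat -> R[i]) : {poly R[i]} :=
  \poly_(m < N.+1) ((su11_coef L m)%:C * a m).

(* sum of phi over the zeros of p, counted with multiplicity
   (p = lead_coef p * prod_(z <- r) (X - z)); for p = 0 the value is irrelevant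
   (a probability-zero event) *)
Definition zero_sum (phi : R[i] -> R) (p : {poly R[i]}) : R :=
  \sum_(z <- projT1 (@closed_field_poly_normal _ p)) phi z.

Definition pdx (f : R -> R -> R) : R -> R -> R :=
  fun x y => derive1 (fun t => f t y) x.
Definition pdy (f : R -> R -> R) : R -> R -> R :=
  fun x y => derive1 (fun t => f x t) y.

Fixpoint Ck (k : nat) (f : R -> R -> R) : Prop :=
  match k with
  | 0 => continuous (fun xy : R * R => f xy.1 xy.2)
  | k.+1 => continuous (fun xy : R * R => f xy.1 xy.2) /\
            (forall x y, derivable (fun t => f t y) x 1) /\
            (forall x y, derivable (fun t => f x t) y 1) /\
            Ck k (pdx f) /\ Ck k (pdy f)
  end.

Definition smooth2 (f : R -> R -> R) : Prop := forall k, Ck k f.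

Definition test_function (phi : R[i] -> R) : Prop :=
  smooth2 (fun x y => phi (Cpt x y)) /\
  exists M : R, forall x y, M < `|x| \/ M < `|y| -> phi (Cpt x y) = 0.

Definition mutually_independent {d} {Omega : measurableType d}
  (P : probability Omega R) {I : eqType} (X : I -> Omega -> R) : Prop :=
  forall (J : seq I) (B : I -> set R), uniq J ->
    (forall i, i \in J -> measurable (B i)) ->
    P (\bigcap_(i in [set i | i \in J]) (X i @^-1` B i)) =
    (\prod_(i <- J) P (X i @^-1` B i))%E.

Definition re_im_part {d} {Omega : measurableType d} (a : nat -> Omega -> R[i])
  (k : nat * bool) : Omega -> R :=
  fun w => if k.2 then complex.Re (a k.1 w) else complex.Im (a k.1 w).

Definition iid_std_complex_gaussian {d} {Omega : measurableType d}
  (P : probability Omega R) (a : nat -> Omega -> R[i]) : Prop :=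
  (forall k, measurable_fun setT (re_im_part a k)) /\
  mutually_independent P (re_im_part a) /\
  (forall k (B : set R), measurable B ->
     P (re_im_part a k @^-1` B) = normal_prob 0 (Num.sqrt (2^-1)) B).

Definition is_zero_density {d} {Omega : measurableType d}
  (P : probability Omega R) (a : nat -> Omega -> R[i]) (L N : nat)
  (p : R[i] -> R) : Prop :=
  forall phi, test_function phi ->
    (\int[P]_w (zero_sum phi (su11_poly L N (fun m => a m w)))%:E =
     \int[(@lebesgue_measure R \x @lebesgue_measure R)]_(xy in setT)
        (p (Cpt xy.1 xy.2) * phi (Cpt xy.1 xy.2))%:E)%E.

Definition gfun (s : R) : R := if s == 0 then 1 else (expR s - 1) / s.

Definition gder (j : nat) : R -> R := derive1n j gfun.

Definition leading_term (L : nat) (s : R) : R :=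
  derive1 (fun t => gder L t / gder L.-1 t) s.

Definition scaled_point (N : nat) (s theta : R) : R[i] :=
  (Num.sqrt (1 + s / N%:R))%:C * Cpt (cos theta) (sin theta).

End Defs.

(* Main.v *)
(* Away from the zero polynomial, [\sum_j phi z_j = (4 pi)^-1 \int ln |psi|^2 Delta phi]:
   the logarithm is the fundamental solution of the Laplacian, which is obtained by
   regularising it to [ln (|z|^2 + e)], integrating by parts and letting [e] tend to 0.
   For fixed [z] the value [psi z] is a complex Gaussian of variance [K |z|^2], where
   [K t = \sum_(m <= N) 'C(m + L - 1, m) t^m], so that [E ln |psi z|^2 = ln (K |z|^2) + const],
   and the constant disappears against [Delta phi].  Fubini's theorem and a second integration by
   parts give the density [pi^-1 (t K'/K)'] at [t = |z|^2]; testing against products of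
   bump functions shows that a continuous density is equal to it everywhere.

   For the asymptotics, [(L - 1)! N^-L K (1 + s / N)] is a polynomial in [s] whose
   coefficients are those of [g^(L-1)] up to a relative error [O(1 / N)], so it converges
   to [g^(L-1)] together with its first two derivatives, uniformly on [[-A, A]]. *)
Require Import Defs.
From HB Require Import structures.
From mathcomp Require Import all_boot all_order all_algebra.
From mathcomp Require Import all_classical all_reals all_analysis.
From mathcomp Require Import measurable_realfun complex ring lra.
Set Implicit Arguments.
Unset Strict Implicit.
Unset Printing Implicit Defensive.
Import Order.TTheory GRing.Theory Num.Theory.
Import numFieldTopology.Exports numFieldNormedType.Exports.
Local Open Scope classical_set_scope.
Local Open Scope ring_scope.

(** * Transport of integrals and Gaussian linear forms *)

Section integral_transport.
Import HBNNSimple.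

(** Everything is tested against products [f x * g y] of one-variable bumps. This shapes the
    analysis: the Laplacian becomes [f2 x * g y + f x * g2 y], so Green's formula reduces to
    one-dimensional integration by parts and Fubini, without polar coordinates or discs cut out
    around the zeros. The factor [4 pi] is the total mass of [4 / (1 + |z|^2)^2], the Laplacian of
    [ln (1 + |z|^2)]; rescaling by [sqrt e] shows that this mass does not depend on the
    regularisation. The singularity of [ln |z - r|^2] is dominated by [ln (x - Re r)^2], a function
    of [x] alone; the price is that pointwise statements hold off a vertical line, still a null set,
    instead of off a point. Independence is given through finite families of events, so the law of
    [psi z] is built one coefficient at a time, by rotation invariance of the planar Gaussian. In
    the limit, negative [s] is the delicate range: positivity of [g^(L-1)], which is a denominator,
    cannot be read off its alternating series and comes from a differential equation. *)

Definition image_measure d1 d2 (T1 : measurableType d1) (T2 : measurableType d2)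
    (R : realType) (m : {measure set T1 -> \bar R}) (f : T1 -> T2)
    (mf : measurable_fun setT f) : {measure set T2 -> \bar R} :=
  measure_function_pushforward__canonical__measure_function_Measure m mf.

Lemma measurable_affine (R : realType) (a b : R) :
  measurable_fun [set: measurableTypeR R]
    ((fun x => a * x + b : R) : measurableTypeR R -> measurableTypeR R).
Proof.
by apply: (measurable_funD (f := fun x : measurableTypeR R => a * x));
  [apply: measurable_funM|].
Qed.

(** The scaled pushforward is itself a measure, so agreement with Lebesgue measure on half-open
    intervals suffices. For [a < 0] the preimage is closed at the other end, which does not change
    its length. *)
Lemma lebesgue_measure_affine (R : realType) (a b : R) (A : set R) :
  a != 0 -> measurable A ->
  (`|a|%:E * lebesgue_measure ((fun x => a * x + b : R)%R @^-1` A) =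
   lebesgue_measure A)%E.
Proof.
move=> a0 mA.
pose nu : {measure set (measurableTypeR R) -> \bar R} :=
  mscale (NngNum (normr_ge0 a)) (image_measure lebesgue_measure (measurable_affine a b)).
apply/esym.
suff H X : ocitv X -> lebesgue_measure X = nu X.
  by rewrite (lebesgue_measure_unique H mA).
move=> [[c d]] _ <-/=.
rewrite /nu/= /mscale/= /pushforward /=.
have [a_gt0|a_le0] := ltP 0 a.
  rewrite (_ : _ @^-1` _ = [set` `](c - b) / a, (d - b) / a]]); last first.
    apply/seteqP; split => x /=; rewrite !in_itv/= ltr_pdivrMr// ler_pdivlMr//;
    rewrite -lerBrDr -ltrBlDr (mulrC a)//.
  rewrite !lebesgue_measure_itv/= !lte_fin ltr_pM2r ?invr_gt0// ltrD2r.
  case: ifP => _; last by rewrite mule0.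
  by rewrite -!EFinB -EFinM; congr EFin; rewrite gtr0_norm//; field.
have a_lt0 : a < 0 by rewrite lt_neqAle a0 a_le0.
rewrite (_ : _ @^-1` _ = [set` `[(d - b) / a, (c - b) / a[]); last first.
  apply/seteqP; split => x /=; rewrite !in_itv/= andbC ltr_ndivlMr// ler_ndivrMr//;
  rewrite -lerBrDr -ltrBlDr (mulrC a)//.
rewrite !lebesgue_measure_itv/= !lte_fin ltr_nM2r ?invr_lt0// ltrD2r.
case: ifP => _; last by rewrite mule0.
by rewrite -!EFinB -EFinM; congr EFin; rewrite ltr0_norm//; field.
Qed.

Lemma ge0_integral_affine (R : realType) (a b : R) (f : R -> \bar R) :
  a != 0 -> measurable_fun setT f -> (forall x, 0 <= f x)%E ->
  (\int[lebesgue_measure]_x f x =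
   `|a|%:E * \int[lebesgue_measure]_x f (a * x + b)%R)%E.
Proof.
move=> a0 mf f0.
pose nu : {measure set (measurableTypeR R) -> \bar R} :=
  mscale (NngNum (normr_ge0 a)) (image_measure lebesgue_measure (measurable_affine a b)).
rewrite (eq_measure_integral nu); last first.
  by move=> A mA _; apply/esym; exact: lebesgue_measure_affine.
rewrite /nu/= ge0_integral_mscale//=.
by rewrite (ge0_integral_pushforward (measurable_affine a b)).
Qed.

(** [normal_prob] is defined on sets by integrating its density; the formula passes to simple
    functions by additivity and then to [f] by monotone convergence on both sides. *)
Lemma ge0_integral_normal (R : realType) (m s : R) (f : R -> \bar R) :
  measurable_fun setT f -> (forall x, 0 <= f x)%E ->
  (\int[normal_prob m s]_x f x =
   \int[lebesgue_measure]_x (f x * (normal_pdf m s x)%:E))%E.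
Proof.
move=> mfR f0.
have mf : measurable_fun [set: measurableTypeR R] f by exact: mfR.
have mp : measurable_fun [set: measurableTypeR R] (fun x => (normal_pdf m s x)%:E).
  by apply/measurable_EFinP; exact: measurable_normal_pdf.
have p0 x : (0 <= (normal_pdf m s x)%:E)%E by rewrite lee_fin normal_pdf_ge0.
pose f_ := nnsfun_approx measurableT mf.
have f_f x : (f_ n x)%:E @[n --> \oo] --> f x by exact: cvg_nnsfun_approx.
transitivity (limn (fun n => \int[normal_prob m s]_x (f_ n x)%:E)%E).
  rewrite -monotone_convergence//.
  - by apply: eq_integral => x _; apply/esym/cvg_lim.
  - by move=> n; exact/measurable_EFinP.
  - by move=> n x _; rewrite lee_fin.
  - by move=> x _ ? ? mn; rewrite lee_fin; exact/lefP/nd_nnsfun_approx.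
transitivity (limn (fun n => \int[lebesgue_measure]_x ((f_ n x)%:E * (normal_pdf m s x)%:E))%E); last first.
  rewrite -monotone_convergence//.
  - apply: eq_integral => x _; apply/cvg_lim => //.
    by apply: cvgeZr.
  - by move=> n; apply: emeasurable_funM => //; exact/measurable_EFinP.
  - by move=> n x _; rewrite mule_ge0// lee_fin.
  - move=> x _ ? ? mn; rewrite lee_wpmul2r// lee_fin.
    exact/lefP/nd_nnsfun_approx.
congr (limn _); apply/funext => n.
transitivity (\sum_(k \in range (f_ n)) k%:E * normal_prob m s (f_ n @^-1` [set k]))%E.
  by rewrite -sintegralE integralT_nnsfun.
transitivity (\int[lebesgue_measure]_x \sum_(k \in range (f_ n)) (k%:E * ((\1_(f_ n @^-1` [set k]) x)%:E * (normal_pdf m s x)%:E)))%E.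
  rewrite ge0_integral_fsum//.
  - apply: eq_fsbigr => k _; rewrite /normal_prob.
    have [k0|k0] := leP 0 k.
      rewrite ge0_integralZl//.
      + congr (_ * _)%E; rewrite [LHS]integral_mkcond; apply: eq_integral => x _.
        by rewrite epatch_indic muleC.
      + apply: emeasurable_funM => //; exact/measurable_EFinP/measurable_indic.
      + by move=> x _; rewrite mule_ge0// lee_fin.
    (* A nonnegative simple function never takes a negative value, so this term vanishes. *)
    rewrite preimage_nnfun0// integral_set0 mule0 (eq_integral (cst 0%E)) ?integral0//.
    by move=> x _; rewrite indic0 /= mul0e mule0.
  - move=> k; apply: emeasurable_funM => //; apply: emeasurable_funM => //.
    exact/measurable_EFinP/measurable_indic.
  - move=> k x _; rewrite muleA mule_ge0//.
    exact: nnfun_muleindic_ge0.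
apply: eq_integral => x _; rewrite [in RHS]fimfunE -fsumEFin//=.
rewrite ge0_mule_fsuml//; first by apply: eq_fsbigr => k _; rewrite EFinM muleA.
by move=> k; rewrite EFinM; exact: nnfun_muleindic_ge0.
Qed.

End integral_transport.

Lemma measurable_lin2 (R : realType) (a b e : R) :
  measurable_fun [set: measurableTypeR R * measurableTypeR R]
   ((fun z => a * z.1 + b * z.2 + e) :
     (measurableTypeR R * measurableTypeR R)%type -> measurableTypeR R).
Proof.
apply: (measurable_funD (f := fun z : measurableTypeR R * measurableTypeR R => a * z.1 + b * z.2)) => //.
by apply: measurable_funD; apply: measurable_funM.
Qed.

Lemma measurable_lin22 (R : realType) (a b e a' b' e' : R) :
  measurable_fun [set: measurableTypeR R * measurableTypeR R]
   ((fun z => (a * z.1 + b * z.2 + e, a' * z.1 + b' * z.2 + e')) :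
     (measurableTypeR R * measurableTypeR R)%type -> (measurableTypeR R * measurableTypeR R)%type).
Proof. by apply: measurable_fun_pair; exact: measurable_lin2. Qed.

Lemma tonelli_curry d1 d2 (T1 : measurableType d1) (T2 : measurableType d2)
    (R : realType) (m1 : {sigma_finite_measure set T1 -> \bar R})
    (m2 : {sigma_finite_measure set T2 -> \bar R}) (f : T1 -> T2 -> \bar R) :
  measurable_fun [set: T1 * T2] (fun z => f z.1 z.2) ->
  (forall x y, 0 <= f x y)%E ->
  (\int[m1]_x \int[m2]_y f x y = \int[m2]_y \int[m1]_x f x y)%E.
Proof. by move=> mf f0; apply: (fubini_tonelli (fun z => f z.1 z.2)). Qed.

(** When [c != 0] the rotation is undone one variable at a time: an affine substitution in [x] with
    [y] fixed, an exchange of the integrals, then one in [y]. Both have Jacobian [|c^-1|], on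
    opposite sides of the equation. The quarter turns [c = 0] only exchange the variables up to sign
    and are treated apart. *)
Lemma ge0_integral2_rotation (R : realType) (c s : R)
    (F : (measurableTypeR R * measurableTypeR R)%type -> \bar R) :
  c ^+ 2 + s ^+ 2 = 1 ->
  measurable_fun setT F -> (forall z, 0 <= F z)%E ->
  (\int[lebesgue_measure]_x \int[lebesgue_measure]_y
     F (c * x - s * y, s * x + c * y)%R =
   \int[lebesgue_measure]_x \int[lebesgue_measure]_y F (x, y))%E.
Proof.
move=> cs1 mF F0.
have mF2 a b e a' b' e' : measurable_fun [set: measurableTypeR R * measurableTypeR R]
    (fun z : measurableTypeR R * measurableTypeR R => F (a * z.1 + b * z.2 + e, a' * z.1 + b' * z.2 + e')).
  exact: (measurableT_comp mF (measurable_lin22 a b e a' b' e')).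
have mF1 a b a' b' : measurable_fun [set: measurableTypeR R]
    (fun x : measurableTypeR R => F (a * x + b, a' * x + b')).
  apply: (measurableT_comp mF (f := F)) => //.
  by apply: measurable_fun_pair; exact: measurable_affine.
have [c0|c0] := eqVneq c 0.
  have s1 : `|s| = 1.
    by apply/eqP; rewrite -(@eqrXn2 _ 2)// expr1n real_normK ?num_real// -cs1 c0 expr0n add0r.
  have s0 : s != 0 by rewrite -normr_eq0 s1 oner_eq0.
  transitivity (\int[lebesgue_measure]_x \int[lebesgue_measure]_y F (y, s * x)%R)%E.
    apply: eq_integral => x _.
    rewrite (@ge0_integral_affine R (- s) 0 (fun y => F (y, s * x))) ?oppr_eq0//.
      rewrite normrN s1 mul1e; apply: eq_integral => y _.
      by rewrite c0 !mul0r sub0r !addr0 mulNr.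
    have := mF1 1 0 0 (s * x); under eq_fun do rewrite mul1r addr0 mul0r add0r.
    exact.
  rewrite (@tonelli_curry _ _ _ _ _ _ _ (fun x y : measurableTypeR R => F (y, s * x)))//; last first.
    have := mF2 0 1 0 s 0 0; under eq_fun do rewrite !mul0r mul1r !addr0 add0r.
    exact.
  apply: eq_integral => x _.
  rewrite [RHS](@ge0_integral_affine R s 0)//.
    by rewrite s1 mul1e; apply: eq_integral => y _; rewrite addr0.
  have := mF1 0 x 1 0; under eq_fun do rewrite mul1r addr0 mul0r add0r.
  exact.
rewrite (@tonelli_curry _ _ _ _ _ _ _ (fun x y : measurableTypeR R => F (c * x - s * y, s * x + c * y)))//; last first.
  have := mF2 c (- s) 0 s c 0; under eq_fun do rewrite !addr0 mulNr.
  exact.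
(* The substitution [x := c^-1 x + s y / c] turns the first coordinate into [x]; by [c^2 + s^2 = 1]
   the second one becomes [c^-1 y + (s / c) x]. *)
transitivity (\int[lebesgue_measure]_y (`|c^-1|%:E * \int[lebesgue_measure]_x F (x, c^-1 * y + s / c * x)%R))%E.
  apply: eq_integral => y _.
  rewrite [LHS](@ge0_integral_affine R c^-1 (s * y / c)) ?invr_eq0//.
    congr (_ * _)%E; apply: eq_integral => x _; congr (F (_, _)); first by field.
    rewrite -[c^-1 * y]mul1r -cs1; by field.
  have := mF1 c (- (s * y)) s (c * y); exact.
have mG : measurable_fun [set: measurableTypeR R * measurableTypeR R]
    (fun z : measurableTypeR R * measurableTypeR R => F (z.2, c^-1 * z.1 + s / c * z.2)).
  have := mF2 0 1 0 c^-1 (s / c) 0; under eq_fun do rewrite !addr0 mul0r mul1r add0r.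
  exact.
rewrite ge0_integralZl//; last 2 first.
  exact: (measurable_fun_fubini_tonelli_F (fun z : measurableTypeR R * measurableTypeR R => F (z.2, c^-1 * z.1 + s / c * z.2))).
  by move=> y _; apply: integral_ge0.
rewrite (@tonelli_curry _ _ _ _ _ _ _ (fun y x : measurableTypeR R => F (x, c^-1 * y + s / c * x)))//.
rewrite -ge0_integralZl//; last 2 first.
  exact: (measurable_fun_fubini_tonelli_G (fun z : measurableTypeR R * measurableTypeR R => F (z.2, c^-1 * z.1 + s / c * z.2))).
  by move=> y _; apply: integral_ge0.
apply: eq_integral => x _.
rewrite [RHS](@ge0_integral_affine R c^-1 (s / c * x)) ?invr_eq0//.
have := mF1 0 x 1 0; under eq_fun do rewrite mul1r addr0 mul0r add0r.
exact.
Qed.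

(** * Rotation invariance of the planar Gaussian and sums of independent Gaussians *)

Section gaussian.
Variable R : realType.
Local Notation mR := (measurableTypeR R).

(** Law of the real or imaginary part of a standard complex Gaussian: each has variance 1/2, so that
    [E|a|^2 = 1]. The density is a multiple of [exp (- x^2)]. *)
Definition gauss1 : probability mR R := normal_prob 0 (Num.sqrt (2^-1)).

Definition gauss_pdf (x : R) := normal_pdf 0 (Num.sqrt (2^-1 : R)) x.

Lemma sqrt2V_neq0 : Num.sqrt (2^-1 : R) != 0.
Proof. by rewrite gt_eqF// sqrtr_gt0 invr_gt0. Qed.

Lemma gauss_pdfE x : gauss_pdf x = normal_peak (Num.sqrt (2^-1 : R)) * expR (- x ^+ 2).
Proof.
rewrite /gauss_pdf normal_pdfE ?sqrt2V_neq0// /normal_fun subr0.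
have -> : Num.sqrt (2^-1 : R) ^+ 2 *+ 2 = 1.
  by rewrite sqr_sqrtr ?invr_ge0// -mulr_natr mulVf// pnatr_eq0.
by rewrite divr1.
Qed.

Lemma gauss_pdf_rotation x y u v : x ^+ 2 + y ^+ 2 = u ^+ 2 + v ^+ 2 ->
  gauss_pdf x * gauss_pdf y = gauss_pdf u * gauss_pdf v.
Proof.
move=> e; rewrite !gauss_pdfE mulrACA [RHS]mulrACA -!expRD.
by rewrite -!opprD e.
Qed.

Lemma ge0_integral_gauss1 (f : mR -> \bar R) :
  measurable_fun setT f -> (forall x, 0 <= f x)%E ->
  (\int[gauss1]_x f x =
   \int[lebesgue_measure]_x (f x * (gauss_pdf x)%:E))%E.
Proof. exact: ge0_integral_normal. Qed.

Lemma gauss_pdf_ge0 x : 0 <= gauss_pdf x.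
Proof. exact: normal_pdf_ge0. Qed.

Lemma measurable_gauss_pdf : measurable_fun [set: mR] (EFin \o gauss_pdf).
Proof. by apply/measurable_EFinP; exact: measurable_normal_pdf. Qed.

Lemma ge0_integral2_gauss1 (f : mR -> mR -> \bar R) :
  measurable_fun [set: mR * mR] (fun z => f z.1 z.2) -> (forall x y, 0 <= f x y)%E ->
  (\int[gauss1]_x \int[gauss1]_y f x y =
   \int[lebesgue_measure]_x \int[lebesgue_measure]_y
     (f x y * (gauss_pdf x * gauss_pdf y)%:E))%E.
Proof.
move=> mf f0.
rewrite ge0_integral_gauss1//; last 2 first.
  exact: (measurable_fun_fubini_tonelli_F (fun z => f z.1 z.2)).
  by move=> x; apply: integral_ge0.
apply: eq_integral => x _.
have mfx : measurable_fun [set: mR] (f x).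
  exact: (measurable_fun_pair2 x mf).
rewrite ge0_integral_gauss1// -ge0_integralZr//.
- by apply: eq_integral => y _; rewrite -muleA -EFinM [(gauss_pdf y * _)%R]mulrC.
- by apply: emeasurable_funM => //; exact: measurable_gauss_pdf.
- by move=> y _; rewrite mule_ge0// lee_fin gauss_pdf_ge0.
- by rewrite lee_fin gauss_pdf_ge0.
Qed.

Lemma gauss_rotation (c s : R) (f : mR -> mR -> \bar R) :
  c ^+ 2 + s ^+ 2 = 1 ->
  measurable_fun [set: mR * mR] (fun z => f z.1 z.2) -> (forall x y, 0 <= f x y)%E ->
  (\int[gauss1]_x \int[gauss1]_y f (c * x - s * y)%R (s * x + c * y)%R =
   \int[gauss1]_x \int[gauss1]_y f x y)%E.
Proof.
move=> cs1 mf f0.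
have mf' : measurable_fun [set: mR * mR] (fun z : mR * mR => f (c * z.1 - s * z.2) (s * z.1 + c * z.2)).
  have := measurableT_comp mf (measurable_lin22 c (- s) 0 s c 0); rewrite /comp /=.
  by under eq_fun do rewrite !addr0 mulNr.
have e1 := @ge0_integral2_gauss1 (fun x y => f (c * x - s * y) (s * x + c * y)) mf'
  (fun x y => f0 _ _).
have e2 := @ge0_integral2_gauss1 f mf f0.
apply: (etrans e1); apply: (etrans _ (esym e2)).
have mg : measurable_fun [set: mR * mR]
    (fun z : mR * mR => f z.1 z.2 * (gauss_pdf z.1 * gauss_pdf z.2)%:E)%E.
  apply: emeasurable_funM => //; apply/measurable_EFinP.
  by apply: measurable_funM; apply: (measurableT_comp (measurable_normal_pdf _ _)).
have g0 (z : mR * mR) : (0 <= f z.1 z.2 * (gauss_pdf z.1 * gauss_pdf z.2)%:E)%E.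
  by rewrite mule_ge0// lee_fin mulr_ge0// gauss_pdf_ge0.
apply: (etrans _ (ge0_integral2_rotation cs1 mg g0)).
apply: eq_integral => x _; apply: eq_integral => y _; congr (_ * _%:E)%E.
apply: gauss_pdf_rotation; move: x y => /= x y.
transitivity ((c ^+ 2 + s ^+ 2) * (x ^+ 2 + y ^+ 2) : R); first by rewrite cs1 mul1r.
by move: (x : R) (y : R) => {x y} x y; ring.
Qed.

(** [k x + r y] is [t] times the first coordinate of a rotated vector, with [t^2 = k^2 + r^2]; after
    the rotation the other coordinate integrates to 1. *)
Lemma gauss_add1 (k r : R) (h : mR -> \bar R) :
  measurable_fun setT h -> (forall x, 0 <= h x)%E ->
  (\int[gauss1]_x \int[gauss1]_y h (k * x + r * y)%R =
   \int[gauss1]_x h (Num.sqrt (k ^+ 2 + r ^+ 2) * x)%R)%E.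
Proof.
move=> mh h0; set t := Num.sqrt _.
have t2 : t ^+ 2 = k ^+ 2 + r ^+ 2 by rewrite sqr_sqrtr// addr_ge0// sqr_ge0.
have intc (e : \bar R) : (\int[gauss1]_y e = e)%E.
  by rewrite integral_cst//= probability_setT mule1.
have [t0|t0] := eqVneq t 0.
  move: t2; rewrite t0 expr0n/= => /esym/eqP; rewrite paddr_eq0 ?sqr_ge0// !sqrf_eq0.
  move=> /andP[/eqP -> /eqP ->].
  apply: eq_integral => x _; under eq_integral do rewrite !mul0r addr0.
  by rewrite intc mul0r.
have cs1 : (k / t) ^+ 2 + (- r / t) ^+ 2 = 1.
  by rewrite !expr_div_n sqrrN -mulrDl -t2 divff// sqrf_eq0.
have mf : measurable_fun [set: mR * mR] (fun z : mR * mR => h (t * z.1)).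
  apply: (measurableT_comp mh).
  have := measurable_lin2 t 0 0; under eq_fun do rewrite mul0r !addr0.
  exact.
have := @gauss_rotation _ _ (fun x y => h (t * x)) cs1 mf (fun x y => h0 _).
move=> e; apply: etrans; last (apply: etrans; first exact: e).
  apply: eq_integral => x _; apply: eq_integral => y _; congr (h _).
  by move: (x : R) (y : R) => {x y} x y; field.
by apply: eq_integral => x _; rewrite intc.
Qed.

(** This is the law of [k w + (a + i b) z] for independent complex Gaussians [w] and [z]. Writing
    [a + i b = r e^(i theta)], the phase is absorbed by a rotation of [z]; with a real factor [r]
    the two coordinates decouple and [gauss_add1] applies to each. *)
Lemma gauss_add2 (k a b : R) (f : mR -> mR -> \bar R) :
  measurable_fun [set: mR * mR] (fun z => f z.1 z.2) -> (forall x y, 0 <= f x y)%E ->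
  (\int[gauss1]_u \int[gauss1]_v \int[gauss1]_x \int[gauss1]_y
     f (k * u + a * x - b * y)%R (k * v + b * x + a * y)%R =
   \int[gauss1]_x \int[gauss1]_y
     f (Num.sqrt (k ^+ 2 + (a ^+ 2 + b ^+ 2)) * x)%R
       (Num.sqrt (k ^+ 2 + (a ^+ 2 + b ^+ 2)) * y)%R)%E.
Proof.
move=> mf f0; set r := Num.sqrt (a ^+ 2 + b ^+ 2).
have r2 : r ^+ 2 = a ^+ 2 + b ^+ 2 by rewrite sqr_sqrtr// addr_ge0// sqr_ge0.
rewrite -r2; set t := Num.sqrt _.
have mfl c1 c2 c3 c4 c5 c6 : measurable_fun [set: mR * mR]
    (fun z : mR * mR => f (c1 * z.1 + c2 * z.2 + c3) (c4 * z.1 + c5 * z.2 + c6)).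
  exact: (measurableT_comp mf (measurable_lin22 c1 c2 c3 c4 c5 c6)).
have [c [s [cs1 ac bs]]] : exists c s, [/\ c ^+ 2 + s ^+ 2 = 1, a = r * c & b = r * s].
  have [r0|r0] := eqVneq r 0.
    exists 1, 0; rewrite expr1n expr0n addr0; split => //; rewrite r0 mul0r;
    by move: r2; rewrite r0 expr0n/= => /esym/eqP; rewrite paddr_eq0 ?sqr_ge0// !sqrf_eq0 => /andP[/eqP ? /eqP ?].
  exists (a / r), (b / r); split; [|by rewrite mulrC divfK|by rewrite mulrC divfK].
  by rewrite !expr_div_n -mulrDl -r2 divff// sqrf_eq0.
transitivity (\int[gauss1]_u \int[gauss1]_v \int[gauss1]_x \int[gauss1]_y
     f (k * u + r * x)%R (k * v + r * y)%R)%E.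
  apply: eq_integral => u _; apply: eq_integral => v _.
  have mg : measurable_fun [set: mR * mR] (fun z : mR * mR => f (k * u + r * z.1) (k * v + r * z.2)).
    have := mfl r 0 (k * u) 0 r (k * v).
    by under eq_fun do rewrite !mul0r addr0 add0r addrC (addrC (r * _)).
  rewrite -(@gauss_rotation _ _ (fun x y => f (k * u + r * x) (k * v + r * y)) cs1 mg)//.
  apply: eq_integral => x _; apply: eq_integral => y _.
  move: (x : R) (y : R) (u : R) (v : R) => {x y mg}x y {}u {}v.
  by congr (f _ _); rewrite ac bs; ring.
have m3 (u : mR) : measurable_fun [set: (mR * mR) * mR]
   (fun z : (mR * mR) * mR => f (k * u + r * z.1.2) (k * z.1.1 + r * z.2)).
  have m1 : measurable_fun [set: (mR * mR) * mR]
      (fun z : (mR * mR) * mR => k * u + r * z.1.2 : R).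
    apply: measurable_funD => //; apply: measurable_funM => //.
    exact: (measurableT_comp measurable_snd).
  have m2 : measurable_fun [set: (mR * mR) * mR]
      (fun z : (mR * mR) * mR => k * z.1.1 + r * z.2 : R).
    apply: measurable_funD; apply: measurable_funM => //.
    exact: (measurableT_comp measurable_fst).
  exact: (measurableT_comp mf (measurable_fun_pair m1 m2)).
transitivity (\int[gauss1]_u \int[gauss1]_x \int[gauss1]_v f (k * u + r * x)%R (t * v)%R)%E.
  apply: eq_integral => u _.
  rewrite (@tonelli_curry _ _ _ _ _ _ _ (fun v x : mR => \int[gauss1]_y f (k * u + r * x)%R (k * v + r * y)%R)%E)//; last 2 first.
    exact: (measurable_fun_fubini_tonelli_F (fun z : (mR * mR) * mR => f (k * u + r * z.1.2) (k * z.1.1 + r * z.2))).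
    by move=> v x; apply: integral_ge0.
  apply: eq_integral => x _.
  by rewrite (@gauss_add1 k r (f (k * u + r * x)))//; exact: (measurable_fun_pair2 _ mf).
rewrite (@gauss_add1 k r (fun w => \int[gauss1]_v f w (t * v)%R)%E)//; last first.
  by move=> x; apply: integral_ge0.
apply: (measurable_fun_fubini_tonelli_F (fun z : mR * mR => f z.1 (t * z.2)%R)) => //.
have := mfl 1 0 0 0 t 0; by under eq_fun do rewrite mul1r !mul0r !addr0 add0r.
Qed.
End gaussian.

(** * The joint law of linear forms in the coefficients *)

Section gaussian_law.
Variable R : realType.
Local Notation mR := (measurableTypeR R).

Lemma measurable_scale2 (k : R) :
  measurable_fun [set: mR * mR]
    ((fun z => (k * z.1, k * z.2)) : (mR * mR)%type -> (mR * mR)%type).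
Proof.
have := measurable_lin22 k 0 0 0 k 0.
by under eq_fun do rewrite !mul0r !addr0 add0r.
Qed.

(** Law of a centred complex Gaussian [Z] with [E|Z|^2 = K]. As a pushforward it also covers
    [K = 0], the Dirac mass at the origin, which has no density and starts the induction on the
    number of terms. *)
Definition gauss2 (K : R) : set (mR * mR) -> \bar R :=
  pushforward (@gauss1 R \x @gauss1 R)%E
    ((fun z => (Num.sqrt K * z.1, Num.sqrt K * z.2)) : (mR * mR)%type -> (mR * mR)%type).

HB.instance Definition _ (K : R) := Measure.copy (gauss2 K)
  (image_measure (@gauss1 R \x @gauss1 R)%E (measurable_scale2 (Num.sqrt K))).

Lemma gauss2_setT (K : R) : gauss2 K setT = 1%E.
Proof. by rewrite /gauss2 /pushforward preimage_setT probability_setT. Qed.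

HB.instance Definition _ (K : R) :=
  Measure_isProbability.Build _ _ _ (gauss2 K) (gauss2_setT K).

Lemma ge0_integral_gauss2 (K : R) (f : (mR * mR)%type -> \bar R) :
  measurable_fun setT f -> (forall z, 0 <= f z)%E ->
  (\int[gauss2 K]_z f z =
   \int[@gauss1 R]_x \int[@gauss1 R]_y f (Num.sqrt K * x, Num.sqrt K * y)%R)%E.
Proof.
move=> mf f0.
rewrite (ge0_integral_pushforward (measurable_scale2 (Num.sqrt K)))//.
rewrite fubini_tonelli1//.
exact: (measurableT_comp mf (measurable_scale2 (Num.sqrt K))).
by move=> z; exact: f0.
Qed.

(** The induction invariant for building a random variable from the family [X]: [U] has law [mu] and
    is independent of the finite subfamilies with indices outside [used]. The law of [U] itself is
    the case of empty [J]. *)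
Definition law_indep {d} {Omega : measurableType d} (P : probability Omega R)
    {I : eqType} (X : I -> Omega -> R) {d'} {T : measurableType d'} (U : Omega -> T)
    (mu : set T -> \bar R) (used : pred I) :=
  measurable_fun setT U /\
  forall (J : seq I) (B : I -> set R) (C : set T), uniq J ->
    (forall i, i \in J -> ~~ used i) -> (forall i, i \in J -> measurable (B i)) ->
    measurable C ->
    (P (U @^-1` C `&` \bigcap_(i in [set i | i \in J]) (X i @^-1` B i)) =
     mu C * \prod_(i <- J) P (X i @^-1` B i))%E.

Section step.
Context d (Omega : measurableType d) (P : probability Omega R) (I : eqType)
  (X : I -> Omega -> R) d' (T : measurableType d') (U : Omega -> T).
Hypothesis mX : forall i, measurable_fun setT (X i).

Lemma measurable_bigcap_seq (J : seq I) (B : I -> set R) :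
  (forall i, i \in J -> measurable (B i)) ->
  measurable (\bigcap_(i in [set i | i \in J]) (X i @^-1` B i)).
Proof.
move=> mB; apply: fin_bigcap_measurable; first exact: finite_seq.
by move=> i /= iJ; rewrite -[X in measurable X]setTI; apply: mX => //; exact: mB.
Qed.

Lemma law_indep_comp d2 (T2 : measurableType d2) (mu : set T -> \bar R)
   (mu2 : set T2 -> \bar R) (h : T -> T2) (used : pred I) :
  measurable_fun setT h ->
  (forall C, measurable C -> mu (h @^-1` C) = mu2 C) ->
  law_indep P X U mu used -> law_indep P X (h \o U) mu2 used.
Proof.
move=> mh hmu [mU HU]; split; first exact: measurableT_comp.
move=> J B C uJ Jused mB mC; rewrite comp_preimage HU// ?hmu//.
by rewrite -[X in measurable X]setTI; exact: mh.
Qed.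

Lemma law_indep_sub (mu : set T -> \bar R) (used used' : pred I) :
  (forall i, used i -> used' i) ->
  law_indep P X U mu used -> law_indep P X U mu used'.
Proof.
move=> sub [mU HU]; split => // J B C uJ Jused mB mC; apply: HU => // i /Jused.
exact/contra/sub.
Qed.

(** On rectangles the claim is the hypothesis applied to [k :: J]. To reach all measurable sets, the
    law of [(U, X k)] conditioned on the remaining event [E] is a measure that agrees with
    [mu \x nu] on rectangles, and product measures are unique. *)
Lemma law_indep_step (mu : {sigma_finite_measure set T -> \bar R})
   (nu : {sigma_finite_measure set mR -> \bar R}) (k : I) (used : pred I) :
  ~~ used k -> (forall B, measurable B -> P (X k @^-1` B) = nu B) ->
  law_indep P X U mu used ->
  law_indep P X (fun w => (U w, X k w) : T * mR) (mu \x nu)%E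
     (fun i => (i == k) || used i).
Proof.
move=> usedk Xk [mU HU].
have mUX : measurable_fun setT (fun w => (U w, X k w) : T * mR).
  by apply: measurable_fun_pair => //; exact: mX.
split=> // J B C uJ Jused mB mC.
set E := \bigcap_(i in _) _; have mE : measurable E by exact: measurable_bigcap_seq.
set q := (\prod_(i <- J) _)%E.
have qfin : q \is a fin_num.
  by rewrite /q big_seq; apply: prode_fin_num => i iJ; apply: fin_num_measure;
    rewrite -[X in measurable X]setTI; apply: mX => //; exact: mB.
have q0 : (0 <= q)%E by apply: prode_ge0 => i _.
have rect A D : measurable A -> measurable D ->
    (P ((fun w => (U w, X k w) : T * mR) @^-1` (A `*` D) `&` E) = mu A * nu D * q)%E.
  move=> mA mD.
  pose B' i := if i == k then D else B i.
  have kJ : k \notin J by apply/negP => /Jused; rewrite eqxx.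
  have eJ : (\prod_(i <- J) P (X i @^-1` B' i) = q)%E.
    rewrite /q !big_seq; apply: eq_bigr => i iJ; rewrite /B'.
    by case: eqP => // ik; move: kJ; rewrite -ik iJ.
  have := HU (k :: J) B' A.
  rewrite /= kJ uJ => /(_ isT); rewrite big_cons.
  have -> : B' k = D by rewrite /B' eqxx.
  rewrite Xk// eJ muleA => <-//.
  - congr (P _); apply/seteqP; split => w /=.
      move=> [[UA XD] Ew]; split => // i /=; rewrite in_cons /B'.
      by case: eqP => [->|_] //= iJ; exact: Ew.
    move=> [UA H]; split; first by split => //; have := H k; rewrite /B' /= eqxx mem_head; exact.
    move=> i /= iJ; have := H i; rewrite /B' /= in_cons iJ orbT => /(_ isT).
    by case: eqP => // ik; move: kJ; rewrite -ik iJ.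
  - by move=> i; rewrite in_cons => /orP[/eqP->//|/Jused]; rewrite negb_or => /andP[].
  - by move=> i; rewrite in_cons /B'; case: eqP => //= _; exact: mB.
(* Conditioning divides by [q], so the case where [E] is a null event is settled separately by
   monotonicity. *)
have [q00|qn0] := eqVneq q 0%E.
  rewrite q00 mule0; apply/eqP; rewrite -measure_le0.
  have HE : P E = 0%E.
    have := HU J B setT uJ; rewrite preimage_setT setTI -/E -/q q00 mule0; apply => //.
    by move=> i /Jused; rewrite negb_or => /andP[].
  rewrite -HE; apply: le_measure; rewrite ?inE//.
    apply: measurableI => //; rewrite -[X in measurable X]setTI; exact: mUX.
have r0 : 0 < fine q by rewrite fine_gt0// lt0e qn0 q0 ltey_eq qfin.
have rV0 : 0 <= (fine q)^-1 by rewrite invr_ge0 ltW.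
pose m' : {measure set (T * mR) -> \bar R} :=
  mscale (NngNum rV0) (image_measure (mrestr P mE) mUX).
have m'E : m' = (fun D => (fine q)^-1%:E * P ((fun w => (U w, X k w) : T * mR) @^-1` D `&` E))%E :> (set _ -> _).
  by [].
have e : (mu \x nu)%E C = m' C.
  apply: product_measure_unique => // A D mA mD.
  by rewrite m'E rect// -[q]fineK// muleC -muleA -EFinM divff ?mule1// gt_eqF.
transitivity (m' C * q)%E; last by congr (_ * _)%E; exact: esym e.
by rewrite m'E muleAC -[q in RHS]fineK// -EFinM mulVf ?mul1e// gt_eqF.
Qed.
End step.

Lemma law_indep_step2 d (Omega : measurableType d) (P : probability Omega R) (I : eqType)
    (X : I -> Omega -> R) d' (T : measurableType d') (U : Omega -> T)
    (mu : probability T R)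
    (nu : probability mR R) (k1 k2 : I) (used : pred I) :
  (forall i, measurable_fun setT (X i)) ->
  ~~ used k1 -> ~~ ((k2 == k1) || used k2) ->
  (forall B, measurable B -> P (X k1 @^-1` B) = nu B) ->
  (forall B, measurable B -> P (X k2 @^-1` B) = nu B) ->
  law_indep P X U mu used ->
  law_indep P X (fun w => (U w, X k1 w, X k2 w) : T * mR * mR) ((mu \x nu) \x nu)%E
     (fun i => (i == k2) || ((i == k1) || used i)).
Proof.
move=> mX uk1 uk2 X1 X2 HU; have H1 := law_indep_step mX uk1 X1 HU.
pose m12 : probability (T * mR)%type R := (mu \x nu)%E.
exact: (law_indep_step (mu := m12) mX uk2 X2 H1).
Qed.

Lemma measurable_gauss2_step (a b : R) : measurable_fun [set: (mR * mR) * mR * mR]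
   (fun z => (z.1.1.1 + a * z.1.2 - b * z.2, z.1.1.2 + b * z.1.2 + a * z.2) : mR * mR).
Proof.
have m11 : measurable_fun [set: (mR * mR) * mR * mR] (fun z : (mR * mR) * mR * mR => z.1.1.1 : R).
  exact: (measurableT_comp measurable_fst (measurableT_comp measurable_fst measurable_fst)).
have m12 : measurable_fun [set: (mR * mR) * mR * mR] (fun z : (mR * mR) * mR * mR => z.1.1.2 : R).
  exact: (measurableT_comp measurable_snd (measurableT_comp measurable_fst measurable_fst)).
have m2 : measurable_fun [set: (mR * mR) * mR * mR] (fun z : (mR * mR) * mR * mR => z.1.2 : R).
  exact: (measurableT_comp measurable_snd measurable_fst).
have m3 : measurable_fun [set: (mR * mR) * mR * mR] (fun z : (mR * mR) * mR * mR => z.2 : R).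
  exact: measurable_snd.
have mx : measurable_fun [set: (mR * mR) * mR * mR]
    (fun z : (mR * mR) * mR * mR => z.1.1.1 + a * z.1.2 - b * z.2 : R).
  by apply: measurable_funB; [apply: measurable_funD => //|]; apply: measurable_funM.
have my : measurable_fun [set: (mR * mR) * mR * mR]
    (fun z : (mR * mR) * mR * mR => z.1.1.2 + b * z.1.2 + a * z.2 : R).
  by apply: measurable_funD; [apply: measurable_funD => //|]; apply: measurable_funM.
exact: (measurable_fun_pair mx my).
Qed.

Lemma integral_indicT d (T : measurableType d) (mu : {measure set T -> \bar R}) (C : set T) :
  measurable C -> (\int[mu]_z (\1_C z)%:E = mu C)%E.
Proof. by move=> mC; rewrite integral_indic// setIT. Qed.

Lemma product_measure3E (m : {sigma_finite_measure set (mR * mR)%type -> \bar R})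
    (D : set ((mR * mR) * mR * mR)%type) : measurable D ->
  ((m \x @gauss1 R) \x @gauss1 R)%E D =
  (\int[m]_u \int[@gauss1 R]_x \int[@gauss1 R]_y (\1_D (u, x, y))%:E)%E.
Proof.
move=> mD; pose F (z : (mR * mR) * mR * mR) : \bar R := (\1_D z)%:E.
have mF : measurable_fun setT F by exact/measurable_EFinP/measurable_indic.
have F0 z : (0 <= F z)%E by rewrite lee_fin.
pose g1 (w : (mR * mR) * mR) : \bar R := (\int[@gauss1 R]_y F (w, y))%E.
have mg1 : measurable_fun setT g1 by exact: (measurable_fun_fubini_tonelli_F F).
have g10 w : (0 <= g1 w)%E by apply: integral_ge0.
have e w : @gauss1 R (xsection D w) = g1 w.
  have I := integral_indic (@gauss1 R) measurableT (measurable_xsection w mD).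
  rewrite setIT in I; rewrite -I; apply: eq_integral => y _; rewrite /F !indicE.
  by rewrite mem_xsection.
transitivity (\int[(m \x @gauss1 R)%E]_w g1 w)%E.
  by rewrite [LHS]/product_measure1; apply: eq_integral => w _; exact: e.
exact: (fubini_tonelli1 g1 mg1 g10).
Qed.

(** Adding the complex term [(a + i b)(x + i y)] to an independent Gaussian of variance [K]
    increases the variance by [|a + i b|^2]: this is [gauss_add2] with [k = sqrt K], applied to
    indicators. *)
Lemma gauss2_step (K a b : R) (C : set (mR * mR)) : 0 <= K -> measurable C ->
  ((gauss2 K \x @gauss1 R) \x @gauss1 R)%E
   ((fun z : (mR * mR) * mR * mR =>
      (z.1.1.1 + a * z.1.2 - b * z.2, z.1.1.2 + b * z.1.2 + a * z.2) : mR * mR) @^-1` C) =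
  gauss2 (K + (a ^+ 2 + b ^+ 2)) C.
Proof.
move=> K0 mC; set h := (fun z : (mR * mR) * mR * mR => _).
have mh : measurable_fun setT h by exact: measurable_gauss2_step.
have mhC : measurable (h @^-1` C) by rewrite -[X in measurable X]setTI; exact: mh.
pose f (x y : mR) : \bar R := (\1_C (x, y))%:E.
have mf : measurable_fun [set: mR * mR] (fun z => f z.1 z.2).
  rewrite (_ : (fun z => _) = EFin \o \1_C); last by apply/funext => -[].
  exact/measurable_EFinP/measurable_indic.
have f0 x y : (0 <= f x y)%E by rewrite lee_fin.
have I2 : (\int[gauss2 (K + (a ^+ 2 + b ^+ 2))]_z (\1_C z)%:E = gauss2 (K + (a ^+ 2 + b ^+ 2)) C)%E.
  exact: integral_indicT.
apply: (etrans (product_measure3E (gauss2 K) mhC)).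
apply: (etrans _ I2).
have E2 : (\int[gauss2 (K + (a ^+ 2 + b ^+ 2))]_z (\1_C z)%:E =
   \int[@gauss1 R]_x \int[@gauss1 R]_y f (Num.sqrt (K + (a ^+ 2 + b ^+ 2)) * x)%R (Num.sqrt (K + (a ^+ 2 + b ^+ 2)) * y)%R)%E.
  by rewrite (@ge0_integral_gauss2 _ (fun z => (\1_C z)%:E))//; exact/measurable_EFinP/measurable_indic.
apply: (etrans _ (esym E2)).
have E3 := @gauss_add2 R (Num.sqrt K) a b f mf f0.
have K2 : Num.sqrt K ^+ 2 = K := sqr_sqrtr K0; rewrite K2 in E3.
apply: (etrans _ E3).
pose g1 (w : (mR * mR) * mR) : \bar R := (\int[@gauss1 R]_y (\1_(h @^-1` C) (w, y))%:E)%E.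
have mF : measurable_fun setT (fun z : (mR * mR) * mR * mR => (\1_(h @^-1` C) z)%:E : \bar R).
  exact/measurable_EFinP/measurable_indic.
have mg1 : measurable_fun setT g1.
  by apply: (measurable_fun_fubini_tonelli_F (fun z : (mR * mR) * mR * mR => (\1_(h @^-1` C) z)%:E)) => // z; rewrite lee_fin.
have g10 w : (0 <= g1 w)%E by apply: integral_ge0 => y _; rewrite lee_fin.
pose g2 (u : mR * mR) : \bar R := (\int[@gauss1 R]_x g1 (u, x))%E.
have mg2 : measurable_fun setT g2 by exact: (measurable_fun_fubini_tonelli_F g1).
have g20 u : (0 <= g2 u)%E by apply: integral_ge0.
exact: (ge0_integral_gauss2 K mg2 g20).
Qed.

Lemma gauss2_0 (C : set (mR * mR)) : gauss2 0 C = (\1_C (0, 0))%:E.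
Proof.
rewrite indicE; have [C0|C0] := boolP ((0, 0) \in C).
  have e : (fun z : mR * mR => (Num.sqrt 0 * z.1, Num.sqrt 0 * z.2) : mR * mR) @^-1` C = setT.
    by apply/seteqP; split => // z _ /=; rewrite sqrtr0 !mul0r; rewrite inE in C0.
  by rewrite /gauss2 /pushforward e probability_setT.
have e : (fun z : mR * mR => (Num.sqrt 0 * z.1, Num.sqrt 0 * z.2) : mR * mR) @^-1` C = set0.
  by apply/seteqP; split => // z /=; rewrite sqrtr0 !mul0r; rewrite notin_setE in C0.
by rewrite /gauss2 /pushforward e measure0.
Qed.

Section gaussian_sum.
Context d (Omega : measurableType d) (P : probability Omega R) (a : nat -> Omega -> R[i]).
Hypothesis ga : iid_std_complex_gaussian P a.

Definition sqnormc (z : R[i]) : R := complex.Re z ^+ 2 + complex.Im z ^+ 2.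

(** Stated with independence of all later coefficients, not only with the law of the sum, so that
    the induction on [n] can adjoin [Re (a n)] and [Im (a n)]. *)
Lemma law_gaussian_sum (c : nat -> R[i]) (n : nat) :
  law_indep P (re_im_part a)
    (fun w => let z := \sum_(m < n) c m * a m w in (complex.Re z, complex.Im z) : mR * mR)
    (gauss2 (\sum_(m < n) sqnormc (c m)))
    (fun k => (k.1 < n)%N).
Proof.
have [ma [ia na]] := ga.
elim: n => [|n IH].
  split.
    rewrite (_ : (fun w => _) = cst (0, 0)) //.
    by apply/funext => w /=; rewrite big_ord0.
  move=> J B C uJ _ mB mC.
  rewrite -ia//.
  have G : gauss2 (\sum_(m < 0) sqnormc (c m)) C = (\1_C (0, 0))%:E by rewrite big_ord0 gauss2_0.
  apply: (etrans _ (congr1 (fun t => t * _)%E (esym G))).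
  rewrite indicE; have [|] := boolP ((0, 0) \in C); rewrite ?inE ?notin_setE => C0.
    rewrite (_ : _ @^-1` C = setT) ?setTI ?mul1e//.
    by apply/seteqP; split => // w _ /=; rewrite big_ord0.
  rewrite (_ : _ @^-1` C = set0) ?set0I ?measure0 ?mul0e//.
  by apply/seteqP; split => // w /=; rewrite big_ord0.
have K0 : 0 <= \sum_(m < n) sqnormc (c m) by apply: sumr_ge0 => i _; rewrite addr_ge0 ?sqr_ge0.
have naB k B : measurable B -> P (re_im_part a k @^-1` B) = @gauss1 R B by exact: na.
have n1 : ~~ ((n, true).1 < n)%N by rewrite /= ltnn.
have n2 : ~~ (((n, false) == (n, true)) || ((n, false).1 < n)%N).
  by rewrite /= ltnn orbF; apply/eqP => -[].
have IH2 := @law_indep_step2 _ Omega P _ (re_im_part a) _ _ _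
  (gauss2 (\sum_(m < n) sqnormc (c m))) (@gauss1 R) (n, true) (n, false) (fun k => (k.1 < n)%N)
  ma n1 n2 (naB (n, true)) (naB (n, false)) IH.
pose h := (fun z : (mR * mR) * mR * mR => (z.1.1.1 + complex.Re (c n) * z.1.2 - complex.Im (c n) * z.2,
   z.1.1.2 + complex.Im (c n) * z.1.2 + complex.Re (c n) * z.2) : mR * mR).
have IH3 := law_indep_comp (h := h) (mu2 := gauss2 (\sum_(m < n.+1) sqnormc (c m)))
   (measurable_gauss2_step _ _) _ IH2.
apply: law_indep_sub; last first.
  rewrite (_ : (fun w => _) = h \o (fun w : Omega =>
    (let z := \sum_(m < n) c m * a m w in (complex.Re z, complex.Im z),
     re_im_part a (n, true) w, re_im_part a (n, false) w))).
    by apply: IH3 => C mC; rewrite big_ord_recr /=; exact: gauss2_step.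
  apply/funext => w /=; rewrite big_ord_recr /= /h /re_im_part /=.
  case: (\sum_(m < n) _) => x y; case: (c n) => u v; case: (a n w) => s t /=.
  by congr (_, _); ring.
by move=> [k b]/= /or3P[/eqP[-> _]|/eqP[-> _]|/ltnW]//; rewrite ltnS.
Qed.

Lemma law_gaussian_linear_form (c : nat -> R[i]) (n : nat) (C : set (mR * mR)) :
  measurable C ->
  P ((fun w => let z := \sum_(m < n) c m * a m w in (complex.Re z, complex.Im z) : mR * mR) @^-1` C)
  = gauss2 (\sum_(m < n) sqnormc (c m)) C.
Proof.
move=> mC; have [_ /(_ [::] (fun=> setT) C)] := law_gaussian_sum c n.
rewrite big_nil mule1 => <-//; congr (P _).
by rewrite (_ : [set i | i \in [::]] = set0) ?bigcap_set0 ?setIT//; apply/seteqP; split.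
Qed.
End gaussian_sum.
End gaussian_law.

(** * Integration by parts in the plane *)

Section plane.
Variable R : realType.
Local Notation mR := (measurableTypeR R).
Local Notation leb := (@lebesgue_measure R).
Local Notation leb2 := (@lebesgue_measure R \x @lebesgue_measure R)%E.

(** Reconciles the product topology with the product sigma-algebra: an open set is the countable
    union of the open rectangles with rational corners that it contains. Continuous functions of two
    variables are measurable because of it. *)
Lemma open_measurable2 (O : set (R * R)) : open O -> measurable (O : set (mR * mR)).
Proof.
move=> oO.
pose Q := (rat * rat * (rat * rat))%type.
pose rect (q : Q) : set (mR * mR) :=
  [set` `]ratr q.1.1, ratr q.1.2[] `*` [set` `]ratr q.2.1, ratr q.2.2[].
have -> : O = \bigcup_(q in [set: Q]) (if pselect (rect q `<=` O) then rect q else set0).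
  apply/seteqP; split => [[x y] Oxy|z [q _]]; last by case: pselect => // sub /sub.
  have /= : nbhs (x, y) O by exact: open_nbhs_nbhs.
  move=> [[A B] /= [/nbhs_ballP[e e0 eA] /nbhs_ballP[e' e'0 eB]] AB].
  have itv (t : R) (r : R) : 0 < r -> exists ab : rat * rat,
      (t \in `](ratr ab.1), (ratr ab.2)[) /\ [set` `](ratr ab.1), (ratr ab.2)[] `<=` ball t r.
    move=> r0.
    have /rat_in_itvoo[a] : t - r < t by rewrite ltrBlDr ltrDl.
    have /rat_in_itvoo[b] : t < t + r by rewrite ltrDl.
    rewrite !in_itv/= => /andP[tb br] /andP[ra at_]; exists (a, b) => /=; split.
      by rewrite in_itv/= at_.
    move=> u; rewrite /= in_itv/= => /andP[au ub]; rewrite /ball/= ltr_distlC.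
    by apply/andP; split; [exact: lt_trans au|exact: lt_trans ub _].
  have [[a b] [xab abA]] := itv x e e0; rewrite /= in xab abA.
  have [[c d] [xcd cdB]] := itv y e' e'0.
  exists (a, b, (c, d)) => //; case: pselect => [sub|nsub]; first by split.
  exfalso; apply: nsub => -[u v] [/= uab vcd]; apply: (AB (u, v)) => /=.
  by split; [exact: eA (abA _ uab)|exact: eB (cdB _ vcd)].
apply: countable_bigcupT_measurable; first exact: countableP.
move=> q; case: pselect => sub; last exact: measurable0.
by apply: measurableX; exact: measurable_itv.
Qed.

Lemma continuous_measurable2 (h : R * R -> R) :
  continuous h -> measurable_fun [set: mR * mR] h.
Proof.
move=> ch; apply: (measurability _ (RGenOInfty.measurableE R)) => //.
move=> /= _ [_ [x ->] <-]; apply: measurableI => //.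
apply: open_measurable2; apply: open_comp; first by move=> z _; exact: ch.
exact: interval_open.
Qed.

Lemma bounded_support_integrable2 (h : mR * mR -> R) (A M : R) :
  measurable_fun setT h -> (forall z, `|h z| <= M) ->
  (forall z, h z != 0 -> `|z.1| <= A /\ `|z.2| <= A) ->
  leb2.-integrable setT (EFin \o h).
Proof.
move=> mh hM hA.
pose S : set (mR * mR) := [set` `[- A, A]] `*` [set` `[- A, A]].
have mS : measurable S by apply: measurableX; exact: measurable_itv.
apply: (@le_integrable _ _ _ _ _ _ _ (fun z => M%:E * (\1_S z)%:E)%E) => //.
- exact/measurable_EFinP.
- move=> z _; rewrite -EFinM /= lee_fin.
  have [/eqP->|hz] := boolP (h z == 0); first by rewrite normr0.
  have [z1 z2] := hA z hz.
  rewrite indicE mem_set; last by split; rewrite /= in_itv/= -ler_norml.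
  by rewrite mulr1 (le_trans (hM z))// ler_norm.
- apply: integrableZl => //; apply/integrableP; split.
    exact/measurable_EFinP/measurable_indic.
  under eq_integral do rewrite gee0_abs ?lee_fin//.
  rewrite integral_indic// setIT [ltLHS]product_measure1E//; try exact: measurable_itv.
  have fin : (leb [set` `[(- A)%R, A]] < +oo)%E.
    by rewrite lebesgue_measure_itv/=; case: ifP => _; rewrite -?EFinB ltry.
  by apply: lte_mul_pinfty => //; rewrite ge0_fin_numE.
Qed.

Lemma continuous_support_bounded2 (h : R * R -> R) (A : R) :
  continuous h -> (forall z, h z != 0 -> `|z.1| <= A /\ `|z.2| <= A) ->
  exists M, forall z, `|h z| <= M.
Proof.
move=> ch hA.
have cpt : compact ([set` `[- A, A]] `*` [set` `[- A, A]] : set (R * R)).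
  by apply: compact_setX; exact: segment_compact.
have /compact_bounded[M [_ mrt]] : compact (h @` ([set` `[- A, A]] `*` [set` `[- A, A]])).
  by apply: continuous_compact => //; apply: continuous_subspaceT.
have M1 : M < `|M| + 1 by rewrite (le_lt_trans (ler_norm M))// ltrDl.
exists (`|M| + 1) => z.
have [/eqP->|hz] := boolP (h z == 0); first by rewrite normr0 addr_ge0.
have [z1 z2] := hA z hz; apply: (mrt _ M1); exists z => //.
by split; rewrite /= in_itv/= -ler_norml.
Qed.

Lemma continuous_support_integrable2 (h : R * R -> R) (A : R) :
  continuous h -> (forall z, h z != 0 -> `|z.1| <= A /\ `|z.2| <= A) ->
  leb2.-integrable setT (EFin \o h).
Proof.
move=> ch hA; have [M hM] := continuous_support_bounded2 ch hA.
by apply: (@bounded_support_integrable2 _ A M) => //; exact: continuous_measurable2.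
Qed.
End plane.

Section ibp.
Variable R : realType.
Local Notation mR := (measurableTypeR R).
Local Notation leb := (@lebesgue_measure R).
Local Notation leb2 := (@lebesgue_measure R \x @lebesgue_measure R)%E.

Lemma derive_continuous (f f1 : R -> R) :
  (forall x, is_derive (x : R) (1 : R) f (f1 x)) -> continuous f.
Proof.
move=> df x; apply: differentiable_continuous; apply/derivable1_diffP.
by have := df x; case.
Qed.

Lemma integral_support (h : R -> R) (A : R) : (forall x, A < `|x| -> h x = 0) ->
  (\int[leb]_x (h x)%:E = \int[leb]_(x in `[(- A)%R, A]) (h x)%:E)%E.
Proof.
move=> hA; rewrite [RHS]integral_mkcond; apply: eq_integral => x _.
rewrite patchE; case: ifPn => //; rewrite notin_setE/= in_itv/= -ler_norml => /negP.
by rewrite -ltNge => /hA ->.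
Qed.

Lemma FTC2_is_derive (F f : R -> R) (a b : R) : a < b ->
  (forall x, is_derive (x : R) (1 : R) F (f x)) -> continuous f ->
  (\int[leb]_(x in `[a, b]) (f x)%:E = (F b - F a)%:E)%E.
Proof.
move=> ab dF cf; rewrite (@continuous_FTC2 _ f F)//.
- exact: continuous_subspaceT.
- have cF := derive_continuous dF.
  split; first by move=> x _; have := dF x; case.
  - by apply: cvg_at_right_filter; exact: cF.
  - by apply: cvg_at_left_filter; exact: cF.
- by move=> x _; rewrite derive1E; have := dF x => -[].
Qed.

(** Both integrations by parts are done at once: [u f1 - u1 f] is a primitive of [u f2 - u2 f] and
    vanishes at [A] and [-A]. *)
Lemma ibp1 (u u1 u2 f f1 f2 : R -> R) (A : R) : 0 < A ->
  (forall x, is_derive (x : R) (1 : R) u (u1 x)) -> (forall x, is_derive (x : R) (1 : R) u1 (u2 x)) ->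
  (forall x, is_derive (x : R) (1 : R) f (f1 x)) -> (forall x, is_derive (x : R) (1 : R) f1 (f2 x)) ->
  continuous u2 -> continuous f2 ->
  (forall x, A <= `|x| -> [/\ f x = 0, f1 x = 0 & f2 x = 0]) ->
  (\int[leb]_x (u x * f2 x)%:E = \int[leb]_x (u2 x * f x)%:E)%E.
Proof.
move=> A0 du du1 df df1 cu2 cf2 fA.
have cu := derive_continuous du; have cf := derive_continuous df.
rewrite (@integral_support (fun x => u x * f2 x) A); last first.
  by move=> x /ltW/fA[_ _ ->]; rewrite mulr0.
rewrite (@integral_support (fun x => u2 x * f x) A); last first.
  by move=> x /ltW/fA[-> _ _]; rewrite mulr0.
have c1 : continuous (fun x => u x * f2 x) by move=> x; apply: cvgM; [exact: cu|exact: cf2].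
have c2 : continuous (fun x => u2 x * f x) by move=> x; apply: cvgM; [exact: cu2|exact: cf].
have i1 : leb.-integrable `[- A, A] (EFin \o (fun x => u x * f2 x)).
  by apply: continuous_compact_integrable; [exact: segment_compact|exact: continuous_subspaceT].
have i2 : leb.-integrable `[- A, A] (EFin \o (fun x => u2 x * f x)).
  by apply: continuous_compact_integrable; [exact: segment_compact|exact: continuous_subspaceT].
have E0 : (\int[leb]_(x in `[(- A)%R, A]) (u x * f2 x - u2 x * f x)%:E = 0)%E.
  have dF x : is_derive (x : R) (1 : R) (fun x => u x * f1 x - u1 x * f x)
      (u x * f2 x - u2 x * f x).
    have d1 := du x; have d2 := du1 x; have d3 := df x; have d4 := df1 x.
    by apply: is_derive_eq; rewrite /GRing.scale/=; ring.
  have cF : continuous (fun x => u x * f2 x - u2 x * f x).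
    by move=> x; apply: cvgB; [exact: c1|exact: c2].
  have NAA : - A < A by rewrite (lt_trans _ A0)// oppr_lt0.
  apply: (etrans (FTC2_is_derive NAA dF cF)).
  have [-> -> _] : [/\ f A = 0, f1 A = 0 & f2 A = 0] by apply: fA; rewrite ler_norm.
  have [-> -> _] : [/\ f (- A) = 0, f1 (- A) = 0 & f2 (- A) = 0].
    by apply: fA; rewrite normrN ler_norm.
  by rewrite !mulr0 !subr0.
have E : (\int[leb]_(x in `[(- A)%R, A]) (u x * f2 x)%:E -
   \int[leb]_(x in `[(- A)%R, A]) (u2 x * f x)%:E = 0)%E.
  by rewrite -integralB//; rewrite -[RHS]E0; apply: eq_integral.
have F1 : (\int[leb]_(x in `[(- A)%R, A]) (u x * f2 x)%:E)%E \is a fin_num.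
  by apply: (integrable_fin_num _ i1); exact: measurable_itv.
have F2 : (\int[leb]_(x in `[(- A)%R, A]) (u2 x * f x)%:E)%E \is a fin_num.
  by apply: (integrable_fin_num _ i2); exact: measurable_itv.
move: E; rewrite -(fineK F1) -(fineK F2) -EFinB => -[/eqP].
by rewrite subr_eq0 => /eqP ->.
Qed.

(** The Laplacian of [f x * g y] is a sum of two terms, each differentiated in one variable only;
    Fubini puts that variable inside and [ibp1] applies with the other one frozen. *)
Lemma ibp2 (u ux uxx uy uyy : R -> R -> R) (f f1 f2 g g1 g2 : R -> R) (A : R) : 0 < A ->
  (forall x y, is_derive (x : R) (1 : R) (fun x => u x y) (ux x y)) ->
  (forall x y, is_derive (x : R) (1 : R) (fun x => ux x y) (uxx x y)) ->
  (forall x y, is_derive (y : R) (1 : R) (fun y => u x y) (uy x y)) ->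
  (forall x y, is_derive (y : R) (1 : R) (fun y => uy x y) (uyy x y)) ->
  continuous (fun z : R * R => u z.1 z.2) ->
  continuous (fun z : R * R => uxx z.1 z.2) ->
  continuous (fun z : R * R => uyy z.1 z.2) ->
  (forall x, is_derive (x : R) (1 : R) f (f1 x)) -> (forall x, is_derive (x : R) (1 : R) f1 (f2 x)) ->
  (forall x, is_derive (x : R) (1 : R) g (g1 x)) -> (forall x, is_derive (x : R) (1 : R) g1 (g2 x)) ->
  continuous f2 -> continuous g2 ->
  (forall x, A <= `|x| -> [/\ f x = 0, f1 x = 0 & f2 x = 0]) ->
  (forall x, A <= `|x| -> [/\ g x = 0, g1 x = 0 & g2 x = 0]) ->
  (\int[leb2]_z (u z.1 z.2 * (f2 z.1 * g z.2 + f z.1 * g2 z.2))%:E =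
   \int[leb2]_z ((uxx z.1 z.2 + uyy z.1 z.2) * (f z.1 * g z.2))%:E)%E.
Proof.
move=> A0 dux duxx duy duyy cu cuxx cuyy df df1 dg dg1 cf2 cg2 fA gA.
have cf := derive_continuous df; have cg := derive_continuous dg.
have supp (h k : R -> R) : (forall x, A <= `|x| -> h x = 0) -> (forall x, A <= `|x| -> k x = 0) ->
  forall (v : R -> R -> R) (z : R * R), v z.1 z.2 * (h z.1 * k z.2) != 0 -> `|z.1| <= A /\ `|z.2| <= A.
  move=> hA kA v z nz; split; apply: contraNT nz; rewrite -ltNge => /ltW zA.
    by rewrite hA// mul0r mulr0.
  by rewrite kA// !mulr0.
have cts (h k : R -> R) (v : R -> R -> R) : continuous h -> continuous k ->
  continuous (fun z : R * R => v z.1 z.2) -> continuous (fun z : R * R => v z.1 z.2 * (h z.1 * k z.2)).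
  move=> ch ck cv z; apply: cvgM; first exact: cv.
  apply: cvgM; first by apply: (@cvg_comp _ _ _ fst h); [exact: cvg_fst|exact: ch].
  by apply: (@cvg_comp _ _ _ snd k); [exact: cvg_snd|exact: ck].
have int (h k : R -> R) (v : R -> R -> R) : continuous h -> continuous k ->
    continuous (fun z : R * R => v z.1 z.2) ->
   (forall x, A <= `|x| -> h x = 0) -> (forall x, A <= `|x| -> k x = 0) ->
   leb2.-integrable setT (fun z : mR * mR => (v z.1 z.2 * (h z.1 * k z.2))%:E).
  move=> ch ck cv hA kA.
  apply: (@continuous_support_integrable2 R (fun z => v z.1 z.2 * (h z.1 * k z.2)) A).
    exact: cts.
  exact: supp.
have f0 x : A <= `|x| -> f x = 0 by move=> /fA[].
have f20 x : A <= `|x| -> f2 x = 0 by move=> /fA[].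
have g0 x : A <= `|x| -> g x = 0 by move=> /gA[].
have g20 x : A <= `|x| -> g2 x = 0 by move=> /gA[].
have i1 := int f2 g u cf2 cg cu f20 g0.
have i2 := int f g2 u cf cg2 cu f0 g20.
have i3 := int f g uxx cf cg cuxx f0 g0.
have i4 := int f g uyy cf cg cuyy f0 g0.
under eq_integral do rewrite mulrDr EFinD.
under [RHS]eq_integral do rewrite mulrDl EFinD.
rewrite integralD// integralD//; congr (_ + _)%E.
  rewrite -(integral21_prod_meas1 i1) -(integral21_prod_meas1 i3).
  apply: eq_integral => y _.
  transitivity (\int[leb]_x ((u x y * g y)%R * f2 x)%:E)%E.
    by apply: eq_integral => x _ /=; congr EFin; ring.
  have d1 x : is_derive (x : R) (1 : R) (fun x => u x y * g y) (ux x y * g y).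
    by have d1 := dux x y; apply: is_derive_eq; rewrite /GRing.scale/=; ring.
  have d2 x : is_derive (x : R) (1 : R) (fun x => ux x y * g y) (uxx x y * g y).
    by have d1' := duxx x y; apply: is_derive_eq; rewrite /GRing.scale/=; ring.
  have cx : continuous (fun x => uxx x y * g y).
    move=> x; apply: cvgM; last exact: cvg_cst.
    apply: (@continuous_comp _ _ _ (fun t : R => (t, y : R)) (fun z : R * R => uxx z.1 z.2)); last exact: cuxx.
    by apply: (@cvg_pair _ _ _ (nbhs (x : R)) (nbhs (x : R)) (nbhs (y : R)) _ _ _ id (fun=> y));
      [exact: cvg_id|exact: cvg_cst].
  apply: (etrans (ibp1 A0 d1 d2 df df1 cx cf2 fA)).
  by apply: eq_integral => x _ /=; congr EFin; ring.
rewrite -(integral12_prod_meas1 i2) -(integral12_prod_meas1 i4).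
apply: eq_integral => x _.
transitivity (\int[leb]_y ((u x y * f x)%R * g2 y)%:E)%E.
  by apply: eq_integral => y _ /=; congr EFin; ring.
have d1 y : is_derive (y : R) (1 : R) (fun y => u x y * f x) (uy x y * f x).
  by have d1 := duy x y; apply: is_derive_eq; rewrite /GRing.scale/=; ring.
have d2 y : is_derive (y : R) (1 : R) (fun y => uy x y * f x) (uyy x y * f x).
  by have d1' := duyy x y; apply: is_derive_eq; rewrite /GRing.scale/=; ring.
have cx : continuous (fun y => uyy x y * f x).
  move=> y; apply: cvgM; last exact: cvg_cst.
  apply: (@continuous_comp _ _ _ (fun t : R => (x : R, t)) (fun z : R * R => uyy z.1 z.2)); last exact: cuyy.
  by apply: (@cvg_pair _ _ _ (nbhs (y : R)) (nbhs (x : R)) (nbhs (y : R)) _ _ _ (fun=> x) id);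
    [exact: cvg_cst|exact: cvg_id].
apply: (etrans (ibp1 A0 d1 d2 dg dg1 cx cg2 gA)).
by apply: eq_integral => y _ /=; congr EFin; ring.
Qed.
End ibp.

(** * The logarithm as fundamental solution of the Laplacian *)

Section kernel_mass.
Variable R : realType.
Local Notation mR := (measurableTypeR R).
Local Notation leb := (@lebesgue_measure R).
Local Notation leb2 := (@lebesgue_measure R \x @lebesgue_measure R)%E.

Lemma ge0_even_FTC (f F : R -> R) (l : R) : (forall x, 0 <= f x) -> continuous f ->
  (forall x, f (- x) = f x) ->
  (forall x, is_derive (x : R) (1 : R) F (f x)) -> F 0 = 0 ->
  F x @[x --> +oo] --> l ->
  (\int[leb]_x (f x)%:E = (2 * l)%:E)%E.
Proof.
move=> f0 cf fN dF F0 Fl.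
have e : f =1 f \o -%R by move=> x /=; rewrite fN.
apply: (etrans (ge0_symfun_integralT f0 cf e)); rewrite EFinM; congr (_ * _)%E.
have cF := derive_continuous dF.
have h1 x : 0 < x -> derivable F x 1 by move=> _; have := dF x; case.
have h2 : F x @[x --> 0^'+] --> F 0 by apply: cvg_at_right_filter; exact: cF.
have h3 : {in `]0, +oo[, derive1 F =1 f}.
  by move=> x _; rewrite derive1E; have := dF x => -[].
have := ge0_continuous_FTC2y (fun x _ => f0 x) (continuous_subspaceT cf) Fl h1 h2 h3.
by rewrite F0 sube0 set_itvcy.
Qed.

Lemma sqrt_1sqr_gt0 (x : R) : 0 < 1 + x ^+ 2.
Proof. by rewrite ltr_wpDr ?sqr_ge0. Qed.

(** The substitution [x = tan u] in disguise: since [cos (atan x) = (1 + x^2)^(-1/2)], this is a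
    primitive of [(1 + x^2)^(-3/2)]; the next lemma gives one of [(1 + x^2)^(-2)]. *)
Lemma is_derive_sin_atan (x : R) :
  is_derive x (1 : R) (fun x => sin (atan x)) ((1 + x ^+ 2)^-1 * cos (atan x)).
Proof. by apply: is_derive_eq; rewrite /GRing.scale/= mulrC. Qed.

Lemma is_derive_sin_cos_atan (x : R) :
  is_derive x (1 : R) (fun x => 2^-1 * (sin (atan x) * cos (atan x) + atan x))
    ((1 + x ^+ 2)^-1 ^+ 2).
Proof.
apply: is_derive_eq; rewrite /GRing.scale/=.
have c2 : cos (atan x) ^+ 2 = (1 + x ^+ 2)^-1.
  by rewrite cos_atan exprVn sqr_sqrtr// ltW// sqrt_1sqr_gt0.
have s2 : sin (atan x) ^+ 2 = 1 - (1 + x ^+ 2)^-1.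
  by rewrite -c2 -(cos2Dsin2 (atan x)) addrAC subrr add0r.
transitivity (2^-1 * (1 + x ^+ 2)^-1 * (cos (atan x) ^+ 2 - sin (atan x) ^+ 2 + 1)); first by ring.
by rewrite c2 s2; move: ((1 + x ^+ 2)^-1) => a; field.
Qed.

Lemma integral_inv_1sqr2 : (\int[leb]_x ((1 + x ^+ 2)^-1 ^+ 2)%:E = (pi / 2)%:E)%E.
Proof.
have c : continuous (fun x : R => (1 + x ^+ 2)^-1 ^+ 2).
  move=> x; apply: (@continuous_comp _ _ _ (fun x : R => (1 + x ^+ 2)^-1) (fun t : R => t ^+ 2)); last exact: exprn_continuous.
  apply: cvgV; first by rewrite gt_eqF// sqrt_1sqr_gt0.
  by apply: cvgD; [exact: cvg_cst|exact: exprn_continuous].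
have l : (2^-1 * (sin (atan x) * cos (atan x) + atan x) : R) @[x --> +oo] --> (2^-1 * (sin (pi / 2) * cos (pi / 2) + pi / 2) : R).
  apply: cvgM; first exact: cvg_cst.
  apply: cvgD; last exact: cvgy_atan.
  by apply: cvgM; [exact: (cvg_comp _ _ (@cvgy_atan R) (@continuous_sin R _))|exact: (cvg_comp _ _ (@cvgy_atan R) (@continuous_cos R _))].
rewrite (ge0_even_FTC _ c _ is_derive_sin_cos_atan _ l).
- by rewrite sin_pihalf cos_pihalf; congr EFin; field.
- by move=> x; rewrite sqr_ge0.
- by move=> x; rewrite sqrrN.
- by rewrite atan0 sin0 mul0r addr0 mulr0.
Qed.

Lemma integral_inv_sqrt_1sqr3 : (\int[leb]_x ((1 + x ^+ 2)^-1 * (Num.sqrt (1 + x ^+ 2))^-1)%:E = 2%:E)%E.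
Proof.
have c : continuous (fun x : R => (1 + x ^+ 2)^-1 * cos (atan x)).
  move=> x; apply: cvgM.
    apply: cvgV; first by rewrite gt_eqF// sqrt_1sqr_gt0.
    by apply: cvgD; [exact: cvg_cst|exact: exprn_continuous].
  by apply: (@continuous_comp _ _ _ (@atan R) (@cos R)); [exact: continuous_atan|exact: continuous_cos].
have l : (sin (atan x) : R) @[x --> +oo] --> (sin (pi / 2) : R).
  exact: (cvg_comp _ _ (@cvgy_atan R) (@continuous_sin R _)).
transitivity (\int[leb]_x ((1 + x ^+ 2)^-1 * cos (atan x))%:E)%E.
  by apply: eq_integral => x _; rewrite cos_atan.
rewrite (ge0_even_FTC _ c _ is_derive_sin_atan _ l).
- by rewrite sin_pihalf mulr1.
- by move=> x; apply: mulr_ge0; rewrite ?cos_atan invr_ge0 ?sqrtr_ge0// ltW// sqrt_1sqr_gt0.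
- by move=> x; rewrite sqrrN atanN cosN.
- by rewrite atan0 sin0.
Qed.

Lemma measurable_inv_1sqr : measurable_fun [set: mR] (fun x : mR => (1 + (x : R) ^+ 2)^-1 : R).
Proof.
apply: continuous_measurable_fun => x.
apply: cvgV; first by rewrite gt_eqF// sqrt_1sqr_gt0.
by apply: cvgD; [exact: cvg_cst|exact: exprn_continuous].
Qed.

(** One quarter of the Laplacian of [ln (1 + x^2 + y^2)]. *)
Definition kern (x y : R) : R := (1 + x ^+ 2 + y ^+ 2)^-1 ^+ 2.

Lemma continuous_kern : continuous (fun z : R * R => kern z.1 z.2).
Proof.
move=> z; rewrite /kern; apply: (@continuous_comp _ _ _ (fun z : R * R => (1 + z.1 ^+ 2 + z.2 ^+ 2)^-1) (fun t : R => t ^+ 2)); last exact: exprn_continuous.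
apply: cvgV; first by rewrite gt_eqF// ltr_wpDr ?sqr_ge0// sqrt_1sqr_gt0.
apply: cvgD; first apply: cvgD; first exact: cvg_cst.
  apply: (@continuous_comp _ _ _ (fst : R * R -> R) (fun t : R => t ^+ 2)); [exact: cvg_fst|exact: exprn_continuous].
apply: (@continuous_comp _ _ _ (snd : R * R -> R) (fun t : R => t ^+ 2)); [exact: cvg_snd|exact: exprn_continuous].
Qed.

(** Scaling [y] by [c = sqrt (1 + x^2)] gives [1 + x^2 + (c y)^2 = c^2 (1 + y^2)], so the variables
    separate: the inner integral is [c^(-3) pi / 2], and [c^(-3)] integrates to 2. *)
Lemma integral_kern : (\int[leb]_x \int[leb]_y (kern x y)%:E = pi%:E)%E.
Proof.
transitivity (\int[leb]_x ((pi / 2)%:E * ((1 + x ^+ 2)^-1 * (Num.sqrt (1 + x ^+ 2))^-1)%:E))%E.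
  apply: eq_integral => x _; set c := Num.sqrt _.
  have c0 : 0 < c by rewrite sqrtr_gt0 sqrt_1sqr_gt0.
  have c2 : c ^+ 2 = 1 + x ^+ 2 by rewrite sqr_sqrtr// ltW// sqrt_1sqr_gt0.
  rewrite [LHS](@ge0_integral_affine R c 0 (fun y => (kern x y)%:E)) ?gt_eqF//; last 2 first.
  - apply/measurable_EFinP.
    exact: (measurable_fun_pair2 x (continuous_measurable2 continuous_kern)).
  - by move=> y; rewrite lee_fin sqr_ge0.
  rewrite gtr0_norm//.
  under eq_integral.
    move=> y _.
    rewrite (_ : kern x (c * y + 0) = (1 + x ^+ 2)^-1 ^+ 2 * (1 + y ^+ 2)^-1 ^+ 2); last first.
      rewrite /kern -exprMn -invfM addr0 exprMn c2; congr (_^-1 ^+ 2); ring.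
    rewrite EFinM; over.
  have hm : measurable_fun [set: mR] (fun y : mR => ((1 + (y : R) ^+ 2)^-1 ^+ 2)%:E).
    by apply/measurable_EFinP/measurable_funX; exact: measurable_inv_1sqr.
  have h0 (y : mR) : [set: mR] y -> (0 <= ((1 + (y : R) ^+ 2)^-1 ^+ 2)%:E)%E.
    by rewrite lee_fin sqr_ge0.
  have hk : (0 <= ((1 + (x : R) ^+ 2)^-1 ^+ 2)%:E)%E by rewrite lee_fin sqr_ge0.
  rewrite ge0_integralZl//.
  rewrite integral_inv_1sqr2 -!EFinM; congr EFin; rewrite -c2; field.
  by rewrite gt_eqF.
rewrite ge0_integralZl//.
- by rewrite integral_inv_sqrt_1sqr3 -EFinM; congr EFin; field.
- apply/measurable_EFinP; apply: measurable_funM; first exact: measurable_inv_1sqr.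
  rewrite (_ : (fun x => _) = @cos R \o @atan R); last by apply/funext => x /=; rewrite cos_atan.
  apply: continuous_measurable_fun => x.
  by apply: (@continuous_comp _ _ _ (@atan R) (@cos R)); [exact: continuous_atan|exact: continuous_cos].
- by move=> x _; rewrite lee_fin; apply: mulr_ge0; rewrite invr_ge0 ?sqrtr_ge0// ltW// sqrt_1sqr_gt0.
- by rewrite lee_fin divr_ge0// pi_ge0.
Qed.
End kernel_mass.

(** * Local integrability of the logarithm *)

Section log_integrable.
Variable R : realType.
Local Notation mR := (measurableTypeR R).
Local Notation leb := (@lebesgue_measure R).
Local Notation leb2 := (@lebesgue_measure R \x @lebesgue_measure R)%E.

(** The offset [2 ln B] makes the integrand an upper bound of [|ln x|] on []0, B]], in particular
    nonnegative, so that the integral is the limit of those over [[1 / (i + 1), B]]. The primitive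
    [H] is nonnegative at the left end, hence [H B] bounds them all. *)
Lemma integral_Nln_lty (B : R) : 1 < B ->
  (\int[leb]_(x in `]0%R, B]) (2 * ln B - ln x)%:E < +oo)%E.
Proof.
move=> B1; have B0 : 0 < B by rewrite (lt_trans _ B1).
pose k (x : R) : R := 2 * ln B - ln x.
pose H (x : R) : R := 2 * ln B * x - (x * ln x - x).
pose F (i : nat) : set mR := [set` `[i.+1%:R^-1, B]].
have mk : measurable_fun [set: mR] (fun x : mR => (k x)%:E).
  apply/measurable_EFinP; apply: measurable_funB => //; exact: measurable_ln.
have FB : (\bigcup_i F i) = [set` `]0, B]] :> set mR.
  apply/seteqP; split => [x [i _]|x]; rewrite /F /= !in_itv/=.
    by move=> /andP[ix ->]; rewrite (lt_le_trans _ ix).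
  move=> /andP[x0 xB]; exists (Num.truncn x^-1) => //.
  rewrite /F/= in_itv/= xB andbT invf_ple ?posrE//.
  by rewrite ltW// truncnS_gt.
have k0 i x : F i x -> (0 <= (k x)%:E)%E.
  rewrite /F /= in_itv/= => /andP[ix xB].
  have x0 : 0 < x by rewrite (lt_le_trans _ ix).
  rewrite lee_fin subr_ge0 (@le_trans _ _ (ln B))//; first by rewrite ler_ln ?posrE.
  by rewrite mulr_natl mulr2n lerDl ln_ge0// ltW.
have ndF : nondecreasing_seq F.
  move=> i j ij; apply/subsetPset => x; rewrite /F /= !in_itv/= => /andP[ix ->].
  by rewrite andbT (le_trans _ ix)// lef_pV2 ?posrE// ler_nat ltnS.
have mF i : measurable (F i) by exact: measurable_itv.
have mfk i : measurable_fun (F i) (fun x : mR => (k x)%:E) by exact: measurable_funTS.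
have cvg := ge0_nondecreasing_set_cvg_integral (mu := leb) ndF mF mfk k0.
rewrite FB in cvg.
apply: (@le_lt_trans _ _ (H B)%:E); last exact: ltry.
apply: cvge_le cvg; near=> i.
have a0 : 0 < i.+1%:R^-1 :> R by rewrite invr_gt0.
have aB : i.+1%:R^-1 < B by rewrite (le_lt_trans _ B1)// invf_le1// ler1n.
have dH (x : R) : 0 < x -> is_derive x (1 : R) H (k x).
  move=> x0; have dl := is_derive1_ln x0.
  apply: is_derive_eq; rewrite /GRing.scale/= /k; field.
  by rewrite gt_eqF.
have cH (x : R) : 0 < x -> H x @[x --> x] --> H x.
  move=> x0; apply: differentiable_continuous; apply/derivable1_diffP.
  by have := dH _ x0; case.
have h1 : {within `[i.+1%:R^-1, B], continuous k}.
  apply: continuous_in_subspaceT => x; rewrite inE/= in_itv/= => /andP[ax _].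
  by apply: cvgB; [exact: cvg_cst|apply: continuous_ln; rewrite (lt_le_trans a0)].
have h2 : derivable_oo_LRcontinuous H i.+1%:R^-1 B.
  split.
  - move=> x; rewrite in_itv/= => /andP[ax _].
    by have := dH _ (lt_trans a0 ax); case.
  - by apply: cvg_at_right_filter; exact: cH.
  - by apply: cvg_at_left_filter; exact: cH.
have h3 : {in `]i.+1%:R^-1, B[, derive1 H =1 k}.
  move=> x; rewrite in_itv/= => /andP[ax _].
  by rewrite derive1E; have := dH _ (lt_trans a0 ax) => -[].
have h := continuous_FTC2 aB h1 h2 h3; rewrite /F [leLHS]h.
rewrite -EFinB lee_fin lerBlDr lerDl /H lnV ?posrE// mulrN -opprD opprK.
by rewrite addr_ge0// ?mulr_ge0 ?addr_ge0 ?mulr_ge0 ?ln_ge0 ?ler1n ?ltW.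
Unshelve. all: end_near. Qed.

Lemma ln_sqr_integral_lty0 (B : R) : 1 < B ->
  (\int[leb]_x (\1_(`[- B, B]%classic : set R) x * `|ln (x ^+ 2)|)%:E < +oo)%E.
Proof.
move=> B1; have B0 : 0 < B by rewrite (lt_trans _ B1).
pose k (x : R) : \bar R := ((fun x => (2 * ln B - ln x)%:E) \_ `]0, B]) x.
have k0 x : (0 <= k x)%E.
  rewrite /k patchE; case: ifPn => //; rewrite inE/= in_itv/= => /andP[x0 xB].
  rewrite lee_fin subr_ge0 (@le_trans _ _ (ln B))//; first by rewrite ler_ln ?posrE.
  by rewrite mulr_natl mulr2n lerDl ln_ge0// ltW.
have mk : measurable_fun [set: mR] (k : mR -> _).
  apply/(measurable_restrictT _ _).1; first exact: measurable_itv.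
  apply: measurable_funTS; apply/measurable_EFinP; apply: measurable_funB => //; exact: measurable_ln.
have mkN : measurable_fun [set: mR] (fun x : mR => k (- x)).
  apply: (measurableT_comp mk); exact: oppr_measurable.
have kfin : (\int[leb]_x k x < +oo)%E.
  by rewrite -integral_mkcond; exact: integral_Nln_lty.
have kN : (\int[leb]_x k (- x)%R = \int[leb]_x k x)%E.
  have N1 : (-1 : R) != 0 by rewrite oppr_eq0 oner_eq0.
  rewrite [RHS](ge0_integral_affine 0 N1 mk k0).
  by rewrite normrN1 mul1e; apply: eq_integral => x _; rewrite mulN1r addr0.
apply: (@le_lt_trans _ _ (\int[leb]_x (2%:E * (k x + k (- x)%R)))%E).
  apply: ge0_le_integral => //.
  - apply/measurable_EFinP/measurable_funM.
      by apply: measurable_indic; exact: measurable_itv.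
    apply: measurableT_comp => //; apply: (measurableT_comp (@measurable_ln R)).
    exact: (measurable_funX 2).
  - apply: emeasurable_funM => //; exact: emeasurable_funD.
  - move=> x _; rewrite indicE.
    have [|_] := boolP (x \in _); last by rewrite mul0r mule_ge0// adde_ge0.
    rewrite inE/= in_itv/= => /andP[Bx xB]; rewrite mul1r.
    have key (y : R) : 0 < y -> y <= B -> (`|ln (y ^+ 2)|%:E <= 2%:E * k y)%E.
      move=> y0 yB; rewrite /k patchE mem_set/=; last by rewrite in_itv/= y0.
      have -> : ln (y ^+ 2) = 2 * ln y by rewrite lnXn// mulr_natl.
      rewrite -EFinM lee_fin normrM ger0_norm// ler_wpM2l//.
      have lyB : ln y <= ln B by rewrite ler_ln ?posrE.
      have lB : 0 <= ln B by rewrite ln_ge0// ltW.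
      by rewrite ler_norml; apply/andP; split; lra.
    have [x0|x0|<-] := ltgtP 0 x.
    + apply: (le_trans (key x x0 xB)); rewrite lee_pmul2l// leeDl//.
    + rewrite -sqrrN; apply: (le_trans (key (- x) _ _)); rewrite ?oppr_gt0// 1?lerNl//.
      by rewrite lee_pmul2l// leeDr.
    + by rewrite expr0n/= ln0// normr0 mule_ge0// adde_ge0.
rewrite ge0_integralZl//; last 2 first.
  exact: emeasurable_funD.
  by move=> x _; rewrite adde_ge0.
rewrite ge0_integralD// kN lte_mul_pinfty//.
by rewrite lte_add_pinfty.
Qed.

Lemma ln_sqr_integral_lty (A x0 : R) :
  (\int[leb]_x (\1_(`[- A, A]%classic : set R) x * `|ln ((x - x0) ^+ 2)|)%:E < +oo)%E.
Proof.
pose B := `|A| + `|x0| + 2.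
(* [B] is chosen so that the translate of [[-A, A]] by [-x0] lies in [[-B, B]]; the summand 2
   ensures [1 < B]. *)
have B1 : 1 < B by rewrite /B; have := normr_ge0 A; have := normr_ge0 x0; lra.
have mg : measurable_fun [set: mR] (fun x : mR => (\1_(`[- B, B]%classic : set R) x * `|ln (x ^+ 2)|)%:E).
  apply/measurable_EFinP/measurable_funM.
    by apply: measurable_indic; exact: measurable_itv.
  apply: measurableT_comp => //; apply: (measurableT_comp (@measurable_ln R)).
  exact: (measurable_funX 2).
apply: le_lt_trans (ln_sqr_integral_lty0 B1).
rewrite [leRHS](@ge0_integral_affine R 1 (- x0))//.
rewrite normr1 mul1e; apply: ge0_le_integral => //.
- apply/measurable_EFinP/measurable_funM.
    by apply: measurable_indic; exact: measurable_itv.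
  apply: measurableT_comp => //; apply: (measurableT_comp (@measurable_ln R)).
  by apply: (measurable_funX 2); exact: measurable_funB.
- apply: (measurableT_comp mg); exact: (measurable_affine 1 (- x0)).
- move=> x _; rewrite lee_fin mul1r ler_wpM2r// !indicE.
  have [|_] := boolP (x \in _); last by rewrite ler0n.
  rewrite inE/= in_itv/= -ler_norml => xA; rewrite mem_set//= in_itv/= -ler_norml.
  rewrite (le_trans (ler_normB _ _))// /B; have := ler_norm A; lra.
Qed.
End log_integrable.

(** * Integration by parts against radial functions *)

Section radial.
Variable R : realType.
Local Notation mR := (measurableTypeR R).
Local Notation leb := (@lebesgue_measure R).
Local Notation leb2 := (@lebesgue_measure R \x @lebesgue_measure R)%E.

Definition sqdist (x0 y0 : R) (z : R * R) : R := (z.1 - x0) ^+ 2 + (z.2 - y0) ^+ 2.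

Lemma sqdist_ge0 x0 y0 z : 0 <= sqdist x0 y0 z.
Proof. by rewrite addr_ge0 ?sqr_ge0. Qed.

Lemma continuous_sqdist x0 y0 : continuous (sqdist x0 y0).
Proof.
move=> z; apply: cvgD.
  apply: (@continuous_comp _ _ _ (fun z : R * R => z.1 - x0) (fun t : R => t ^+ 2)); last exact: exprn_continuous.
  by apply: cvgB; [exact: cvg_fst|exact: cvg_cst].
apply: (@continuous_comp _ _ _ (fun z : R * R => z.2 - y0) (fun t : R => t ^+ 2)); last exact: exprn_continuous.
by apply: cvgB; [exact: cvg_snd|exact: cvg_cst].
Qed.

Lemma measurable_sqdist x0 y0 : measurable_fun [set: mR * mR] (sqdist x0 y0).
Proof. exact: (continuous_measurable2 (@continuous_sqdist x0 y0)). Qed.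

(** The Laplacian of [F (|z - z0|^2)] is [4 (F'(t) + t F''(t))] at [t = |z - z0|^2]. This serves
    three times: for the regularised logarithm, for [ln K (|z|^2)], and for a constant [F], which
    yields that the Laplacian of a bump has integral zero. *)
Lemma ibp_radial (f f1 f2 g g1 g2 : R -> R) (A : R) (F F1 F2 : R -> R) (x0 y0 : R) : 0 < A ->
  (forall x, is_derive (x : R) (1 : R) f (f1 x)) -> (forall x, is_derive (x : R) (1 : R) f1 (f2 x)) ->
  (forall x, is_derive (x : R) (1 : R) g (g1 x)) -> (forall x, is_derive (x : R) (1 : R) g1 (g2 x)) ->
  continuous f2 -> continuous g2 ->
  (forall x, A <= `|x| -> [/\ f x = 0, f1 x = 0 & f2 x = 0]) ->
  (forall x, A <= `|x| -> [/\ g x = 0, g1 x = 0 & g2 x = 0]) ->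
  (forall t, 0 <= t -> is_derive (t : R) (1 : R) F (F1 t)) ->
  (forall t, 0 <= t -> is_derive (t : R) (1 : R) F1 (F2 t)) ->
  (forall t, 0 <= t -> {for t, continuous F2}) ->
  (\int[leb2]_z (F (sqdist x0 y0 z) * (f2 z.1 * g z.2 + f z.1 * g2 z.2))%:E =
   \int[leb2]_z (4 * (F1 (sqdist x0 y0 z) + sqdist x0 y0 z * F2 (sqdist x0 y0 z)) * (f z.1 * g z.2))%:E)%E.
Proof.
move=> A0 df df1 dg dg1 cf2 cg2 fA gA dF dF1 cF2.
have cF (G G1 : R -> R) : (forall t, 0 <= t -> is_derive (t : R) (1 : R) G (G1 t)) ->
    forall t, 0 <= t -> {for t, continuous G}.
  move=> dG t t0; apply: differentiable_continuous; apply/derivable1_diffP.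
  by have := dG _ t0; case.
have cc (G : R -> R) : (forall t, 0 <= t -> {for t, continuous G}) ->
    continuous (fun z : R * R => G (sqdist x0 y0 z)).
  move=> cG z; apply: (@continuous_comp _ _ _ (sqdist x0 y0) G); first exact: continuous_sqdist.
  by apply: cG; exact: sqdist_ge0.
have cfst : continuous (fun z : R * R => 2 * (z.1 - x0)).
  by move=> z; apply: cvgM; [exact: cvg_cst|apply: cvgB; [exact: cvg_fst|exact: cvg_cst]].
have csnd : continuous (fun z : R * R => 2 * (z.2 - y0)).
  by move=> z; apply: cvgM; [exact: cvg_cst|apply: cvgB; [exact: cvg_snd|exact: cvg_cst]].
have dtx (x y : R) : is_derive (x : R) (1 : R) (fun x => sqdist x0 y0 (x, y)) (2 * (x - x0)).
  by rewrite /sqdist/=; apply: is_derive_eq; rewrite /GRing.scale/=; ring.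
have dty (x y : R) : is_derive (y : R) (1 : R) (fun y => sqdist x0 y0 (x, y)) (2 * (y - y0)).
  by rewrite /sqdist/=; apply: is_derive_eq; rewrite /GRing.scale/=; ring.
have dx (G G1 : R -> R) (x y : R) : (forall t, 0 <= t -> is_derive (t : R) (1 : R) G (G1 t)) ->
    is_derive (x : R) (1 : R) (fun x => G (sqdist x0 y0 (x, y))) (G1 (sqdist x0 y0 (x, y)) * (2 * (x - x0))).
  move=> dG; have d1 := dtx x y; have d2 := dG _ (sqdist_ge0 x0 y0 (x, y)).
  exact: (@is_derive1_comp _ G (fun x => sqdist x0 y0 (x, y))).
have dy (G G1 : R -> R) (x y : R) : (forall t, 0 <= t -> is_derive (t : R) (1 : R) G (G1 t)) ->
    is_derive (y : R) (1 : R) (fun y => G (sqdist x0 y0 (x, y))) (G1 (sqdist x0 y0 (x, y)) * (2 * (y - y0))).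
  move=> dG; have d1 := dty x y; have d2 := dG _ (sqdist_ge0 x0 y0 (x, y)).
  exact: (@is_derive1_comp _ G (fun y => sqdist x0 y0 (x, y))).
pose ux (x y : R) := F1 (sqdist x0 y0 (x, y)) * (2 * (x - x0)).
pose uy (x y : R) := F1 (sqdist x0 y0 (x, y)) * (2 * (y - y0)).
pose uxx (x y : R) := F2 (sqdist x0 y0 (x, y)) * (2 * (x - x0)) * (2 * (x - x0)) + F1 (sqdist x0 y0 (x, y)) * 2.
pose uyy (x y : R) := F2 (sqdist x0 y0 (x, y)) * (2 * (y - y0)) * (2 * (y - y0)) + F1 (sqdist x0 y0 (x, y)) * 2.
have h1 x y : is_derive (x : R) (1 : R) (fun x => F (sqdist x0 y0 (x, y))) (ux x y) by exact: dx.
have h2 x y : is_derive (x : R) (1 : R) (fun x => ux x y) (uxx x y).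
  have d1 := dx F1 F2 x y dF1; rewrite /ux; apply: is_derive_eq; rewrite /GRing.scale/= /uxx; ring.
have h3 x y : is_derive (y : R) (1 : R) (fun y => F (sqdist x0 y0 (x, y))) (uy x y) by exact: dy.
have h4 x y : is_derive (y : R) (1 : R) (fun y => uy x y) (uyy x y).
  have d1 := dy F1 F2 x y dF1; rewrite /uy; apply: is_derive_eq; rewrite /GRing.scale/= /uyy; ring.
have e (z : R * R) : (z.1, z.2) = z by case: z.
have c1 : continuous (fun z : R * R => F (sqdist x0 y0 (z.1, z.2))).
  under eq_fun do rewrite e; exact: cc (cF _ _ dF).
have c2 : continuous (fun z : R * R => uxx z.1 z.2).
  rewrite /uxx; under eq_fun do rewrite e.
  move=> z; apply: cvgD.
    by apply: cvgM; [apply: cvgM|]; [exact: cc|exact: cfst|exact: cfst].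
  by apply: cvgM; [exact: cc (cF _ _ dF1) z|exact: cvg_cst].
have c3 : continuous (fun z : R * R => uyy z.1 z.2).
  rewrite /uyy; under eq_fun do rewrite e.
  move=> z; apply: cvgD.
    by apply: cvgM; [apply: cvgM|]; [exact: cc|exact: csnd|exact: csnd].
  by apply: cvgM; [exact: cc (cF _ _ dF1) z|exact: cvg_cst].
have := ibp2 A0 h1 h2 h3 h4 c1 c2 c3 df df1 dg dg1 cf2 cg2 fA gA.
under eq_integral do rewrite e.
move=> ->; apply: eq_integral => z _; congr EFin; rewrite /uxx /uyy e /sqdist.
move: z => -[x y] /=; move: (F1 _) (F2 _) => G1 G2.
by move: (x : R) (y : R) => {}x {}y; ring.
Qed.
End radial.

Section log_poly.
Variable R : realType.

Lemma derive_log_poly (K : {poly R}) : (forall t, 0 <= t -> 0 < K.[t]) ->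
  [/\ forall t, 0 <= t -> is_derive (t : R) (1 : R) (fun t => ln K.[t]) (K^`().[t] / K.[t]),
      forall t, 0 <= t -> is_derive (t : R) (1 : R) (fun t => K^`().[t] / K.[t])
         (K^`()^`().[t] / K.[t] - (K^`().[t] / K.[t]) ^+ 2) &
      forall t, 0 <= t -> {for t, continuous (fun t => K^`()^`().[t] / K.[t] - (K^`().[t] / K.[t]) ^+ 2)}].
Proof.
move=> Kp; split => t t0.
- have dl := is_derive1_ln (Kp t t0).
  have := @is_derive1_comp _ (@ln R) (horner K) t _ _ dl (is_derive_poly K t).
  by rewrite mulrC.
- have n0 : K.[t] != 0 by rewrite gt_eqF// Kp.
  have dV := is_deriveV n0 (is_derive_poly K t).
  apply: (is_derive_eq (is_deriveM (is_derive_poly K^`() t) dV)).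
  by rewrite /GRing.scale/=; field.
- have n0 : K.[t] != 0 by rewrite gt_eqF// Kp.
  have cp (q : {poly R}) : {for t, continuous (horner q)} by exact: continuous_horner.
  have cV : {for t, continuous (fun t => K.[t]^-1)} by apply: cvgV => //; exact: cp.
  apply: cvgB; first by apply: cvgM => //; exact: cp.
  apply: (@continuous_comp _ _ _ (fun t => K^`().[t] / K.[t]) (fun u : R => u ^+ 2)); last exact: exprn_continuous.
  by apply: cvgM => //; exact: cp.
Qed.

End log_poly.

(** * The regularised logarithm and its limit *)

Section log_fundamental.
Variable R : realType.
Local Notation mR := (measurableTypeR R).
Local Notation leb := (@lebesgue_measure R).
Local Notation leb2 := (@lebesgue_measure R \x @lebesgue_measure R)%E.

Lemma integrable_prod_fun (a b : mR -> R) :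
  measurable_fun setT a -> measurable_fun setT b ->
  (forall x, 0 <= a x) -> (forall x, 0 <= b x) ->
  (\int[leb]_x (a x)%:E < +oo)%E -> (\int[leb]_x (b x)%:E < +oo)%E ->
  leb2.-integrable setT (fun z : mR * mR => (a z.1 * b z.2)%:E).
Proof.
move=> ma mb a0 b0 ia ib.
have m2 : measurable_fun [set: mR * mR] (fun z : mR * mR => (a z.1 * b z.2)%:E).
  apply/measurable_EFinP; apply: measurable_funM.
    exact: (measurableT_comp ma measurable_fst).
  exact: (measurableT_comp mb measurable_snd).
apply: (integrable12ltyP _ _ m2).2.
have -> : (\int[leb]_x \int[leb]_y `|(a x * b y)%:E| = \int[leb]_x ((a x)%:E * \int[leb]_y (b y)%:E))%E.
  apply: eq_integral => x _; rewrite -ge0_integralZl//.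
  - by apply: eq_integral => y _; rewrite gee0_abs ?lee_fin ?mulr_ge0// EFinM.
  - exact/measurable_EFinP.
  - by move=> y _; rewrite lee_fin.
  - by rewrite lee_fin.
have b0' : (0 <= \int[leb]_y (b y)%:E)%E by apply: integral_ge0 => y _; rewrite lee_fin.
rewrite ge0_integralZr//; last 2 first.
- exact/measurable_EFinP.
- by move=> y _; rewrite lee_fin.
apply: lte_mul_pinfty => //; first by apply: integral_ge0 => y _; rewrite lee_fin.
by rewrite ge0_fin_numE// integral_ge0// => y _; rewrite lee_fin.
Qed.

Lemma ae_neq_fst (x0 : R) : {ae leb2, forall z : mR * mR, z.1 != x0 :> R}.
Proof.
exists ([set (x0 : mR)] `*` [set: mR]); split.
- by apply: measurableX => //; exact: measurable_set1.
- have := product_measure1E leb leb (measurable_set1 x0) measurableT.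
  move=> e; apply: (etrans e).
  by apply: (etrans (congr1 (fun t => t * _)%E (lebesgue_measure_set1 x0))); rewrite mul0e.
- by move=> [x y] /= /negP; rewrite negbK => /eqP ->.
Qed.

(** Two one-dimensional affine substitutions, one per variable, each contributing a factor [a]. *)
Lemma ge0_integral2_scale (a x0 y0 : R) (F : mR * mR -> \bar R) : 0 < a ->
  measurable_fun setT F -> (forall z, 0 <= F z)%E ->
  (\int[leb2]_z F z = \int[leb2]_z ((a ^+ 2)%:E * F (a * z.1 + x0, a * z.2 + y0)%R))%E.
Proof.
move=> a0 mF F0; have an0 : a != 0 by rewrite gt_eqF.
have mG : measurable_fun [set: mR * mR] (fun z : mR * mR => F (a * z.1 + x0, a * z.2 + y0)).
  have := measurableT_comp mF (measurable_lin22 a 0 x0 0 a y0).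
  by rewrite /comp/=; under eq_fun do rewrite !mul0r addr0 add0r.
have mH : measurable_fun [set: mR * mR] (fun z : mR * mR => F (z.1, a * z.2 + y0)).
  have := measurableT_comp mF (measurable_lin22 1 0 0 0 a y0).
  by rewrite /comp/=; under eq_fun do rewrite !mul0r !addr0 add0r mul1r.
rewrite (ge0_integralZl _ _ mG)//; last by rewrite lee_fin sqr_ge0.
rewrite [in LHS]fubini_tonelli1// [in RHS](fubini_tonelli1 _ mG)// /fubini_F.
pose psi (x : mR) : \bar R := (a%:E * \int[leb]_y F (x, a * y + y0)%R)%E.
have mpsi0 : measurable_fun [set: mR] (fun x : mR => \int[leb]_y F (x, a * y + y0)%R)%E.
  exact: (measurable_fun_fubini_tonelli_F (fun z : mR * mR => F (z.1, a * z.2 + y0))).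
have mpsi : measurable_fun setT psi by apply: emeasurable_funM.
have psi0 x : (0 <= psi x)%E.
  by apply: mule_ge0; [rewrite lee_fin ltW|apply: integral_ge0].
transitivity (\int[leb]_x psi x)%E.
  apply: eq_integral => x _.
  have e := @ge0_integral_affine R a y0 (fun y => F (x, y)) an0 (measurable_fun_pair2 x mF) (fun y => F0 _).
  by rewrite e gtr0_norm.
have e := @ge0_integral_affine R a x0 psi an0 mpsi psi0.
rewrite e gtr0_norm// expr2 EFinM -muleA; congr (_ * _)%E; rewrite /psi ge0_integralZl//.
- exact: (measurable_fun_fubini_tonelli_F (fun z : mR * mR => F (a * z.1 + x0, a * z.2 + y0))).
- by move=> x _; apply: integral_ge0.
- by rewrite lee_fin ltW.
Qed.

(** The derivatives are carried as data, so that they can be passed directly to the integration by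
    parts. Nonnegativity allows the change of variables in [log_regularised] to be done for
    nonnegative integrands. *)
Definition bump2 (A : R) (f f1 f2 : R -> R) :=
  [/\ forall x, is_derive (x : R) (1 : R) f (f1 x),
      forall x, is_derive (x : R) (1 : R) f1 (f2 x), continuous f2,
      forall x, A <= `|x| -> [/\ f x = 0, f1 x = 0 & f2 x = 0] & forall x, 0 <= f x].

Variables (A : R) (f f1 f2 g g1 g2 : R -> R).
Hypotheses (A0 : 0 < A) (bf : bump2 A f f1 f2) (bg : bump2 A g g1 g2).

Definition lap (z : R * R) : R := f2 z.1 * g z.2 + f z.1 * g2 z.2.

Lemma continuous_bump2 h h1 h2 : bump2 A h h1 h2 -> continuous h.
Proof. by move=> [dh _ _ _ _]; exact: derive_continuous dh. Qed.

Lemma continuous_tensor (h k : R -> R) : continuous h -> continuous k ->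
  continuous (fun z : R * R => h z.1 * k z.2).
Proof.
move=> ch ck z; apply: cvgM.
  by apply: (@continuous_comp _ _ _ (fst : R * R -> R) h); [exact: cvg_fst|exact: ch].
by apply: (@continuous_comp _ _ _ (snd : R * R -> R) k); [exact: cvg_snd|exact: ck].
Qed.

Lemma continuous_lap : continuous lap.
Proof.
have cf := continuous_bump2 bf; have cg := continuous_bump2 bg.
have [_ _ cf2 _ _] := bf; have [_ _ cg2 _ _] := bg.
by move=> z; apply: cvgD; [exact: continuous_tensor|exact: continuous_tensor].
Qed.

Lemma lap_support z : lap z != 0 -> `|z.1| <= A /\ `|z.2| <= A.
Proof.
have [_ _ _ fA _] := bf; have [_ _ _ gA _] := bg.
move=> nz; split; apply: contraNT nz; rewrite -ltNge => /ltW zA; rewrite /lap.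
  by have [-> _ ->] := fA _ zA; rewrite !mul0r addr0.
by have [-> _ ->] := gA _ zA; rewrite !mulr0 addr0.
Qed.

Lemma bump2_bounded h h1 h2 : bump2 A h h1 h2 -> exists M, forall x, `|h x| <= M.
Proof.
move=> bh; have ch := continuous_bump2 bh; have [_ _ _ hA _] := bh.
have cpt : compact (h @` [set` `[- A, A]]).
  by apply: continuous_compact; [exact: continuous_subspaceT|exact: segment_compact].
have /compact_bounded[M [_ mrt]] := cpt.
have M1 : M < `|M| + 1 by rewrite (le_lt_trans (ler_norm M))// ltrDl.
exists (`|M| + 1) => x; have [xA|/ltW xA] := leP `|x| A.
  by apply: (mrt _ M1); exists x => //=; rewrite in_itv/= -ler_norml.
by have [-> _ _] := hA _ xA; rewrite normr0 addr_ge0.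
Qed.

(** For [0 <= e <= 1] and [z] in the support, [(x - x0)^2 <= |z - z0|^2 + e <= T + 1], whence [|ln
    (|z - z0|^2 + e)| <= |ln (x - x0)^2| + ln (T + 1)]. The right side depends on [x] only and is
    integrable; [M] bounds the Laplacian of the bump. The range of [e] covers both the
    approximations [1 / (n + 1)] and the limit 0. *)
Lemma ae_log_domination (x0 y0 : R) : exists D : mR * mR -> \bar R,
  [/\ leb2.-integrable setT D,
   {ae leb2, forall (z : mR * mR) (n : nat), setT z -> (`|(ln (sqdist x0 y0 z + n.+1%:R^-1) * lap z)%:E| <= D z)%E} &
   {ae leb2, forall z : mR * mR, setT z -> (`|(ln (sqdist x0 y0 z) * lap z)%:E| <= D z)%E}].
Proof.
have [M hM] := continuous_support_bounded2 continuous_lap lap_support.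
pose I : set mR := [set` `[- A, A]].
have mI : measurable I by exact: measurable_itv.
pose T := (A + `|x0|) ^+ 2 + (A + `|y0|) ^+ 2.
have T0 : 0 <= T by rewrite addr_ge0 ?sqr_ge0.
pose C := ln (T + 1).
have C0 : 0 <= C by rewrite ln_ge0// lerDr.
pose a (x : mR) : R := `|M| * (\1_I x * `|ln ((x - x0 : R) ^+ 2)| + \1_I x * C).
pose b (y : mR) : R := \1_I y.
have iI : (\int[leb]_x (\1_I x)%:E < +oo)%E.
  have fin : (leb [set` `[(- A)%R, A]] < +oo)%E.
    by rewrite lebesgue_measure_itv/=; case: ifP => _; rewrite -?EFinB ltry.
  by rewrite integral_indic// setIT; exact: fin.
have mIn : measurable_fun [set: mR] (\1_I : mR -> R) by exact: measurable_indic.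
have mln : measurable_fun [set: mR] (fun x : mR => \1_I x * `|ln ((x - x0 : R) ^+ 2)| : R).
  apply: measurable_funM => //.
  apply: measurableT_comp => //; apply: (measurableT_comp (@measurable_ln R)).
  by apply: (measurable_funX 2); exact: measurable_funB.
have mIC : measurable_fun [set: mR] (fun x : mR => \1_I x * C : R) by exact: measurable_funM.
have bound (z : R * R) (e : R) : z.1 != x0 -> 0 <= e <= 1 ->
    `|ln (sqdist x0 y0 z + e) * lap z| <= a z.1 * b z.2.
  move=> zx0 /andP[e0 e1]; have [->|nz] := eqVneq (lap z) 0.
    by rewrite mulr0 normr0 mulr_ge0// ?mulr_ge0// addr_ge0// mulr_ge0.
  have [z1 z2] := lap_support nz.
  rewrite /a /b !indicE !mem_set; try by rewrite /I/= in_itv/= -ler_norml.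
  rewrite !mul1r mulr1 normrM mulrC ler_pM//; first by rewrite (le_trans (hM z))// ler_norm.
  have x20 : 0 < (z.1 - x0) ^+ 2 by rewrite exprn_even_gt0//= subr_eq0.
  have q1 : (z.1 - x0) ^+ 2 <= sqdist x0 y0 z + e.
    by rewrite /sqdist -addrA lerDl addr_ge0// sqr_ge0.
  have q0 : 0 < sqdist x0 y0 z + e by rewrite (lt_le_trans x20).
  have sqle (u v : R) : `|u| <= A -> (u - v) ^+ 2 <= (A + `|v|) ^+ 2.
    move=> uA; rewrite -(real_normK (num_real (u - v))) lerXn2r ?nnegrE ?addr_ge0 ?(ltW A0)//.
    by rewrite (le_trans (ler_normB _ _))// lerD2r.
  have q2 : sqdist x0 y0 z + e <= T + 1.
    by rewrite lerD// /sqdist lerD// sqle.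
  have l1 : ln ((z.1 - x0) ^+ 2) <= ln (sqdist x0 y0 z + e) by rewrite ler_ln ?posrE.
  have l2 : ln (sqdist x0 y0 z + e) <= C by rewrite ler_ln ?posrE// ltr_wpDl.
  have n1 := lerNnormlW (lexx `|ln ((z.1 - x0) ^+ 2)|).
  rewrite ler_norml; apply/andP; split; first by have := normr_ge0 (ln ((z.1 - x0) ^+ 2)); lra.
  by have := normr_ge0 (ln ((z.1 - x0) ^+ 2)); lra.
exists (fun z => (a z.1 * b z.2)%:E); split.
- apply: integrable_prod_fun.
  + by apply: measurable_funM => //; exact: measurable_funD.
  + by [].
  + by move=> x; rewrite mulr_ge0// addr_ge0// mulr_ge0.
  + by move=> x; rewrite /b.
  + under eq_integral do rewrite /a EFinM EFinD.
    rewrite ge0_integralZl//; last 2 first.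
      by apply: emeasurable_funD; exact/measurable_EFinP.
      by move=> x _; rewrite adde_ge0// lee_fin mulr_ge0.
    rewrite ge0_integralD//; try exact/measurable_EFinP; last first.
      by move=> x _; rewrite lee_fin mulr_ge0.
    have i1 : (\int[leb]_x (\1_I x * `|ln ((x - x0) ^+ 2)|)%:E < +oo)%E by exact: ln_sqr_integral_lty.
    have i2 : (\int[leb]_x (\1_I x * C)%:E < +oo)%E.
      under eq_integral do rewrite EFinM.
      rewrite ge0_integralZr//; last exact/measurable_EFinP.
      apply: lte_mul_pinfty => //; first by apply: integral_ge0 => x _; rewrite lee_fin.
        by rewrite ge0_fin_numE//; apply: integral_ge0 => x _; rewrite lee_fin.
      exact: ltry.
    by apply: lte_mul_pinfty => //; exact: lte_add_pinfty.
  + exact: iI.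
- apply: filterS (ae_neq_fst x0) => z zx0 n _ /=; rewrite lee_fin; apply: bound => //.
  by rewrite invr_ge0 ler0n/= invf_le1// ler1n.
- apply: filterS (ae_neq_fst x0) => z zx0 _ /=; rewrite lee_fin -[sqdist x0 y0 z]addr0; apply: bound => //.
  by rewrite lexx ler01.
Qed.

Lemma measurable_ln_lap (x0 y0 e : R) :
  measurable_fun [set: mR * mR] (fun z : mR * mR => (ln (sqdist x0 y0 z + e) * lap z)%:E).
Proof.
apply/measurable_EFinP; apply: measurable_funM; last exact: (continuous_measurable2 continuous_lap).
apply: (measurableT_comp (@measurable_ln R)).
by apply: measurable_funD => //; exact: measurable_sqdist.
Qed.

Lemma log_regularised_ibp (x0 y0 e : R) : 0 < e ->
  (\int[leb2]_z (ln (sqdist x0 y0 z + e) * lap z)%:E =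
   \int[leb2]_z (4 * (e / (sqdist x0 y0 z + e) ^+ 2) * (f z.1 * g z.2))%:E)%E.
Proof.
move=> e0; have [df df1 cf2 fA _] := bf; have [dg dg1 cg2 gA _] := bg.
(* [ln (t + e)] is treated as the logarithm of a polynomial of degree one, positive for [t >= 0], so
   that [derive_log_poly] supplies its derivatives. *)
pose K : {poly R} := 'X + e%:P.
have KE t : K.[t] = t + e by rewrite /K hornerD hornerX hornerC.
have K1 : K^`() = 1%:P by rewrite /K derivD derivX derivC addr0 polyC1.
have K1E t : K^`().[t] = 1 by rewrite K1 hornerC.
have K2E t : K^`()^`().[t] = 0 by rewrite K1 derivC horner0.
have Kp t : 0 <= t -> 0 < K.[t] by move=> t0; rewrite KE; lra.
have [k1 k2 k3] := derive_log_poly Kp.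
apply: (etrans _ (etrans (ibp_radial x0 y0 A0 df df1 dg dg1 cf2 cg2 fA gA k1 k2 k3) _)).
  by apply: eq_integral => z _; rewrite KE.
apply: eq_integral => z _; congr EFin; rewrite !KE !K1E !K2E.
have := sqdist_ge0 x0 y0 z; move: (sqdist _ _ _) (f _ * g _) => t v t0.
have te : t + e != 0 by rewrite gt_eqF//; lra.
by field.
Qed.

Lemma regularised_rescale (e t v : R) : 0 < e -> 0 <= t ->
  e * (4 * (e / (e * t + e) ^+ 2) * v) = 4 * (1 + t)^-1 ^+ 2 * v.
Proof.
move=> e0 t0; have t1 : 1 + t != 0 by rewrite gt_eqF//; lra.
have en : e != 0 by rewrite gt_eqF.
have -> : e * t + e = e * (1 + t) by ring.
by field; rewrite en t1.
Qed.

(** The Laplacian of [ln (|z|^2 + e)] is [4 e / (|z|^2 + e)^2]; rescaling by [sqrt e] moves all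
    dependence on [e] from the kernel into the arguments of [f] and [g], which exhibits an
    approximate identity. *)
Lemma log_regularised (x0 y0 e : R) : 0 < e ->
  (\int[leb2]_z (ln (sqdist x0 y0 z + e) * lap z)%:E =
   \int[leb2]_z (4 * kern z.1 z.2 * (f (Num.sqrt e * z.1 + x0) * g (Num.sqrt e * z.2 + y0)))%:E)%E.
Proof.
move=> e0; apply: (etrans (log_regularised_ibp x0 y0 e0)).
have cf := continuous_bump2 bf; have cg := continuous_bump2 bg.
have [_ _ _ _ f0] := bf; have [_ _ _ _ g0] := bg.
pose F (z : mR * mR) : \bar R := (4 * (e / (sqdist x0 y0 z + e) ^+ 2) * (f z.1 * g z.2))%:E.
have mF : measurable_fun setT F.
  apply/measurable_EFinP; apply: measurable_funM; last exact: (continuous_measurable2 (continuous_tensor cf cg)).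
  apply: (continuous_measurable2 (h := fun z => 4 * (e / (sqdist x0 y0 z + e) ^+ 2))) => z.
  apply: cvgM; first exact: cvg_cst.
  apply: cvgM; first exact: cvg_cst.
  have q0 : 0 < sqdist x0 y0 z + e by have := sqdist_ge0 x0 y0 z; lra.
  apply: cvgV; first by rewrite gt_eqF// exprn_gt0.
  apply: (@continuous_comp _ _ _ (fun z => sqdist x0 y0 z + e) (fun u : R => u ^+ 2)); last exact: exprn_continuous.
  by apply: cvgD; [exact: continuous_sqdist|exact: cvg_cst].
have F0 z : (0 <= F z)%E.
  rewrite lee_fin; apply: mulr_ge0; last exact: mulr_ge0.
  by apply: mulr_ge0 => //; apply: divr_ge0; [exact: ltW|exact: sqr_ge0].
have s0 : 0 < Num.sqrt e by rewrite sqrtr_gt0.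
apply: (etrans (ge0_integral2_scale x0 y0 s0 mF F0)); apply: eq_integral => z _.
rewrite /F -EFinM; congr EFin; rewrite sqr_sqrtr ?(ltW e0)//.
have -> : sqdist x0 y0 (Num.sqrt e * z.1 + x0, Num.sqrt e * z.2 + y0) = e * (z.1 ^+ 2 + z.2 ^+ 2).
  by rewrite /sqdist /= !addrK !exprMn sqr_sqrtr ?(ltW e0)// mulrDr.
by rewrite regularised_rescale ?addr_ge0 ?sqr_ge0// /kern addrA.
Qed.

(** Dominated convergence is applied to both sides of [log_regularised] with [e = 1 / (n + 1)]. On
    the left it removes the regularisation; on the right the bump freezes to its value at [(x0, y0)]
    and the kernel contributes [4 pi]. *)
Lemma log_fundamental (x0 y0 : R) :
  leb2.-integrable setT (fun z : mR * mR => (ln (sqdist x0 y0 z) * lap z)%:E) /\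
  (\int[leb2]_z (ln (sqdist x0 y0 z) * lap z)%:E = (4 * pi * (f x0 * g y0))%:E)%E.
Proof.
have cf := continuous_bump2 bf; have cg := continuous_bump2 bg.
have [_ _ _ _ f0] := bf; have [_ _ _ _ g0] := bg.
have [D [iD domn dom]] := ae_log_domination x0 y0.
have e0 n : 0 < n.+1%:R^-1 :> R by rewrite invr_gt0.
have en : (n.+1%:R^-1 : R) @[n --> \oo] --> (0 : R) by exact: cvg_harmonic.
have mlim : measurable_fun [set: mR * mR] (fun z : mR * mR => (ln (sqdist x0 y0 z) * lap z)%:E).
  by have := measurable_ln_lap x0 y0 0; under eq_fun do rewrite addr0.
pose fn n (z : mR * mR) : \bar R := (ln (sqdist x0 y0 z + n.+1%:R^-1) * lap z)%:E.
have cvgf : {ae leb2, forall z : mR * mR, setT z -> fn ^~ z @ \oo --> (ln (sqdist x0 y0 z) * lap z)%:E}.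
  apply: filterS (ae_neq_fst x0) => z zx0 _; apply: cvg_EFin; first by apply: nearW.
  apply: cvgM; last exact: cvg_cst.
  have q0 : 0 < sqdist x0 y0 z.
    by rewrite /sqdist ltr_wpDr ?sqr_ge0// exprn_even_gt0//= subr_eq0.
  have cl := continuous_ln q0.
  have : (sqdist x0 y0 z + n.+1%:R^-1)%R @[n --> \oo] --> sqdist x0 y0 z.
    by rewrite -[X in _ --> X]addr0; apply: cvgD => //; exact: cvg_cst.
  by move=> c; exact: (cvg_comp _ _ c cl).
have [ilim _ cvg1] := dominated_convergence measurableT (fun n => measurable_ln_lap x0 y0 n.+1%:R^-1) mlim cvgf iD domn.
split => //.
have ikern : leb2.-integrable setT (fun z : mR * mR => (kern z.1 z.2)%:E).
  have mk : measurable_fun [set: mR * mR] (fun z : mR * mR => (kern z.1 z.2)%:E).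
    by apply/measurable_EFinP; exact: (continuous_measurable2 (@continuous_kern R)).
  apply: (integrable12ltyP _ _ mk).2.
  under eq_integral do under eq_integral do rewrite gee0_abs ?lee_fin ?sqr_ge0//.
  by rewrite integral_kern ltry.
have [Mf hMf] := bump2_bounded bf; have [Mg hMg] := bump2_bounded bg.
have Mf0 : 0 <= Mf := le_trans (normr_ge0 _) (hMf 0).
have Mg0 : 0 <= Mg := le_trans (normr_ge0 _) (hMg 0).
pose gn n (z : mR * mR) : \bar R := (4 * kern z.1 z.2 * (f (Num.sqrt n.+1%:R^-1 * z.1 + x0) * g (Num.sqrt n.+1%:R^-1 * z.2 + y0)))%:E.
have mgn n : measurable_fun setT (gn n).
  apply/measurable_EFinP; apply: (continuous_measurable2 (h := fun z : R * R => 4 * kern z.1 z.2 * (f (Num.sqrt n.+1%:R^-1 * z.1 + x0) * g (Num.sqrt n.+1%:R^-1 * z.2 + y0)))) => z.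
  apply: cvgM; first by apply: cvgM; [exact: cvg_cst|exact: continuous_kern].
  apply: (@continuous_tensor (fun x => f (Num.sqrt n.+1%:R^-1 * x + x0)) (fun y => g (Num.sqrt n.+1%:R^-1 * y + y0))).
    move=> x; apply: (@continuous_comp _ _ _ (fun x : R => Num.sqrt n.+1%:R^-1 * x + x0) f); last exact: cf.
    by apply: cvgD; [apply: cvgM; [exact: cvg_cst|exact: cvg_id]|exact: cvg_cst].
  move=> x; apply: (@continuous_comp _ _ _ (fun x : R => Num.sqrt n.+1%:R^-1 * x + y0) g); last exact: cg.
  by apply: cvgD; [apply: cvgM; [exact: cvg_cst|exact: cvg_id]|exact: cvg_cst].
have mgl : measurable_fun [set: mR * mR] (fun z : mR * mR => (4 * kern z.1 z.2 * (f x0 * g y0))%:E).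
  apply/measurable_EFinP; apply: measurable_funM => //; apply: measurable_funM => //.
  exact: (continuous_measurable2 (@continuous_kern R)).
have cvgg : {ae leb2, forall z : mR * mR, setT z -> gn ^~ z @ \oo --> (4 * kern z.1 z.2 * (f x0 * g y0))%:E}.
  apply: nearW => z _; apply: cvg_EFin; first by apply: nearW.
  apply: cvgM; first exact: cvg_cst.
  have cs : (Num.sqrt n.+1%:R^-1 : R) @[n --> \oo] --> (0 : R).
    rewrite -sqrtr0; exact: (cvg_comp _ _ en (@sqrt_continuous R 0)).
  have ct (c u : R) : (Num.sqrt n.+1%:R^-1 * u + c : R) @[n --> \oo] --> c.
    rewrite -[X in _ --> X]add0r -(mul0r u).
    by apply: cvgD; [apply: cvgM => //|]; exact: cvg_cst.
  apply: cvgM; [exact: (cvg_comp _ _ (ct x0 z.1) (cf x0))|exact: (cvg_comp _ _ (ct y0 z.2) (cg y0))].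
have domg : {ae leb2, forall (z : mR * mR) (n : nat), setT z -> (`|gn n z| <= (4 * Mf * Mg)%:E * (kern z.1 z.2)%:E)%E}.
  apply: nearW => z n _; rewrite /gn /= lee_fin normrM normrM ger0_norm// (ger0_norm (sqr_ge0 _)).
  rewrite [leRHS](_ : _ = 4 * kern z.1 z.2 * (Mf * Mg)); last by rewrite /=; ring.
  rewrite -/(kern z.1 z.2) ler_wpM2l//; first by rewrite mulr_ge0// sqr_ge0.
  by rewrite normrM ler_pM.
have [_ _ cvg2] := dominated_convergence measurableT mgn mgl cvgg (integrableZl measurableT (4 * Mf * Mg) ikern) domg.
have E n : (\int[leb2]_z fn n z = \int[leb2]_z gn n z)%E by exact: log_regularised.
have cvg3 : [sequence (\int[leb2]_z fn n z)%E]_n @ \oo --> (\int[leb2]_z (4 * kern z.1 z.2 * (f x0 * g y0))%:E)%E.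
  by rewrite (_ : (fun n => _) = (fun n => \int[leb2]_z gn n z)%E) //; apply/funext => n; exact: E.
rewrite (cvg_unique _ cvg1 cvg3)//.
transitivity (\int[leb2]_z ((4 * (f x0 * g y0))%:E * (kern z.1 z.2)%:E))%E.
  by apply: eq_integral => z _; rewrite -EFinM; congr EFin; rewrite /=; ring.
rewrite integralZl// -(integral12_prod_meas1 ikern) integral_kern -EFinM; congr EFin; ring.
Qed.
End log_fundamental.

(** * Smooth bump functions *)

Section smooth.
Variable R : realType.

(** One-variable counterpart of [Ck]; [smooth1_Ck] turns products of such functions into admissible
    test functions. *)
Fixpoint smooth1 (k : nat) (f : R -> R) : Prop :=
  continuous f /\
  if k is k'.+1 then (forall x, derivable f x 1) /\ smooth1 k' (derive1 f) else True.

Lemma smooth1_continuous k f : smooth1 k f -> continuous f.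
Proof. by case: k => [|k] []. Qed.

Lemma smooth1_pred k f : smooth1 k.+1 f -> smooth1 k f.
Proof.
elim: k f => [|k IH] f; first by move=> [cf [_ _]]; split.
by move=> [cf [df sf]]; split => //; split => //; exact: IH.
Qed.

Lemma smooth1D k f g : smooth1 k f -> smooth1 k g -> smooth1 k (fun x => f x + g x).
Proof.
elim: k f g => [|k IH] f g [cf hf] [cg hg].
  by split => // x; apply: cvgD; [exact: cf|exact: cg].
have [df sf] := hf; have [dg sg] := hg.
split; first by move=> x; apply: cvgD; [exact: cf|exact: cg].
split; first by move=> x; exact: derivableD.
rewrite (_ : derive1 _ = fun x => derive1 f x + derive1 g x); first exact: IH.
by apply/funext => x; rewrite !derive1E deriveD.
Qed.

Lemma smooth1M k f g : smooth1 k f -> smooth1 k g -> smooth1 k (fun x => f x * g x).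
Proof.
elim: k f g => [|k IH] f g sf sg; have cf := smooth1_continuous sf; have cg := smooth1_continuous sg.
  by split => // x; apply: cvgM; [exact: cf|exact: cg].
have [_ [df sf']] := sf; have [_ [dg sg']] := sg.
split; first by move=> x; apply: cvgM; [exact: cf|exact: cg].
split; first by move=> x; exact: derivableM.
rewrite (_ : derive1 _ = fun x => f x * derive1 g x + g x * derive1 f x).
  by apply: smooth1D; apply: IH => //; exact: smooth1_pred.
by apply/funext => x; rewrite !derive1E deriveM.
Qed.

Lemma expR_ge_coeff (y : R) n : 0 <= y -> y ^+ n <= n`!%:R * expR y.
Proof.
move=> y0; rewrite -ler_pdivrMl ?ltr0n ?fact_gt0// mulrC.
apply: (@le_trans _ _ (series (exp_coeff y) n.+1)).
  rewrite seriesEnat /= big_nat_recr//= lerDr; apply: sumr_ge0 => i _.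
  by rewrite /exp_coeff/= divr_ge0// exprn_ge0.
apply: nondecreasing_cvgn_le; last exact: is_cvg_series_exp_coeff.
by apply: nondecreasing_series => i _ _; rewrite /exp_coeff/= divr_ge0// exprn_ge0.
Qed.

(* [flat q x = q(1/x) e^(-1/x)] for [x > 0] and [0] otherwise: differentiation stays in this family. *)
Definition flat (q : {poly R}) (x : R) : R :=
  if 0 < x then q.[x^-1] * expR (- x^-1) else 0.

Definition flat_deriv (q : {poly R}) : {poly R} := 'X^2 * (q - q^`()).

(** With [y = 1 / x], the bound [y^(i+2) <= (i+2)! e^y] gives [y^i e^(-y) <= (i+2)! x^2]. A
    quadratic bound is what makes the derivative at 0 exist and vanish, whatever [q]. *)
Lemma flat_sqr_bound (q : {poly R}) : exists C, forall x, `|flat q x| <= C * x ^+ 2.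
Proof.
pose C := \sum_(i < size q) `|q`_i| * (i + 2)`!%:R; exists C => x.
have C0 : 0 <= C by apply: sumr_ge0 => i _; rewrite mulr_ge0.
rewrite /flat; case: ifPn => x0; last by rewrite normr0 mulr_ge0// sqr_ge0.
have y0 : 0 < x^-1 by rewrite invr_gt0.
rewrite normrM (ger0_norm (expR_ge0 _)) horner_coef.
apply: (@le_trans _ _ (\sum_(i < size q) `|q`_i * x^-1 ^+ i| * expR (- x^-1))).
  by rewrite -mulr_suml ler_wpM2r ?expR_ge0// ler_norm_sum.
rewrite /C mulr_suml; apply: ler_sum => i _.
rewrite normrM -!mulrA ler_wpM2l// (ger0_norm (exprn_ge0 _ (ltW y0))).
have := @expR_ge_coeff x^-1 (i + 2) (ltW y0).
rewrite -ler_pdivrMr ?expR_gt0// -expRN exprD => h.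
rewrite -[leLHS]mulr1 -[X in _ * X <= _](@mulVf _ (x^-1 ^+ 2)) ?expf_neq0 ?gt_eqF//.
rewrite (mulrC (x^-1 ^- 2)) mulrA -exprVn invrK ler_wpM2r ?sqr_ge0//.
by rewrite mulrAC.
Qed.

Lemma sqr_bound_is_derive0 (f : R -> R) C : (forall x, `|f x| <= C * x ^+ 2) ->
  is_derive (0 : R) (1 : R) f 0.
Proof.
move=> fC; have f0 : f 0 = 0.
  by apply/eqP; rewrite -normr_le0 (le_trans (fC 0))// expr0n/= mulr0.
have C0 : 0 <= C by have := le_trans (normr_ge0 _) (fC 1); rewrite expr1n mulr1.
have lim : h^-1 *: (f (h *: 1 + 0) - f 0) @[h --> (0:R)^'] --> (0 : R).
  apply/cvgrPdist_le => e e0; near=> h.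
  have h0 : h != 0 by near: h; exact: nbhs_dnbhs_neq.
  rewrite sub0r normrN f0 subr0 addr0 /GRing.scale/= mulr1 normrM normfV.
  rewrite ler_pdivrMl ?normr_gt0// (le_trans (fC h))//.
  rewrite -(real_normK (num_real h)) expr2 mulrCA ler_wpM2l//.
  have hC : `|h| <= e / (C + 1).
    by near: h; apply: dnbhs0_le; rewrite divr_gt0// ltr_wpDl.
  apply: (le_trans (ler_wpM2l C0 hC)); rewrite mulrA ler_pdivrMr ?ltr_wpDl//.
  by rewrite mulrC ler_wpM2l ?ltW// ltrDl.
apply: DeriveDef; first by apply: cvgP lim.
exact: cvg_lim lim.
Unshelve. all: end_near. Qed.

Lemma is_derive_flat q (x : R) : is_derive x (1 : R) (flat q) (flat (flat_deriv q) x).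
Proof.
have [x0|x0|<-] := ltgtP 0 x.
- rewrite {2}/flat x0.
  have d1 : is_derive (x : R) (1 : R) (fun y => q.[y^-1] * expR (- y^-1)) ((flat_deriv q).[x^-1] * expR (- x^-1)).
    have xn0 : x != 0 by rewrite gt_eqF.
    have dV : is_derive (x : R) (1 : R) (fun y : R => y^-1) (- x ^- 2).
      by have := is_deriveV xn0 (is_derive_id x (1 : R)); rewrite /GRing.scale/= mulr1; exact.
    have dq : is_derive (x : R) (1 : R) (fun y : R => q.[y^-1]) (q^`().[x^-1] * (- x ^- 2)).
      exact: (@is_derive1_comp _ (horner q) (fun y : R => y^-1) x _ _ (is_derive_poly q x^-1) dV).
    have dE : is_derive (x : R) (1 : R) (fun y : R => expR (- y^-1)) (expR (- x^-1) * (x ^- 2)).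
      have dN : is_derive (x : R) (1 : R) (fun y : R => - y^-1) (x ^- 2).
        by have := is_deriveN dV; rewrite opprK.
      exact: (@is_derive1_comp _ (@expR R) (fun y : R => - y^-1) x _ _ (is_derive_expR _) dN).
    apply: (is_derive_eq (is_deriveM dq dE)).
    rewrite /flat_deriv /GRing.scale/= hornerM hornerXn hornerD hornerN exprVn; ring.
  apply: near_eq_is_derive d1; near=> y; rewrite /flat.
  suff -> : 0 < y by [].
  by near: y; exact: lt_nbhsr.
- rewrite {2}/flat ltNge (ltW x0)/=.
  apply: (near_eq_is_derive (f := fun=> 0)); near=> y; rewrite /flat.
  suff : y < 0 by move=> /ltW; rewrite leNgt => /negbTE ->.
  by near: y; exact: lt_nbhsl.
- rewrite {2}/flat ltxx; have [C hC] := flat_sqr_bound q.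
  exact: sqr_bound_is_derive0 hC.
Unshelve. all: end_near. Qed.

(** The statement carries the factor [c] and an arbitrary [q] because differentiation changes both,
    to [c * a] and [flat_deriv q]; the induction on [k] is then immediate. *)
Lemma smooth1_flat (a b : R) k c q : smooth1 k (fun x => c * flat q (a * x + b)).
Proof.
have d c' q' (x : R) : is_derive (x : R) (1 : R) (fun x => c' * flat q' (a * x + b)) (c' * a * flat (flat_deriv q') (a * x + b)).
  have da : is_derive (x : R) (1 : R) (fun x => a * x + b) a.
    by apply: is_derive_eq; rewrite /GRing.scale/=; ring.
  have df : is_derive (x : R) (1 : R) (fun x => flat q' (a * x + b)) (flat (flat_deriv q') (a * x + b) * a).
    exact: (@is_derive1_comp _ (flat q') (fun x => a * x + b) x _ _ (is_derive_flat q' _) da).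
  by apply: is_derive_eq; rewrite /GRing.scale/=; ring.
have cont c' q' : continuous (fun x => c' * flat q' (a * x + b)).
  by move=> x; apply: differentiable_continuous; apply/derivable1_diffP; have := d c' q' x; case.
elim: k c q => [|k IH] c q; split => //; split.
  by move=> x; have := d c q x; case.
rewrite (_ : derive1 _ = fun x => (c * a) * flat (flat_deriv q) (a * x + b)); first exact: IH.
by apply/funext => x; rewrite derive1E; have := d c q x => -[].
Qed.

(** The first factor is positive exactly for [x > c - e], the second exactly for [x < c + e]. *)
Definition bumpf (c e x : R) : R := flat 1 (x - c + e) * flat 1 (e - (x - c)).

Lemma smooth1_bump c e k : smooth1 k (bumpf c e).
Proof.
rewrite (_ : bumpf c e = fun x => (1 * flat 1 (1 * x + (e - c))) * (1 * flat 1 (- 1 * x + (e + c)))).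
  by apply: smooth1M; exact: smooth1_flat.
by apply/funext => x; rewrite /bumpf !mul1r mulN1r; congr (flat 1 _ * flat 1 _); ring.
Qed.

Lemma bump_ge0 c e x : 0 <= bumpf c e x.
Proof.
have f0 y : 0 <= flat 1 y by rewrite /flat; case: ifP => // _; rewrite hornerC mul1r expR_ge0.
exact: mulr_ge0.
Qed.

Lemma bump_gt0 c e : 0 < e -> 0 < bumpf c e c.
Proof.
by move=> e0; rewrite /bumpf subrr add0r subr0 /flat e0 hornerC mul1r mulr_gt0// expR_gt0.
Qed.

Lemma bump_out c e x : e <= `|x - c| -> bumpf c e x = 0.
Proof.
rewrite ler_normr /bumpf /flat => /orP[h|h].
  by rewrite (_ : 0 < e - (x - c) = false) ?mulr0//; apply/negbTE; rewrite -leNgt; lra.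
by rewrite (_ : 0 < x - c + e = false) ?mul0r//; apply/negbTE; rewrite -leNgt; lra.
Qed.

Lemma derive1_out (f : R -> R) (A : R) : (forall x, A < `|x| -> f x = 0) ->
  forall x, A < `|x| -> derive1 f x = 0.
Proof.
move=> fA x xA; rewrite derive1E.
have : is_derive (x : R) (1 : R) f 0.
  apply: (near_eq_is_derive (f := fun=> 0)); near=> y; apply/esym/fA.
  by near: y; apply: (cvgr_gt _ (@norm_continuous _ R x)).
by case.
Unshelve. all: end_near. Qed.

(** The strict inequality leaves room: the derivatives are seen to vanish on the open set
    [|x| > |c| + e], where the function is locally zero, while [bump2] asks for [A <= |x|]. *)
Lemma bump2_bump c e (A : R) : `|c| + e < A ->
  bump2 A (bumpf c e) (derive1 (bumpf c e)) (derive1 (derive1 (bumpf c e))).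
Proof.
move=> cA; have [_ [d1 [_ [d2 [c2 _]]]]] := smooth1_bump c e 3.
have b0 x : `|c| + e < `|x| -> bumpf c e x = 0.
  by move=> h; apply: bump_out; have := ler_distD c x 0; rewrite !subr0; lra.
have b1 := derive1_out b0; have b2 := derive1_out b1.
split.
- by move=> x; apply: DeriveDef; [exact: d1|rewrite derive1E].
- by move=> x; apply: DeriveDef; [exact: d2|rewrite [in RHS]derive1E].
- exact: c2.
- by move=> x xA; have h := lt_le_trans cA xA; split; [exact: b0|exact: b1|exact: b2].
- exact: bump_ge0.
Qed.

Lemma smooth1_Ck k (f g : R -> R) : smooth1 k f -> smooth1 k g ->
  Ck k (fun x y => f x * g y).
Proof.
elim: k f g => [|k IH] f g sf sg; have cf := smooth1_continuous sf; have cg := smooth1_continuous sg.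
  exact: continuous_tensor.
have [_ [df sf']] := sf; have [_ [dg sg']] := sg.
split; first exact: continuous_tensor.
split; first by move=> x y; apply: derivableM => //; exact: derivable_cst.
split; first by move=> x y; apply: derivableM => //; exact: derivable_cst.
split.
  rewrite (_ : pdx _ = fun x y => derive1 f x * g y).
    by apply: IH => //; exact: smooth1_pred.
  apply/funext => x; apply/funext => y; rewrite /pdx !derive1E deriveM// derive_cst scaler0 add0r.
  by rewrite /GRing.scale/= mulrC.
rewrite (_ : pdy _ = fun x y => f x * derive1 g y).
  by apply: IH => //; exact: smooth1_pred.
apply/funext => x; apply/funext => y; rewrite /pdy !derive1E deriveM// derive_cst scaler0 addr0.
by rewrite /GRing.scale/=.
Qed.

Lemma test_function_bump (c d e : R) :
  test_function (fun z : R[i] => bumpf c e (complex.Re z) * bumpf d e (complex.Im z)).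
Proof.
split; first by move=> k; apply: smooth1_Ck; exact: smooth1_bump.
exists (`|c| + `|d| + e) => x y [h|h] /=.
  by rewrite bump_out ?mul0r//; have := ler_distD c x 0; rewrite !subr0; have := normr_ge0 d; lra.
by rewrite mulrC bump_out ?mul0r//; have := ler_distD d y 0; rewrite !subr0; have := normr_ge0 c; lra.
Qed.
End smooth.

(** * Asymptotics of the covariance kernel *)

Section gseries.
Variable R : realType.

(** Taylor coefficients of [g^(k)]: since [g(s)] is the integral of [e^(s x)] over [[0, 1]],
    [g^(k)(s)] is that of [x^k e^(s x)], and [x^(i+k)] integrates to [1 / (i + k + 1)]. *)
Definition gcoef (k i : nat) : R := (i`!%:R * (i + k).+1%:R)^-1.

Definition gser (k : nat) (s : R) : R := limn (pseries (gcoef k) s).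

Lemma gcoef_gt0 k i : 0 < gcoef k i.
Proof. by rewrite invr_gt0 mulr_gt0 ?ltr0n ?fact_gt0. Qed.

Lemma pseries_diffs_gcoef k : pseries_diffs (gcoef k) = gcoef k.+1.
Proof.
apply/funext => i; rewrite /pseries_diffs /gcoef factS natrM addSnnS.
by rewrite -mulrA invfM mulrA divff ?pnatr_eq0// mul1r.
Qed.

Lemma is_cvg_gser k (x : R) : cvgn (pseries (gcoef k) x).
Proof.
apply: normed_cvg; apply: (@series_le_cvg _ _ (exp_coeff `|x|)) => /=.
- by move=> n; rewrite normr_ge0.
- by move=> n; rewrite /exp_coeff /= divr_ge0// exprn_ge0.
- move=> n; rewrite /exp_coeff /= normrM normrX (ger0_norm (ltW (gcoef_gt0 _ _))) [leRHS]mulrC ler_wpM2r ?exprn_ge0//.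
  rewrite /gcoef lef_pV2 ?posrE ?mulr_gt0 ?ltr0n ?fact_gt0//.
  by rewrite ler_peMr ?ler0n// ler1n.
- exact: is_cvg_series_exp_coeff.
Qed.

Lemma is_derive_gser k (x : R) : is_derive x (1 : R) (gser k) (gser k.+1 x).
Proof.
rewrite /gser -pseries_diffs_gcoef.
apply: (@pseries_snd_diffs _ _ (`|x| + 1)); rewrite ?pseries_diffs_gcoef; try exact: is_cvg_gser.
by rewrite [ltRHS]ger0_norm ?addr_ge0// ltrDl.
Qed.

(** Integration by parts for the integral of [x^k e^(s x)] over [[0, 1]], carried out on the
    coefficients: [i + (k + 1)] cancels the denominator of [gcoef k i]. *)
Lemma gser_ode k (s : R) : s * gser k.+1 s + k.+1%:R * gser k s = expR s.
Proof.
have c1 := pseries_diffs_equiv (f := gcoef k) (x := s).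
rewrite pseries_diffs_gcoef in c1; have {}c1 := c1 (@is_cvg_gser k.+1 s).
have c2 : series (fun i => gcoef k i * s ^+ i) @ \oo --> gser k s by exact: is_cvg_gser.
have c3 : series (exp_coeff s) @ \oo --> s * gser k.+1 s + k.+1%:R * gser k s.
  rewrite (_ : series (exp_coeff s) = fun n => s * series (fun i => i%:R * gcoef k i * s ^+ i.-1) n
      + k.+1%:R * series (fun i => gcoef k i * s ^+ i) n); last first.
    apply/funext => n; rewrite !seriesEnat /= !mulr_sumr -big_split/=.
    apply: eq_bigr => i _; rewrite /exp_coeff /gcoef /=.
    have h1 : i`!%:R != 0 :> R by rewrite pnatr_eq0 -lt0n fact_gt0.
    have h2 : (i + k).+1%:R != 0 :> R by rewrite pnatr_eq0.
    have -> : s * (i%:R * (i`!%:R * (i + k).+1%:R)^-1 * s ^+ i.-1) = i%:R * (i`!%:R * (i + k).+1%:R)^-1 * s ^+ i.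
      by case: i {h1 h2} => [|i]; rewrite ?mul0r ?mulr0// exprS; ring.
    rewrite mulrA -mulrDl -mulrDl -natrD addnS invfM mulrCA divff// mulr1 mulrC//.
  apply: cvgD; apply: cvgM; try exact: cvg_cst; [exact: c1|exact: c2].
by rewrite /expR; apply/esym/cvg_lim.
Qed.

(** For [s >= 0] the first term of the series suffices. For [s < 0] the terms alternate; by
    [gser_ode] the function [h r = r^(k+1) g^(k)(-r)] has derivative [r^k e^(-r)], so it increases
    from [h 0 = 0], and [h (-s) > 0]. *)
Lemma gser_gt0 k (s : R) : 0 < gser k s.
Proof.
have [s0|s0] := leP 0 s.
  have c2 : series (fun i => gcoef k i * s ^+ i) @ \oo --> gser k s by exact: is_cvg_gser.
  apply: (@lt_le_trans _ _ (gcoef k 0)); first exact: gcoef_gt0.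
  have : gcoef k 0 <= limn (series (fun i => gcoef k i * s ^+ i)).
    apply: limr_ge; first exact: is_cvg_gser.
    near=> n; rewrite seriesEnat /=.
    have n0 : (0 < n)%N by near: n; exists 1%N.
    rewrite -(prednK n0) big_nat_recl// expr0 mulr1 lerDl.
    by apply: sumr_ge0 => i _; rewrite mulr_ge0 ?exprn_ge0// ltW// gcoef_gt0.
  exact.
pose h (r : R) := r ^+ k.+1 * gser k (- r).
have dh (r : R) : is_derive r (1 : R) h (r ^+ k * expR (- r)).
  have dg := is_derive_gser k (- r).
  have dg2 : is_derive (r : R) (1 : R) (fun r => gser k (- r)) (gser k.+1 (- r) * (- 1)).
    exact: (@is_derive1_comp _ (gser k) -%R).
  rewrite -(gser_ode k (- r)) /h.
  have dX : is_derive (r : R) (1 : R) (fun r : R => r ^+ k.+1) (k.+1%:R * r ^+ k).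
    rewrite (_ : (fun r => _) = (id : R -> R) ^+ k.+1); last by apply/funext => x; rewrite exprfctE.
    by apply: is_derive_eq; rewrite /GRing.scale/= mulr1.
  apply: (is_derive_eq (is_deriveM dX dg2)); rewrite /GRing.scale/= exprS; ring.
have r0 : 0 < - s by rewrite oppr_gt0.
suff : h 0 < h (- s).
  rewrite /h opprK expr0n/= mul0r pmulr_rgt0// exprn_gt0//.
have ch : {within `[0, - s], continuous h}.
  by apply: continuous_subspaceT => x; apply: differentiable_continuous; apply/derivable1_diffP; have := dh x; case.
have [c] := MVT r0 (fun x _ => dh x) ch.
rewrite in_itv/= => /andP[c0 cs] e.
by rewrite -subr_gt0 e subr0 mulr_gt0// mulr_gt0 ?expR_gt0// exprn_gt0.
Unshelve. all: end_near. Qed.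

Lemma gser_le k (s t : R) : s <= t -> gser k s <= gser k t.
Proof.
rewrite le_eqVlt => /predU1P[->//|st].
have ch : {within `[s, t], continuous (gser k)}.
  by apply: continuous_subspaceT => x; apply: differentiable_continuous; apply/derivable1_diffP; have := is_derive_gser k x; case.
have [c _ e] := MVT st (fun x _ => is_derive_gser k x) ch.
by rewrite -subr_ge0 e; apply: mulr_ge0; apply: ltW; rewrite ?gser_gt0// subr_gt0.
Qed.

(** Since [(i + 1) i! = (i + 1)!], the series [1 + s * gser 0 s] is the exponential series shifted
    by one index. At [s = 0] the value 1 assigned by [gfun] is the constant coefficient. *)
Lemma gfun_gser : @gfun R = gser 0.
Proof.
apply/funext => s; rewrite /gfun.
case: eqVneq => [->|s0].
  apply/esym/cvg_lim => //; rewrite /pseries.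
  apply: cvg_near_cst; near=> n; rewrite seriesEnat/=.
  have n0 : (0 < n)%N by near: n; exists 1%N.
  rewrite -(prednK n0) big_nat_recl// expr0 mulr1 big1 ?addr0.
    by rewrite /gcoef fact0 mul1r invr1.
  by move=> i _; rewrite expr0n/= mulr0.
have c1 : series (exp_coeff s) @ \oo --> expR s by exact: is_cvg_series_exp_coeff.
have c2 : series (fun i => gcoef 0 i * s ^+ i) @ \oo --> gser 0 s by exact: is_cvg_gser.
have c3 : (fun n => series (exp_coeff s) n.+1) @ \oo --> expR s by rewrite cvg_shiftS.
have c4 : (fun n => series (exp_coeff s) n.+1) @ \oo --> 1 + s * gser 0 s.
  rewrite (_ : (fun n => _) = fun n => 1 + s * series (fun i => gcoef 0 i * s ^+ i) n).
    by apply: cvgD; [exact: cvg_cst|apply: cvgM => //; exact: cvg_cst].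
  apply/funext => n; rewrite !seriesEnat /= big_nat_recl// mulr_sumr; congr (_ + _).
    by rewrite /exp_coeff /= expr0 fact0 divr1.
  apply: eq_bigr => i _; rewrite /exp_coeff/= /gcoef addn0 factS natrM exprS (mulrC i`!%:R) (mulrC _^-1) mulrA//.
by rewrite (cvg_unique _ c3 c4)// addrC addKr mulrC mulKf.
Unshelve. all: end_near. Qed.

Lemma gder_gser j : @gder R j = gser j.
Proof.
rewrite /gder; elim: j => [|j IH] /=; first by rewrite gfun_gser.
by apply/funext => s; rewrite IH derive1E; have := is_derive_gser j s => -[].
Qed.

Lemma leading_termE L (s : R) : (1 <= L)%N -> leading_term L s =
  (gser L.+1 s * gser L.-1 s - gser L s ^+ 2) / gser L.-1 s ^+ 2.
Proof.
case: L => // k _; rewrite /leading_term !gder_gser /= derive1E.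
have g0 : gser k s != 0 by rewrite gt_eqF// gser_gt0.
have d1 := is_derive_gser k s; have d2 := is_derive_gser k.+1 s.
have dV := is_deriveV g0 d1.
have : is_derive s (1 : R) (fun t => gser k.+1 t / gser k t)
   ((gser k.+2 s * gser k s - gser k.+1 s ^+ 2) / gser k s ^+ 2).
  by apply: is_derive_eq; rewrite /GRing.scale/=; field.
by case.
Qed.
End gseries.

From mathcomp Require Import zify.

(** * Convergence of the rescaled covariance polynomial *)

Section asymptotics.
Variable R : realType.

Lemma ffact_add n m1 m2 : (n ^_ (m1 + m2) = n ^_ m1 * (n - m1) ^_ m2)%N.
Proof.
elim: m2 => [|m2 IH]; first by rewrite addn0 ffactn0 muln1.
by rewrite addnS !ffactnSr IH -mulnA subnDA.
Qed.

Lemma ffactS_diff n k : (n.+1 ^_ k.+1 = n ^_ k.+1 + k.+1 * n ^_ k)%N.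
Proof.
rewrite ffactSS ffactnSr; have [kn|nk] := leqP k n; last by rewrite ffact_small// !muln0.
by rewrite mulnC [X in (_ + X)%N]mulnC -mulnDr; congr muln; lia.
Qed.

(** The sum telescopes: [l! i! C(N+l, N) C(N, i)] is the falling factorial [(N + l) ^_ (l + i)], and
    [ffactS_diff] identifies [l + i + 1] times it as a difference of consecutive falling factorials.
    It gives the Taylor coefficients of [K] at [t = 1] in closed form. *)
Lemma sum_bin_bin l i N :
  (l`! * i`! * (l + i).+1 * \sum_(m < N) 'C(m + l, m) * 'C(m, i) = (N + l) ^_ (l + i).+1)%N.
Proof.
elim: N => [|N IH]; first by rewrite big_ord0 muln0 add0n ffact_small// ltnS leq_addr.
rewrite big_ord_recr /= mulnDr IH addSn ffactS_diff; congr addn.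
have h1 : ('C(N + l, N) * l`! = (N + l) ^_ l)%N.
  by rewrite -bin_ffact -(@bin_sub (N + l) l) ?leq_addl// addnK.
have -> : ((N + l) ^_ (l + i) = (N + l) ^_ l * N ^_ i)%N by rewrite ffact_add addnK.
by rewrite -h1 -bin_ffact; ring.
Qed.

Definition Kpoly (L N : nat) : {poly R} := \poly_(m < N.+1) ('C(m + L - 1, m))%:R.

(** The factor by which the coefficients of the rescaled polynomial differ from those of the limit;
    it tends to 1 as [N] grows with [n] fixed. *)
Definition ratioP (L N n : nat) : R := ((N + L) ^_ n)%:R / N%:R ^+ n.

Definition Bpoly (L N : nat) : {poly R} :=
  (L.-1`!%:R / N%:R ^+ L) *: (Kpoly L N \Po (1 + N%:R^-1 *: 'X)).

(** An exact identity: expanding [K (1 + s / N)] leaves [\sum_m C(m+l, m) C(m, i)] with [l = L - 1],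
    which [sum_bin_bin] evaluates. The normalisation in [Bpoly] is the one that leaves [gcoef] times
    a ratio close to 1. *)
Lemma coef_Bpoly L N i : (0 < L)%N -> (0 < N)%N ->
  (Bpoly L N)`_i = ratioP L N (L + i) * gcoef R L.-1 i.
Proof.
case: L => // l _ N0; rewrite /Bpoly coefZ comp_polyE coef_sum.
have sz : (size (Kpoly l.+1 N) <= N.+1)%N by exact: size_poly.
transitivity (l`!%:R / N%:R ^+ l.+1 * \sum_(m < N.+1) ('C(m + l, m) * 'C(m, i))%:R * N%:R^-1 ^+ i : R).
  congr (_ * _).
  pose F (m : nat) : R := ('C(m + l, m) * 'C(m, i))%:R * N%:R^-1 ^+ i.
  have E (m : nat) : ((Kpoly l.+1 N)`_m *: (1 + N%:R^-1 *: 'X) ^+ m)`_i = (Kpoly l.+1 N)`_m * 'C(m, i)%:R * N%:R^-1 ^+ i.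
    rewrite coefZ exprDn coef_sum -mulrA; congr (_ * _).
    have T (j : nat) : ((1 ^+ (m - j) * (N%:R^-1 *: 'X) ^+ j : {poly R}) *+ 'C(m, j))`_i = 'C(m, j)%:R * N%:R^-1 ^+ j * (i == j)%:R.
      by rewrite expr1n mul1r exprZn coefMn coefZ coefXn -[LHS]mulr_natl mulrA.
    under eq_bigr do rewrite T.
    have [im|mi] := leqP i m; last first.
      rewrite bin_small// mul0r big1// => j _; case: eqP => [ij|]; last by rewrite mulr0.
      by move: (ltn_ord j) mi; rewrite -ij ltnS leqNgt => /negbTE ->.
    rewrite (bigD1 (Ordinal (im : (i < m.+1)%N)))//= eqxx mulr1 big1 ?addr0//.
    move=> j ji; case: eqP => [ij|]; last by rewrite mulr0.
    by move: ji; rewrite -val_eqE /= -ij eqxx.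
  under eq_bigr do rewrite E.
  rewrite -(big_mkord xpredT (fun m => (Kpoly l.+1 N)`_m * 'C(m, i)%:R * N%:R^-1 ^+ i)).
  rewrite -(big_mkord xpredT F) [RHS](big_cat_nat _ (n := size (Kpoly l.+1 N)))//=.
  rewrite [X in _ = _ + X]big_nat_cond [X in _ = _ + X]big1 ?addr0.
    rewrite !big_nat; apply: eq_bigr => m /andP[_ ms]; rewrite /F coef_poly (leq_trans ms sz).
    by rewrite addnS subn1 /= natrM.
  (* Indices between the size of the polynomial and [N + 1] cannot occur: the coefficient there
     would be zero, but it is a positive binomial. *)
  move=> m; rewrite andbT => /andP[sm mN].
  have := leq_sizeP _ _ (leqnn (size (Kpoly l.+1 N))) m sm.
  rewrite coef_poly mN addnS subn1 /= => /eqP; rewrite pnatr_eq0 -leqn0 leqNgt bin_gt0.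
  by rewrite leq_addr.
rewrite -mulr_suml -natr_sum /ratioP /gcoef exprVn.
have -> : (N + l.+1)%N = (N.+1 + l)%N by lia.
have -> : (l.+1 + i)%N = (l + i).+1 by [].
have -> : l.+1.-1 = l by [].
rewrite -(sum_bin_bin l i N.+1) !natrM (addnC i l) !exprS exprD.
have h1 : N%:R != 0 :> R by rewrite pnatr_eq0 -lt0n.
have h2 : i`!%:R != 0 :> R by rewrite pnatr_eq0 -lt0n fact_gt0.
have h3 : (l + i).+1%:R != 0 :> R by rewrite pnatr_eq0.
have h4 : N%:R ^+ l != 0 :> R by rewrite expf_neq0.
have h5 : N%:R ^+ i != 0 :> R by rewrite expf_neq0.
move: (N%:R ^+ l) (N%:R ^+ i) h4 h5 => Nl Ni h4 h5.
move: ((l + i).+1%:R) ((\sum_(_ < _) _)%:R) h3 => r S h3.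
by field; rewrite h1 h2 h3 h4 h5.
Qed.

Lemma coef_derivn_Bpoly L N j i : (0 < L)%N -> (0 < N)%N ->
  ((Bpoly L N)^`(j))`_i = ratioP L N (L + j + i) * gcoef R (L.-1 + j) i.
Proof.
move=> L0 N0; rewrite coef_derivn coef_Bpoly// -mulr_natr -mulrA addnA; congr (_ * _).
rewrite /gcoef (_ : i + (L.-1 + j) = j + i + L.-1)%N; last by lia.
have fd : ((j + i) ^_ j * i`! = (j + i)`!)%N by rewrite -{2}(addKn j i) ffact_fact// leq_addr.
rewrite -fd natrM.
have h1 : ((j + i) ^_ j)%:R != 0 :> R by rewrite pnatr_eq0 -lt0n ffact_gt0 leq_addr.
by rewrite -mulrA invfM mulrC mulrA divff// mul1r.
Qed.

(** Induction on [n] through the factor [(N + L - n) / N]. The error bound is allowed to grow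
    geometrically in [n], since it is later summed against [A^i / i!]; the 4 leaves room for
    [n <= 4^n] and for the previous error in the inductive step. *)
Lemma ratioP_bounds L N n : (0 < N)%N ->
  0 <= ratioP L N n <= (1 + L%:R) ^+ n /\
  `|ratioP L N n - 1| <= (4 * (1 + L%:R)) ^+ n / N%:R.
Proof.
move=> N0; have NR : 0 < N%:R :> R by rewrite ltr0n.
have N1 : 1 <= N%:R :> R by rewrite ler1n.
have L0 : 0 <= L%:R :> R by [].
elim: n => [|n [/andP[IH0 IH1] IH2]].
  by rewrite /ratioP ffactn0 !expr0 divr1 lexx ler01 subrr normr0 divr_ge0// ltW.
pose q : R := (N + L - n)%:R / N%:R.
have E : ratioP L N n.+1 = ratioP L N n * q.
  by rewrite /ratioP /q ffactnSr natrM exprSr invfM mulrACA.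
have q0 : 0 <= q by rewrite divr_ge0.
have q1 : q <= 1 + L%:R.
  rewrite /q ler_pdivrMr// (@le_trans _ _ (N + L)%:R)// ?ler_nat ?leq_subr// natrD mulrDl mul1r lerD2l.
  by rewrite ler_peMr.
have qb : `|q - 1| <= (L%:R + n%:R) / N%:R.
  have -> : q - 1 = ((N + L - n)%:R - N%:R) / N%:R by rewrite /q mulrBl divff// gt_eqF.
  rewrite normrM normfV (gtr0_norm NR) ler_pM2r ?invr_gt0//.
  have [h|h] := leqP n (N + L).
    rewrite natrB// natrD (_ : _ - _ = L%:R - n%:R); last by ring.
    by rewrite (le_trans (ler_normB _ _))// !ger0_norm.
  (* Past [n = N + L] the truncated subtraction gives 0; then [|q - 1| = 1], still below
     [(L + n) / N]. *)
  have -> : (N + L - n = 0)%N by apply/eqP; rewrite subn_eq0 ltnW.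
  by rewrite sub0r normrN ger0_norm// -natrD ler_nat; lia.
rewrite E; split.
  by rewrite mulr_ge0//= exprSr ler_pM.
rewrite (_ : ratioP L N n * q - 1 = ratioP L N n * (q - 1) + (ratioP L N n - 1)); last by ring.
apply: (le_trans (ler_normD _ _)); rewrite normrM (ger0_norm IH0).
apply: (@le_trans _ _ ((1 + L%:R) ^+ n * ((L%:R + n%:R) / N%:R) + (4 * (1 + L%:R)) ^+ n / N%:R)).
  by apply: lerD => //; apply: ler_pM.
rewrite mulrA -mulrDl ler_pM2r ?invr_gt0// exprSr !exprMn.
have n4 : n%:R <= 4 ^+ n :> R by rewrite -natrX ler_nat ltnW// ltn_expl.
have f1 : 1 <= 4 ^+ n :> R by rewrite exprn_ege1// ler1n.
have e0 : 0 <= (1 + L%:R) ^+ n :> R by rewrite exprn_ge0// addr_ge0.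
rewrite -[X in _ <= X](_ : (1 + L%:R) ^+ n * (4 ^+ n * (4 * (1 + L%:R))) = _); last by ring.
rewrite (mulrC (4 ^+ n)) -mulrDr ler_wpM2l//.
have : L%:R <= 4 ^+ n * L%:R :> R by rewrite ler_peMl.
by nra.
Qed.

(** Coefficientwise comparison: the difference has terms [(ratioP - 1) gcoef s^i], bounded by
    [D^(L+j) / N] times the terms of the exponential series at [D A]. *)
Lemma Bpoly_derivn_bound L N j (A s : R) : (0 < L)%N -> (0 < N)%N -> 0 < A -> `|s| <= A ->
  `|(Bpoly L N)^`(j).[s] - gser (L.-1 + j) s| <=
   (4 * (1 + L%:R)) ^+ (L + j) * expR (4 * (1 + L%:R) * A) / N%:R.
Proof.
move=> L0 N0 A0 sA; set D := 4 * (1 + L%:R).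
have NR : 0 < N%:R :> R by rewrite ltr0n.
have D0 : 0 <= D by rewrite mulr_ge0// addr_ge0.
set k := (L.-1 + j)%N; set p := (Bpoly L N)^`(j).
have c2 : series (fun i => gcoef R k i * s ^+ i) @ \oo --> gser k s by exact: is_cvg_gser.
pose u n := p.[s] - series (fun i => gcoef R k i * s ^+ i) n.
have cu : u @ \oo --> p.[s] - gser k s by apply: cvgB => //; exact: cvg_cst.
have cn : (fun n => `|u n|) @ \oo --> `|p.[s] - gser k s| by exact: cvg_norm cu.
rewrite -(cvg_lim _ cn)//; apply: limr_le; first by apply: cvgP cn.
near=> n.
(* Once [n] exceeds the size of [p], the polynomial can be summed over the same range as the partial
   sum of the series. *)
have sz : (size p <= n)%N by near: n; exists (size p) => //.
have -> : u n = \sum_(0 <= i < n) (ratioP L N (L + j + i) - 1) * (gcoef R k i * s ^+ i).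
  rewrite /u seriesEnat /= (@horner_coef_wide _ n)// -(big_mkord xpredT (fun i => p`_i * s ^+ i)) -sumrB.
  by apply: eq_bigr => i _; rewrite /p coef_derivn_Bpoly//; ring.
apply: (le_trans (ler_norm_sum _ _ _)).
apply: (@le_trans _ _ (\sum_(0 <= i < n) D ^+ (L + j) / N%:R * exp_coeff (D * A) i)).
  apply: ler_sum => i _; rewrite normrM normrM normrX (ger0_norm (ltW (gcoef_gt0 R k i))).
  have [_ h] := @ratioP_bounds L N (L + j + i) N0.
  rewrite /exp_coeff /= (exprMn i D A).
  apply: (@le_trans _ _ (D ^+ (L + j + i) / N%:R * ((i`!%:R)^-1 * A ^+ i))).
    apply: ler_pM => //; first by rewrite mulr_ge0// ?exprn_ge0// ltW// gcoef_gt0.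
    apply: ler_pM; rewrite ?exprn_ge0// ?(ltW (gcoef_gt0 R k i))//.
      rewrite /gcoef lef_pV2 ?posrE ?mulr_gt0 ?ltr0n ?fact_gt0//.
      by rewrite ler_peMr// ler1n.
    by rewrite lerXn2r// nnegrE ltW.
  by rewrite exprD le_eqVlt; apply/orP; left; apply/eqP; ring.
rewrite -mulr_sumr mulrAC ler_pM2r ?invr_gt0//.
rewrite ler_wpM2l ?exprn_ge0//.
have -> : \sum_(0 <= i < n) exp_coeff (D * A) i = series (exp_coeff (D * A)) n by rewrite seriesEnat.
apply: nondecreasing_cvgn_le; last exact: is_cvg_series_exp_coeff.
by apply: nondecreasing_series => i _ _; rewrite /exp_coeff/= divr_ge0// exprn_ge0// mulr_ge0// ltW.
Unshelve. all: end_near. Qed.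

Lemma Kpoly_Bpoly L N (s : R) : (0 < N)%N ->
  let c := L.-1`!%:R / N%:R ^+ L in let t := 1 + s / N%:R in
  [/\ (Bpoly L N)^`(0).[s] = c * (Kpoly L N).[t],
      (Bpoly L N)^`(1).[s] = c / N%:R * (Kpoly L N)^`().[t] &
      (Bpoly L N)^`(2).[s] = c / N%:R ^+ 2 * (Kpoly L N)^`()^`().[t]].
Proof.
move=> N0 c t.
pose q : {poly R} := 1 + N%:R^-1 *: 'X.
have dq : q^`() = (N%:R^-1)%:P.
  by rewrite /q derivD derivZ derivX derivC add0r alg_polyC.
have qs : q.[s] = t by rewrite /q hornerD hornerC hornerZ hornerX mulrC.
have d1 : (Bpoly L N)^`() = (c / N%:R) *: ((Kpoly L N)^`() \Po q).
  by rewrite /Bpoly derivZ deriv_comp dq [X in _ *: X]mulrC mul_polyC scalerA.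
have d2 : (Bpoly L N)^`()^`() = (c / N%:R ^+ 2) *: ((Kpoly L N)^`()^`() \Po q).
  by rewrite d1 derivZ deriv_comp dq [X in _ *: X]mulrC mul_polyC scalerA expr2 invfM mulrA.
split.
- by rewrite derivn0 /Bpoly hornerZ horner_comp qs.
- by rewrite derivn1 d1 hornerZ horner_comp qs.
- by rewrite (_ : (Bpoly L N)^`(2) = (Bpoly L N)^`()^`())// d2 hornerZ horner_comp qs.
Qed.

(** Used with [G0 = g^(L-1)(s)], [G] one of the next two derivatives, and [S0], [S] their polynomial
    approximations. The first estimate rests on [S0 * G0 >= d^2 / 2]. *)
Lemma quotient_perturbation (M c d e S G S0 G0 : R) : 0 < d -> d <= G0 -> G0 <= M ->
  d / 2 <= S0 -> 0 < G -> G <= M -> 0 <= e -> e <= c -> `|S - G| <= e -> `|S0 - G0| <= e ->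
  `|S / S0 - G / G0| <= 4 * M * e / d ^+ 2 /\ `|S / S0| <= 2 * (M + c) / d.
Proof.
move=> d0 dG GM dS g0 gM e0 ec h h0.
have d20 : 0 < d / 2 by rewrite divr_gt0.
have S0p : 0 < S0 := lt_le_trans d20 dS.
have G0p : 0 < G0 := lt_le_trans d0 dG.
have M0 : 0 < M := lt_le_trans g0 gM.
split.
  have -> : S / S0 - G / G0 = ((S - G) * G0 - G * (S0 - G0)) / (S0 * G0).
    by field; rewrite !gt_eqF.
  rewrite normrM normfV (gtr0_norm (mulr_gt0 S0p G0p)) ler_pdivrMr ?mulr_gt0//.
  apply: (@le_trans _ _ (2 * M * e)).
    apply: (le_trans (ler_normB _ _)); rewrite !normrM (gtr0_norm G0p) (gtr0_norm g0).
    rewrite -mulrA mulr_natl mulr2n; apply: lerD.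
      by rewrite mulrC; apply: ler_pM => //; exact: ltW.
    by apply: ler_pM => //; exact: ltW.
  have -> : 2 * M * e = 4 * M * e / d ^+ 2 * (d / 2 * d) by field; rewrite gt_eqF.
  apply: ler_wpM2l; last exact: (ler_pM (ltW d20) (ltW d0) dS dG).
  by apply: divr_ge0; [apply: mulr_ge0 => //; apply: mulr_ge0 => //; exact: ltW|exact: sqr_ge0].
rewrite normrM normfV (gtr0_norm S0p) ler_pdivrMr//.
apply: (@le_trans _ _ (M + c)).
  have -> : S = G + (S - G) by ring.
  by apply: (le_trans (ler_normD _ _)); rewrite (gtr0_norm g0); apply: lerD => //; exact: le_trans ec.
have {1}-> : M + c = 2 * (M + c) / d * (d / 2) by field; rewrite gt_eqF.
have c0 : 0 <= c := le_trans e0 ec.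
apply: ler_wpM2l => //; apply: divr_ge0; last exact: ltW.
by apply: mulr_ge0 => //; apply: addr_ge0 => //; exact: ltW.
Qed.

Lemma quotient_asymptotics (L : nat) (A : R) : (1 <= L)%N -> 0 < A ->
  exists C : R, exists N0 : nat, forall N : nat, (1 <= N)%N -> (N0 <= N)%N ->
    forall s t : R, - A <= s <= A -> t = 1 + s / N%:R ->
    `| (N%:R ^+ 2)^-1 *
         ((Kpoly L N)^`().[t] / (Kpoly L N).[t]
          + t * ((Kpoly L N)^`()^`().[t] / (Kpoly L N).[t]
                 - ((Kpoly L N)^`().[t] / (Kpoly L N).[t]) ^+ 2))
       - leading_term L s | <= C / N%:R.
Proof.
move=> L1 A0; have half_le (x : R) : 0 < x -> x / 2 <= x by move=> ?; lra.
pose D : R := 4 * (1 + L%:R).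
have D1 : 1 <= D by rewrite /D; have : 0 <= L%:R :> R by []; lra.
pose c : R := D ^+ (L + 2) * expR (D * A).
have c0 : 0 < c by rewrite mulr_gt0 ?expR_gt0// exprn_gt0//; lra.
(* The functions [gser k] increase, so [d] is the minimum of [g^(L-1)] over [[-A, A]], and the
   values at [A] collected in [M] bound the three functions from above. *)
pose d : R := gser L.-1 (- A).
have d0 : 0 < d by exact: gser_gt0.
pose M : R := gser L.-1 A + gser L.-1.+1 A + gser L.-1.+2 A.
have M0 : 0 < M by rewrite !addr_gt0 ?gser_gt0.
pose V := 2 * (M + c) / d.
have V0 : 0 < V by rewrite divr_gt0// mulr_gt0// addr_gt0.
pose e := 4 * M * c / d ^+ 2.
have e0 : 0 < e.
  by apply: divr_gt0; [apply: mulr_gt0 => //; apply: mulr_gt0|apply: exprn_gt0].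
(* [V] bounds the quotients and [e / N] their errors; the four summands match the four terms of the
   final decomposition. The threshold on [N] forces [c / N <= d / 2], which keeps the approximate
   denominator above [d / 2]. *)
exists (V + e + 2 * V * e + A * (V + V ^+ 2)), (Num.truncn (2 * c / d)).+1 => N N1 NN s t /andP[sA1 sA2] tE.
have NR : 0 < N%:R :> R by rewrite ltr0n.
have N1R : 1 <= N%:R :> R by rewrite ler1n.
have sA : `|s| <= A by rewrite ler_norml sA1.
have [K0 K1 K2] := @Kpoly_Bpoly L N s N1.
have Sb j : (j <= 2)%N -> `|(Bpoly L N)^`(j).[s] - gser (L.-1 + j) s| <= c / N%:R.
  move=> j2; apply: (le_trans (Bpoly_derivn_bound j L1 N1 A0 sA)).
  rewrite ler_pM2r ?invr_gt0// ler_pM2r ?expR_gt0// ler_weXn2l// leq_add2l//.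
have := Sb 0 isT; have := Sb 1%N isT; have := Sb 2 isT; rewrite {Sb} addn0 addn1 addn2.
move: K0 K1 K2; set S0 := (Bpoly L N)^`(0).[s]; set S1 := (Bpoly L N)^`(1).[s]; set S2 := (Bpoly L N)^`(2).[s].
move=> K0 K1 K2; set G0 := gser L.-1 s; set G1 := gser L.-1.+1 s; set G2 := gser L.-1.+2 s.
move=> h2 h1 h0.
have G0d : d <= G0 by exact: gser_le.
have G0p : 0 < G0 by exact: gser_gt0.
have G1p : 0 < G1 by exact: gser_gt0.
have G2p : 0 < G2 by exact: gser_gt0.
have GM : [/\ G0 <= M, G1 <= M & G2 <= M].
  have g0 : G0 <= gser L.-1 A by exact: gser_le.
  have g1 : G1 <= gser L.-1.+1 A by exact: gser_le.
  have g2 : G2 <= gser L.-1.+2 A by exact: gser_le.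
  by split; rewrite /M; lra.
have [G0M G1M G2M] := GM.
have cN : c / N%:R <= d / 2.
  have h : 2 * c / d <= N%:R.
    apply: ltW; apply: (lt_le_trans (truncnS_gt _)); by rewrite ler_nat.
  rewrite ler_pdivrMr//; move: h; rewrite ler_pdivrMr//; nra.
have cNc : c / N%:R <= c by rewrite ler_pdivrMr// ler_peMr// ltW.
have S0d : d / 2 <= S0 by move: h0; rewrite ler_norml => /andP[]; lra.
have S0p : 0 < S0 by apply: lt_le_trans S0d; rewrite divr_gt0.
have cN0 : 0 <= c / N%:R by rewrite divr_ge0// ltW.
have eN : 4 * M * (c / N%:R) / d ^+ 2 = e / N%:R by rewrite /e; field; rewrite !gt_eqF.
have Vd : V * (d / 2) = M + c by rewrite /V; field; rewrite gt_eqF.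
have [r1 v1] := quotient_perturbation d0 G0d G0M S0d G1p G1M cN0 cNc h1 h0.
have [r2 v2] := quotient_perturbation d0 G0d G0M S0d G2p G2M cN0 cNc h2 h0.
rewrite eN in r1 r2; rewrite -/V in v1 v2.
have gp1 : 0 < G1 / G0 by rewrite divr_gt0.
have gV : G1 / G0 <= V.
  rewrite ler_pdivrMr//; apply: (@le_trans _ _ (V * (d / 2))).
    by rewrite Vd; apply: (le_trans G1M); rewrite lerDl ltW.
  apply: ler_wpM2l; first exact: ltW.
  by apply: le_trans G0d; exact: half_le.
have cn0 : L.-1`!%:R / N%:R ^+ L != 0 :> R.
  by rewrite mulf_neq0 ?invr_eq0 ?expf_neq0 ?gt_eqF// ltr0n fact_gt0.
rewrite (leading_termE s L1) -/G0; have -> : gser L s = G1 by rewrite /G1 prednK.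
have -> : gser L.+1 s = G2 by rewrite /G2 prednK.
move: K0 K1 K2; rewrite -tE; move: (_ / _ ^+ L) cn0 => k kn0.
set k0 := (Kpoly L N).[t]; set k1 := (Kpoly L N)^`().[t]; set k2 := (Kpoly L N)^`()^`().[t].
move=> K0 K1 K2.
have Nn0 : N%:R != 0 :> R by rewrite gt_eqF.
have kk0 : k0 != 0 by move: S0p; rewrite K0; case: eqP => // ->; rewrite mulr0 ltxx.
have q1 : k1 / k0 = N%:R * (S1 / S0) by rewrite K1 K0; field; rewrite kn0 kk0 Nn0.
have q2 : k2 / k0 = N%:R ^+ 2 * (S2 / S0) by rewrite K2 K0; field; rewrite kn0 kk0 Nn0.
have g12 : (G2 * G0 - G1 ^+ 2) / G0 ^+ 2 = G2 / G0 - (G1 / G0) ^+ 2.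
  by field; rewrite gt_eqF.
rewrite q1 q2 g12.
move: v1 v2 r1 r2 gV gp1; move: (S1 / S0) (S2 / S0) (G1 / G0) (G2 / G0) => a b al be v1 v2 r1 r2 gV gp1.
(* By the chain rule [K'/K = N a] and [K''/K = N^2 b], so the factor [N^-2] is absorbed by
   [b - a^2]; the isolated [K'/K] and the excess [t - 1 = s / N] are of order [1 / N]. *)
have -> : N%:R ^- 2 * (N%:R * a + t * (N%:R ^+ 2 * b - (N%:R * a) ^+ 2)) - (be - al ^+ 2) =
   a / N%:R + (b - be) - (a - al) * (a + al) + s / N%:R * (b - a ^+ 2).
  by rewrite tE; field.
have b1 : `|a / N%:R| <= V / N%:R by rewrite normrM normfV (gtr0_norm NR) ler_pM2r ?invr_gt0.
have b2 : `|(a - al) * (a + al)| <= e / N%:R * (2 * V).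
  rewrite normrM; apply: ler_pM => //; apply: (le_trans (ler_normD _ _)).
  by rewrite (gtr0_norm gp1); lra.
have b3 : `|s / N%:R * (b - a ^+ 2)| <= A / N%:R * (V + V ^+ 2).
  rewrite normrM; apply: ler_pM => //.
    by rewrite normrM normfV (gtr0_norm NR) ler_pM2r ?invr_gt0.
  apply: (le_trans (ler_normB _ _)); apply: lerD => //; rewrite normrX lerXn2r// nnegrE ltW//.
have -> : (V + e + 2 * V * e + A * (V + V ^+ 2)) / N%:R =
  V / N%:R + e / N%:R + e / N%:R * (2 * V) + A / N%:R * (V + V ^+ 2) by field.
apply: (le_trans (ler_normD _ _)); apply: lerD => //.
apply: (le_trans (ler_normB _ _)); apply: lerD => //.
by apply: (le_trans (ler_normD _ _)); apply: lerD.
Qed.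
End asymptotics.

(** * The expected logarithm of a Gaussian polynomial *)

Section log_gauss.
Variable R : realType.
Local Notation mR := (measurableTypeR R).
Local Notation leb := (@lebesgue_measure R).
Local Notation gg := (@gauss1 R \x @gauss1 R)%E.

(** Domination holds only almost everywhere here; dominated convergence for a constant sequence
    delivers integrability under that weaker assumption. *)
Lemma ae_le_integrable d (T : measurableType d) (mu : {measure set T -> \bar R})
    (f g : T -> \bar R) : measurable_fun setT f -> mu.-integrable setT g ->
  {ae mu, forall x, (`|f x| <= g x)%E} -> mu.-integrable setT f.
Proof.
move=> mf ig fg.
have [] := @dominated_convergence _ _ _ mu setT measurableT (fun=> f) f g (fun=> mf) mf _ ig _ => //.
  by apply: nearW => x _; exact: cvg_cst.
by apply: filterS fg => x h _ _.
Qed.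

Lemma gauss1_set1 (x : R) : @gauss1 R [set x] = 0%E.
Proof.
first [exact: integral_set1 | by rewrite /gauss1 /= /normal_prob integral_set1
 | by apply: null_set_integral; [exact: measurable_set1|apply: measurable_funTS; exact: measurable_gauss_pdf|exact: lebesgue_measure_set1]].
Qed.

Lemma ae_gauss_neq0 : {ae gg, forall z : mR * mR, z.1 != 0 :> R}.
Proof.
exists ([set (0 : mR)] `*` [set: mR]); split.
- by apply: measurableX => //; exact: measurable_set1.
- have e := product_measure1E (@gauss1 R) (@gauss1 R) (measurable_set1 (0 : R)) measurableT.
  apply: (etrans e); apply: (etrans (congr1 (fun t => t * _)%E (gauss1_set1 0))); by rewrite mul0e.
- by move=> [x y] /= /negP; rewrite negbK => /eqP ->.
Qed.

(** With [u = x^2], [u e^(-u) <= 2 e^(-u/2)] bounds the integrand by a multiple of the density of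
    [N(0, 1)], whose integral is known. *)
Lemma gauss1_sqr_lty : (\int[@gauss1 R]_x ((x : R) ^+ 2)%:E < +oo)%E.
Proof.
have key (u : R) : 0 <= u -> u * expR (- u) <= 2 * expR (- u / 2).
  move=> u0; have -> : expR (- u) = expR (- u / 2) * expR (- u / 2).
    by rewrite -expRD; congr expR; field.
  rewrite mulrA.
  rewrite ler_wpM2r ?expR_ge0// mulNr expRN ler_pdivrMr ?expR_gt0//.
  by have := expR_ge1Dx (u / 2); lra.
have m1 : measurable_fun [set: mR] (fun x : mR => ((x : R) ^+ 2)%:E).
  by apply/measurable_EFinP; exact: (measurable_funX 2).
have h0 (x : mR) : (0 <= ((x : R) ^+ 2)%:E)%E by rewrite lee_fin sqr_ge0.
rewrite (ge0_integral_gauss1 m1 h0).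
pose c := normal_peak (Num.sqrt (2^-1 : R)) * 2 / normal_peak (1 : R).
have c0 : 0 <= c by rewrite divr_ge0 ?normal_peak_ge0// mulr_ge0 ?normal_peak_ge0.
have mp : measurable_fun [set: mR] (fun x : mR => (normal_pdf 0 1 (x : R))%:E).
  by apply/measurable_EFinP; exact: measurable_normal_pdf.
apply: (@le_lt_trans _ _ (\int[leb]_x (c%:E * (normal_pdf 0 1 (x : R))%:E))%E).
  apply: ge0_le_integral => //.
  - by move=> x _; rewrite -EFinM lee_fin mulr_ge0 ?sqr_ge0// gauss_pdf_ge0.
  - by apply: emeasurable_funM => //; exact: measurable_gauss_pdf.
  - exact: emeasurable_funM.
  - move=> x _; rewrite -!EFinM lee_fin gauss_pdfE.
    have -> : normal_pdf 0 1 (x : R) = normal_peak 1 * expR (- (x : R) ^+ 2 / 2).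
      by rewrite normal_pdfE ?oner_neq0// /normal_fun subr0 expr1n.
    have p1 : normal_peak (1 : R) != 0 by rewrite gt_eqF// normal_peak_gt0// oner_neq0.
    rewrite [leRHS](_ : _ = normal_peak (Num.sqrt (2^-1 : R)) * (2 * expR (- (x : R) ^+ 2 / 2))); last first.
      by rewrite /c; move: (expR _) (normal_peak (Num.sqrt _)) => E p; field.
    by rewrite mulrCA ler_wpM2l ?normal_peak_ge0// key// sqr_ge0.
rewrite ge0_integralZl//; last by move=> x _; rewrite lee_fin normal_pdf_ge0.
by rewrite integral_normal_pdf mule1 ltry.
Qed.

Lemma gauss1_integral_lty (u : mR -> R) : measurable_fun setT (fun x => (u x)%:E) ->
  (forall x, 0 <= u x) -> (\int[leb]_x (u x)%:E < +oo)%E -> (\int[@gauss1 R]_x (u x)%:E < +oo)%E.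
Proof.
move=> mu u0 iu.
have u0' x : (0 <= (u x)%:E)%E by rewrite lee_fin.
rewrite (ge0_integral_gauss1 mu u0').
pose c := normal_peak (Num.sqrt (2^-1 : R)).
have c0 : 0 <= c by exact: normal_peak_ge0.
have E : (\int[leb]_x (c%:E * (u x)%:E) = c%:E * \int[leb]_x (u x)%:E)%E.
  by apply: ge0_integralZl => //; first [by rewrite lee_fin | by move=> x _; exact: u0' | exact: mu].
apply: (@le_lt_trans _ _ (\int[leb]_x (c%:E * (u x)%:E))%E).
  apply: ge0_le_integral => //.
  - by move=> x _; rewrite -EFinM lee_fin mulr_ge0// gauss_pdf_ge0.
  - by apply: emeasurable_funM => //; exact: measurable_gauss_pdf.
  - exact: emeasurable_funM.
  - move=> x _; rewrite -!EFinM lee_fin gauss_pdfE [leLHS]mulrC; apply: ler_wpM2r => //.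
    rewrite /c -[leRHS]mulr1; apply: ler_wpM2l; first exact: normal_peak_ge0.
    by rewrite -expR0 ler_expR oppr_le0 sqr_ge0.
by rewrite E; apply: lte_mul_pinfty => //; rewrite lee_fin.
Qed.

Lemma measurable_ln_sqr_itv :
  measurable_fun [set: mR] (fun x : mR => (\1_(`[- 2, 2]%classic : set R) x * `|ln ((x : R) ^+ 2)|)%:E).
Proof.
apply/measurable_EFinP/measurable_funM; first by apply: measurable_indic; exact: measurable_itv.
apply: measurableT_comp => //; apply: (measurableT_comp (@measurable_ln R)).
exact: (measurable_funX 2).
Qed.

Lemma ln_sqr_itv_ge0 (x : mR) : 0 <= \1_(`[- 2, 2]%classic : set R) x * `|ln ((x : R) ^+ 2)|.
Proof. by apply: mulr_ge0; rewrite ?indicE ?ler0n. Qed.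

Lemma gauss1_ln_lty : (\int[@gauss1 R]_x (\1_(`[- 2, 2]%classic : set R) x * `|ln ((x : R) ^+ 2)|)%:E < +oo)%E.
Proof.
apply: (gauss1_integral_lty measurable_ln_sqr_itv ln_sqr_itv_ge0).
by have := @ln_sqr_integral_lty R 2 0; under eq_integral do rewrite subr0.
Qed.

Lemma integrable_gauss_fst (u : mR -> R) : measurable_fun setT (fun x => (u x)%:E) ->
  (forall x, 0 <= u x) -> (\int[@gauss1 R]_x (u x)%:E < +oo)%E ->
  gg.-integrable setT (fun z : mR * mR => (u z.1)%:E).
Proof.
move=> mu u0 iu.
have m2 : measurable_fun [set: mR * mR] (fun z : mR * mR => (u z.1)%:E).
  exact: (measurableT_comp mu measurable_fst).
apply: (integrable12ltyP _ _ m2).2.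
apply: le_lt_trans iu; rewrite le_eqVlt; apply/orP; left; apply/eqP.
apply: eq_integral => x _ /=.
by rewrite integral_cst//= probability_setT mule1 ger0_norm.
Qed.

Lemma integrable_gauss_snd (u : mR -> R) : measurable_fun setT (fun x => (u x)%:E) ->
  (forall x, 0 <= u x) -> (\int[@gauss1 R]_x (u x)%:E < +oo)%E ->
  gg.-integrable setT (fun z : mR * mR => (u z.2)%:E).
Proof.
move=> mu u0 iu.
have m2 : measurable_fun [set: mR * mR] (fun z : mR * mR => (u z.2)%:E).
  exact: (measurableT_comp mu measurable_snd).
apply: (integrable12ltyP _ _ m2).2.
apply: le_lt_trans iu; rewrite le_eqVlt; apply/orP; left; apply/eqP.
transitivity (\int[@gauss1 R]_x (\int[@gauss1 R]_y (u y)%:E))%E.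
  by apply: eq_integral => x _; apply: eq_integral => y _ /=; rewrite ger0_norm.
by rewrite integral_cst//= probability_setT mule1.
Qed.

(** For [q = x^2 + y^2 >= 1] one has [ln q <= q]. For [q < 1] the logarithm is negative and
    [x^2 <= q] gives [|ln q| <= |ln x^2|], with [x] well inside [[-2, 2]]. *)
Lemma norm_ln_sum_sqr_le (x y : R) : x != 0 ->
  `|ln (x ^+ 2 + y ^+ 2)| <= \1_(`[- 2, 2]%classic : set R) x * `|ln (x ^+ 2)| + x ^+ 2 + y ^+ 2.
Proof.
move=> x0; have x2 : 0 < x ^+ 2 by rewrite exprn_even_gt0.
have y2 := sqr_ge0 y.
have u0 := ln_sqr_itv_ge0 x.
rewrite -addrA; move qE : (x ^+ 2 + y ^+ 2) => q.
have xq : x ^+ 2 <= q by rewrite -qE lerDl.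
have q0 : 0 < q by exact: lt_le_trans xq.
have [q1|q1] := leP 1 q.
  rewrite ger0_norm ?ln_ge0//.
  have h : ln q <= q by have := expR_ge1Dx (ln q); rewrite lnK ?posrE//; lra.
  by apply: (le_trans h); rewrite lerDr.
have lq : ln q <= 0 by apply: ln_le0; exact: ltW.
have lx : ln (x ^+ 2) <= ln q by rewrite ler_ln ?posrE.
have key (t : R) : t * t < 1 -> - 2 <= t <= 2 by move=> h; apply/andP; split; nra.
have xI : - 2 <= x <= 2 by apply: key; rewrite -expr2; exact: le_lt_trans q1.
have xI' : x \in (`[- 2, 2]%classic : set R) by rewrite inE/= in_itv/=.
rewrite indicE xI' mul1r (ler0_norm lq) (ler0_norm (le_trans lx lq)).
by apply: ler_wpDr; [exact: ltW|rewrite lerN2].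
Qed.

Lemma measurable_ln_scale2 (k : R) : 0 <= k -> measurable_fun [set: mR * mR]
  (fun z : mR * mR => (ln ((Num.sqrt k * z.1) ^+ 2 + (Num.sqrt k * z.2) ^+ 2))%:E).
Proof.
move=> k0.
rewrite (_ : (fun z : mR * mR => _) = (fun z : mR * mR => (ln (k * sqdist 0 0 z))%:E)); last first.
  by apply/funext => z; rewrite /sqdist !subr0 !exprMn sqr_sqrtr// mulrDr.
apply/measurable_EFinP; apply: (measurableT_comp (@measurable_ln R)).
by apply: measurable_funM; [exact: measurable_cst|exact: measurable_sqdist].
Qed.

Lemma integrable_gauss_ln : gg.-integrable setT (fun z : mR * mR => (ln ((z.1 : R) ^+ 2 + (z.2 : R) ^+ 2))%:E).
Proof.
have ms : measurable_fun [set: mR] (fun x : mR => ((x : R) ^+ 2)%:E).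
  by apply/measurable_EFinP; exact: (measurable_funX 2).
have s0 (x : mR) : 0 <= (x : R) ^+ 2 by exact: sqr_ge0.
have i1 := integrable_gauss_fst measurable_ln_sqr_itv ln_sqr_itv_ge0 gauss1_ln_lty.
have i2 := integrable_gauss_fst ms s0 gauss1_sqr_lty.
have i3 := integrable_gauss_snd ms s0 gauss1_sqr_lty.
have i := integrableD measurableT (integrableD measurableT i1 i2) i3.
apply: (ae_le_integrable _ i).
  have := measurable_ln_scale2 (@ler01 R); rewrite sqrtr1.
  by under eq_fun do rewrite !mul1r.
apply: filterS ae_gauss_neq0 => z z0 /=.
by rewrite -?EFinD lee_fin; exact: norm_ln_sum_sqr_le.
Qed.

(** [E ln |a|^2] for a standard complex Gaussian [a]; by [integrable_gauss_ln] the integral is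
    finite, so [fine] loses nothing. *)
Definition gauss_log_const : R :=
  fine (\int[gg]_z (ln ((z.1 : R) ^+ 2 + (z.2 : R) ^+ 2))%:E)%E.
Definition gauss_log_abs : R :=
  fine (\int[gg]_z `|(ln ((z.1 : R) ^+ 2 + (z.2 : R) ^+ 2))%:E|)%E.

(** [ln (k q) = ln k + ln q] for [q > 0]. At the origin it may fail, as [ln 0 = 0] by convention, so
    the splitting is used almost everywhere. *)
Lemma gauss_log_scale (k : R) : 0 < k ->
  [/\ gg.-integrable setT (fun z : mR * mR => (ln ((Num.sqrt k * z.1) ^+ 2 + (Num.sqrt k * z.2) ^+ 2))%:E),
   (\int[gg]_z (ln ((Num.sqrt k * z.1) ^+ 2 + (Num.sqrt k * z.2) ^+ 2))%:E =
     (ln k + gauss_log_const)%:E)%E &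
   (\int[gg]_z `|(ln ((Num.sqrt k * z.1) ^+ 2 + (Num.sqrt k * z.2) ^+ 2))%:E| <=
     (`|ln k| + gauss_log_abs)%:E)%E].
Proof.
move=> k0.
have one0 (x : mR) : 0 <= (1 : R) by exact: ler01.
have T : gg setT = 1%E by exact: (@gauss2_setT R 1).
have i1 : gg.-integrable setT (fun z : mR * mR => (1 : R)%:E).
  apply: (@integrable_gauss_fst (fun=> 1)) => //.
  by rewrite integral_cst//= probability_setT mule1 ltry.
have e1 : (\int[gg]_z (1 : R)%:E = 1)%E.
  by apply: (etrans (integral_cst gg measurableT 1%E)); apply: (etrans (congr1 (fun t => 1 * t)%E T)); rewrite mule1.
have iq := integrable_gauss_ln.
have iqa := integrable_abse iq.
have ik := integrableZl measurableT (ln k) i1.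
have ika := integrableZl measurableT `|ln k| i1.
have iS := integrableD measurableT ik iq.
have mk := measurable_ln_scale2 (ltW k0).
have ae : {ae gg, forall z : mR * mR, (ln ((Num.sqrt k * z.1) ^+ 2 + (Num.sqrt k * z.2) ^+ 2))%:E =
    ((ln k)%:E * (1 : R)%:E + (ln ((z.1 : R) ^+ 2 + (z.2 : R) ^+ 2))%:E)%E}.
  apply: filterS ae_gauss_neq0 => z z0.
  have q0 : 0 < (z.1 : R) ^+ 2 + (z.2 : R) ^+ 2 by rewrite ltr_wpDr ?sqr_ge0// exprn_even_gt0.
  rewrite -EFinM -EFinD mulr1 !exprMn sqr_sqrtr ?(ltW k0)// -mulrDr.
  by congr EFin; rewrite lnM ?posrE.
split.
- apply: (ae_le_integrable mk (integrable_abse iS)).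
  by apply: filterS ae => z -> /=; exact: lexx.
- transitivity (\int[gg]_z ((ln k)%:E * (1 : R)%:E + (ln ((z.1 : R) ^+ 2 + (z.2 : R) ^+ 2))%:E))%E.
    apply: ae_eq_integral => //; first exact: (measurable_int _ iS).
    by apply: filterS ae => z h _; exact: h.
  apply: (etrans (integralD measurableT ik iq)).
  rewrite (integralZl measurableT i1) e1 mule1 EFinD; congr (_ + _)%E.
  by rewrite /gauss_log_const fineK//; exact: (integrable_fin_num measurableT iq).
- apply: (@le_trans _ _ (\int[gg]_z (`|ln k|%:E * (1 : R)%:E + `|(ln ((z.1 : R) ^+ 2 + (z.2 : R) ^+ 2))%:E|))%E).
    apply: ae_ge0_le_integral => //; first [
      exact: measurableT_comp mk | exact: (measurable_int _ (integrableD measurableT ika iqa))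
    | by move=> z _; rewrite adde_ge0// mule_ge0// lee_fin
    | by apply: filterS ae => z -> _; rewrite -!EFinM !mulr1 -EFinD lee_fin; exact: ler_normD
    | by apply: filterS ae => z -> _; rewrite !mule1; exact: lee_abs_add ].
  rewrite le_eqVlt; apply/orP; left; apply/eqP.
  apply: (etrans (integralD measurableT ika iqa)).
  rewrite (integralZl measurableT i1) e1 mule1 EFinD; congr (_ + _)%E.
  by rewrite /gauss_log_abs fineK//; exact: (integrable_fin_num measurableT iqa).
Qed.
End log_gauss.

(** * Squared modulus and measurability of complex-valued maps *)

Section complex_aux.
Variable R : realType.

Lemma ReD (x y : R[i]) : complex.Re (x + y) = complex.Re x + complex.Re y.
Proof. by case: x => a b; case: y. Qed.
Lemma ImD (x y : R[i]) : complex.Im (x + y) = complex.Im x + complex.Im y.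
Proof. by case: x => a b; case: y. Qed.
Lemma ReM (x y : R[i]) : complex.Re (x * y) =
  complex.Re x * complex.Re y - complex.Im x * complex.Im y.
Proof. by case: x => a b; case: y. Qed.
Lemma ImM (x y : R[i]) : complex.Im (x * y) =
  complex.Re x * complex.Im y + complex.Im x * complex.Re y.
Proof. by case: x => a b; case: y. Qed.

Lemma sqnormcM (x y : R[i]) : sqnormc (x * y) = sqnormc x * sqnormc y.
Proof. by rewrite /sqnormc ReM ImM; ring. Qed.

Lemma sqnormcX (x : R[i]) n : sqnormc (x ^+ n) = sqnormc x ^+ n.
Proof.
elim: n => [|n IH]; last by rewrite !exprS sqnormcM IH.
by rewrite !expr0 /sqnormc /= expr1n expr0n addr0.
Qed.

Lemma sqnormc_ge0 (x : R[i]) : 0 <= sqnormc x.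
Proof. by rewrite addr_ge0 ?sqr_ge0. Qed.

Lemma sqnormc_eq0 (x : R[i]) : (sqnormc x == 0) = (x == 0).
Proof.
rewrite /sqnormc paddr_eq0 ?sqr_ge0// !sqrf_eq0; case: x => a b /=.
by rewrite eq_complex.
Qed.

Lemma sqnormc_sub (x y : R) (r : R[i]) :
  sqnormc (Cpt x y - r) = sqdist (complex.Re r) (complex.Im r) (x, y).
Proof. by case: r. Qed.

Section cmeas.
Context d (T : measurableType d).
Definition cmeas (h : T -> R[i]) :=
  measurable_fun setT (fun t => complex.Re (h t)) /\ measurable_fun setT (fun t => complex.Im (h t)).

Lemma cmeasD h k : cmeas h -> cmeas k -> cmeas (fun t => h t + k t).
Proof.
move=> [h1 h2] [k1 k2]; split.
  by under eq_fun do rewrite ReD; exact: measurable_funD.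
by under eq_fun do rewrite ImD; exact: measurable_funD.
Qed.

Lemma cmeasM h k : cmeas h -> cmeas k -> cmeas (fun t => h t * k t).
Proof.
move=> [h1 h2] [k1 k2]; split.
  by under eq_fun do rewrite ReM; apply: measurable_funB; exact: measurable_funM.
by under eq_fun do rewrite ImM; apply: measurable_funD; exact: measurable_funM.
Qed.

Lemma cmeas_cst c : cmeas (fun=> c).
Proof. by split; exact: measurable_cst. Qed.

Lemma cmeasX h n : cmeas h -> cmeas (fun t => h t ^+ n).
Proof.
move=> mh; elim: n => [|n IH]; first by under eq_fun do rewrite expr0; exact: cmeas_cst.
by under eq_fun do rewrite exprS; exact: cmeasM.
Qed.

Lemma cmeas_sum n (F : nat -> T -> R[i]) : (forall i, cmeas (F i)) ->
  cmeas (fun t => \sum_(i < n) F i t).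
Proof.
move=> mF; elim: n => [|n IH]; first by under eq_fun do rewrite big_ord0; exact: cmeas_cst.
by under eq_fun do rewrite big_ord_recr; exact: cmeasD.
Qed.

Lemma measurable_sqnormc h : cmeas h -> measurable_fun setT (fun t => sqnormc (h t)).
Proof. by move=> [h1 h2]; apply: measurable_funD; exact: measurable_funX. Qed.
End cmeas.
End complex_aux.

Section plane_sfinite.
Variable R : realType.
Local Notation mR := (measurableTypeR R).
Local Notation leb := (@lebesgue_measure R).

(** A named copy of planar Lebesgue measure that carries a sigma-finite structure, for use as the
    second factor of the product with [P] in Fubini's theorem. *)
Definition plane : set (mR * mR) -> \bar R := (leb \x leb)%E.

HB.instance Definition _ := Measure.copy plane (leb \x leb)%E.

Lemma plane_sigma_finite : sigma_finite setT plane.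
Proof.
have /sigma_finiteP[F [TF ndF Foo]] := sigma_finiteT leb.
exists (fun n => F n `*` F n).
  rewrite -setXTT TF predeqE => -[x y]; split.
    move=> [/= [n _ Fnx] [k _ Fky]]; exists (maxn n k) => //; split.
    - by move: x Fnx; exact/subsetPset/ndF/leq_maxl.
    - by move: y Fky; exact/subsetPset/ndF/leq_maxr.
  by move=> [n _ []/= ? ?]; split; exists n.
move=> k; have [mF Foo'] := Foo k; split; first exact: measurableX.
have e := product_measure1E leb leb mF mF; rewrite [ltLHS]e.
by apply: lte_mul_pinfty => //; rewrite ge0_fin_numE.
Qed.

HB.instance Definition _ := Measure_isSigmaFinite.Build _ _ _ plane plane_sigma_finite.
End plane_sfinite.

Lemma ge0_integral_same_law d1 d2 d3 (T1 : measurableType d1) (T2 : measurableType d2)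
    (T3 : measurableType d3) (R : realType) (P : {measure set T1 -> \bar R})
    (Q : {measure set T2 -> \bar R}) (S : T1 -> T3) (S' : T2 -> T3) (f : T3 -> \bar R) :
  measurable_fun setT S -> measurable_fun setT S' -> measurable_fun setT f ->
  (forall A, measurable A -> P (S @^-1` A) = Q (S' @^-1` A)) ->
  (forall x, 0 <= f x)%E -> (\int[P]_x f (S x) = \int[Q]_x f (S' x))%E.
Proof.
move=> mS mS' mf PQ f0.
have e1 := ge0_integral_pushforward mS P measurableT mf (fun x _ => f0 x).
have e2 := ge0_integral_pushforward mS' Q measurableT mf (fun x _ => f0 x).
rewrite preimage_setT in e1; rewrite preimage_setT in e2.
apply: (etrans (esym e1)); apply: (etrans _ e2).
by apply: eq_measure_integral => A mA _; exact: PQ.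
Qed.

Lemma integral_same_law d1 d2 d3 (T1 : measurableType d1) (T2 : measurableType d2)
    (T3 : measurableType d3) (R : realType) (P : {measure set T1 -> \bar R})
    (Q : {measure set T2 -> \bar R}) (S : T1 -> T3) (S' : T2 -> T3) (f : T3 -> \bar R) :
  measurable_fun setT S -> measurable_fun setT S' -> measurable_fun setT f ->
  (forall A, measurable A -> P (S @^-1` A) = Q (S' @^-1` A)) ->
  (\int[P]_x f (S x) = \int[Q]_x f (S' x))%E.
Proof.
move=> mS mS' mf PQ; rewrite integralE [RHS]integralE; congr (_ - _)%E.
  rewrite (eq_integral (fun x => (f^\+ (S x))%E)); last by move=> x _; rewrite !funeposE.
  rewrite [RHS](eq_integral (fun x => (f^\+ (S' x))%E)); last by move=> x _; rewrite !funeposE.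
  by apply: ge0_integral_same_law => //; exact: measurable_funepos.
rewrite (eq_integral (fun x => (f^\- (S x))%E)); last by move=> x _; rewrite !funenegE.
rewrite [RHS](eq_integral (fun x => (f^\- (S' x))%E)); last by move=> x _; rewrite !funenegE.
by apply: ge0_integral_same_law => //; exact: measurable_funeneg.
Qed.

(** * The logarithmic formula for the zeros of a fixed polynomial *)

Section zero_density.
Variable R : realType.
Local Notation mR := (measurableTypeR R).
Local Notation leb := (@lebesgue_measure R).
Local Notation leb2 := (@lebesgue_measure R \x @lebesgue_measure R)%E.

Lemma Kpoly_gt0 L N (t : R) : 0 <= t -> 0 < (Kpoly R L N).[t].
Proof.
move=> t0; rewrite /Kpoly horner_poly big_ord_recl /= expr0 mulr1 bin0 ltr_pwDl//.
by apply: sumr_ge0 => i _; rewrite mulr_ge0// exprn_ge0.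
Qed.

(** This is [(4 pi)^-1] times the Laplacian of [ln K (|z|^2)], that is [pi^-1 (t K'/K)'] expanded by
    the quotient rule. *)
Definition pstar L N (z : R * R) : R :=
  let K := Kpoly R L N in let t := sqdist 0 0 z in
  pi^-1 * (K^`().[t] / K.[t] + t * (K^`()^`().[t] / K.[t] - (K^`().[t] / K.[t]) ^+ 2)).

Definition cvec L (z : R * R) (m : nat) : R[i] := (su11_coef R L m)%:C%C * Cpt z.1 z.2 ^+ m.

Lemma horner_su11 L N (a : nat -> R[i]) (z : R * R) :
  (su11_poly L N a).[Cpt z.1 z.2] = \sum_(m < N.+1) cvec L z m * a m.
Proof. by rewrite /su11_poly horner_poly; apply: eq_bigr => m _; rewrite /cvec mulrAC. Qed.

Lemma sqnormc_cvec L N z : \sum_(m < N.+1) sqnormc (cvec L z m) = (Kpoly R L N).[sqdist 0 0 z].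
Proof.
rewrite /Kpoly horner_poly; apply: eq_bigr => m _; rewrite /cvec sqnormcM sqnormcX.
congr (_ * _ ^+ _); last by rewrite /sqnormc /sqdist/= !subr0.
by rewrite /sqnormc /su11_coef /= expr0n addr0 sqr_sqrtr.
Qed.

Lemma cmeas_cvec L m : cmeas (fun z : mR * mR => cvec L z m).
Proof.
apply: cmeasM; first exact: cmeas_cst.
apply: cmeasX; split => /=; [exact: measurable_fst|exact: measurable_snd].
Qed.

Variables (A : R) (f f1 f2 g g1 g2 : R -> R).
Hypotheses (A0 : 0 < A) (bf : bump2 A f f1 f2) (bg : bump2 A g g1 g2).
Local Notation W := (lap f f2 g g2).
Local Notation phi := (fun z : R[i] => f (complex.Re z) * g (complex.Im z)).

Lemma integrable_lap : leb2.-integrable setT (fun z : mR * mR => (W z)%:E).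
Proof.
exact: (continuous_support_integrable2 (continuous_lap bf bg) (lap_support bf bg)).
Qed.

Lemma integral_lap : (\int[leb2]_z (W z)%:E = 0)%E.
Proof.
have [df df1 cf2 fA _] := bf; have [dg dg1 cg2 gA _] := bg.
have c0 (c : R) t : 0 <= t -> is_derive (t : R) (1 : R) (fun=> c) 0 by move=> _; exact: is_derive_cst.
have cc t : 0 <= t -> {for t, continuous (fun _ : R => (0 : R))} by move=> _; exact: cvg_cst.
have e := ibp_radial 0 0 A0 df df1 dg dg1 cf2 cg2 fA gA (c0 1) (c0 0) cc.
transitivity (\int[leb2]_z (1 * W z)%:E)%E; first by apply: eq_integral => z _; rewrite mul1r.
apply: (etrans e); rewrite (eq_integral (cst 0%E)) ?integral0//.
by move=> z _; rewrite mulr0 addr0 mulr0 mul0r.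
Qed.

Lemma log_fundamental_sum (rs : seq R[i]) :
  leb2.-integrable setT (fun z : mR * mR => ((\sum_(r <- rs) ln (sqdist (complex.Re r) (complex.Im r) z)) * W z)%:E) /\
  (\int[leb2]_z ((\sum_(r <- rs) ln (sqdist (complex.Re r) (complex.Im r) z)) * W z)%:E =
    (4 * pi * \sum_(r <- rs) phi r)%:E)%E.
Proof.
elim: rs => [|r rs [IH1 IH2]].
  rewrite big_nil mulr0; split.
    apply: (eq_integrable measurableT (cst 0%E)); last exact: integrable0.
    by move=> z _; rewrite big_nil mul0r.
  by rewrite (eq_integral (cst 0%E)) ?integral0// => z _; rewrite big_nil mul0r.
have [i1 e1] := log_fundamental A0 bf bg (complex.Re r) (complex.Im r).
have E (z : mR * mR) : ((\sum_(r <- r :: rs) ln (sqdist (complex.Re r) (complex.Im r) z)) * W z)%:E =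
  ((ln (sqdist (complex.Re r) (complex.Im r) z) * W z)%:E +
   ((\sum_(r <- rs) ln (sqdist (complex.Re r) (complex.Im r) z)) * W z)%:E)%E.
  by rewrite big_cons mulrDl EFinD.
split.
  pose h1 (z : mR * mR) : \bar R := (ln (sqdist (complex.Re r) (complex.Im r) z) * W z)%:E.
  pose h2 (z : mR * mR) : \bar R :=
    ((\sum_(r <- rs) ln (sqdist (complex.Re r) (complex.Im r) z)) * W z)%:E.
  apply: (eq_integrable measurableT (h1 \+ h2)%E); last exact: (integrableD measurableT i1 IH1).
  by move=> z _; exact: esym (E z).
rewrite (eq_integral _ _ (fun z _ => E z)) integralD// e1 IH2 big_cons -EFinD.
congr EFin; first [by rewrite [RHS]mulrDr | by apply/esym; exact: mulrDr | ring].
Qed.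

Lemma ae_neq_fst_seq (rs : seq R[i]) :
  {ae leb2, forall z : mR * mR, forall r, r \in rs -> z.1 != complex.Re r :> R}.
Proof.
elim: rs => [|r rs IH]; first exact: nearW.
apply: filterS2 (ae_neq_fst (complex.Re r)) IH => z h1 h2 s.
by rewrite in_cons => /predU1P[->//|]; exact: h2.
Qed.

(** Factor [p]: [ln |p|^2] is the sum of [ln |lead_coef p|^2], which disappears by [integral_lap],
    and of one fundamental solution per root. The splitting holds off the vertical lines through the
    roots, where every factor is nonzero. *)
Lemma zero_sum_log (p : {poly R[i]}) : p != 0 ->
  (\int[leb2]_z (ln (sqnormc p.[Cpt z.1 z.2]) * W z)%:E = (4 * pi * zero_sum phi p)%:E)%E.
Proof.
move=> p0; rewrite /zero_sum; case: closed_field_poly_normal => rs /= pE.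
have lc0 : 0 < sqnormc (lead_coef p) by rewrite lt_neqAle sqnormc_ge0 andbT eq_sym sqnormc_eq0 lead_coef_eq0.
have [i1 e1] := log_fundamental_sum rs.
have ic : leb2.-integrable setT (fun z : mR * mR => ((ln (sqnormc (lead_coef p)))%:E * (W z)%:E)%E).
  exact: (integrableZl measurableT _ integrable_lap).
pose F (z : mR * mR) := ((ln (sqnormc (lead_coef p)))%:E * (W z)%:E +
   ((\sum_(r <- rs) ln (sqdist (complex.Re r) (complex.Im r) z)) * W z)%:E)%E.
have iF : leb2.-integrable setT F by exact: integrableD.
have mW : measurable_fun [set: mR * mR] (fun z : mR * mR => W z).
  exact: (continuous_measurable2 (continuous_lap bf bg)).
have mL : measurable_fun [set: mR * mR] (fun z : mR * mR => (ln (sqnormc p.[Cpt z.1 z.2]) * W z)%:E).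
  apply/measurable_EFinP; apply: measurable_funM => //.
  apply: (measurableT_comp (@measurable_ln R)); apply: measurable_sqnormc.
  under eq_fun do rewrite horner_coef.
  apply: (@cmeas_sum R _ (mR * mR)%type (size p) (fun i z => p`_i * Cpt z.1 z.2 ^+ i)) => i.
  apply: cmeasM; first exact: cmeas_cst.
  by apply: cmeasX; split => /=; [exact: measurable_fst|exact: measurable_snd].
have lnprod (x y : R) (s : seq R[i]) : (forall r, r \in s -> x != complex.Re r) ->
    0 < sqnormc (\prod_(r <- s) ('X - r%:P)).[Cpt x y] /\
    ln (sqnormc (\prod_(r <- s) ('X - r%:P)).[Cpt x y]) = \sum_(r <- s) ln (sqdist (complex.Re r) (complex.Im r) (x, y)).
  elim: s => [|r s IH] h.
    by rewrite !big_nil hornerC /sqnormc /= expr1n expr0n addr0 ln1.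
  have [h1 h2] : 0 < sqnormc (\prod_(r <- s) ('X - r%:P)).[Cpt x y] /\
      ln (sqnormc (\prod_(r <- s) ('X - r%:P)).[Cpt x y]) = \sum_(r <- s) ln (sqdist (complex.Re r) (complex.Im r) (x, y)).
    by apply: IH => r' r's; apply: h; rewrite in_cons r's orbT.
  have q0 : 0 < sqdist (complex.Re r) (complex.Im r) (x, y).
    by rewrite /sqdist/= ltr_wpDr ?sqr_ge0// exprn_even_gt0//= subr_eq0 h// mem_head.
  rewrite !big_cons hornerM hornerXsubC sqnormcM sqnormc_sub; split; first exact: mulr_gt0.
  by rewrite lnM ?posrE// h2.
have ae : ae_eq leb2 setT (fun z : mR * mR => (ln (sqnormc p.[Cpt z.1 z.2]) * W z)%:E) F.
  apply: filterS (ae_neq_fst_seq rs) => -[x y] h _; rewrite /F /=.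
  have [h1 h2] := lnprod x y rs h.
  by rewrite {1}pE hornerZ sqnormcM lnM ?posrE// h2 mulrDl EFinD EFinM.
transitivity (\int[leb2]_z F z)%E.
  by apply: ae_eq_integral => //; exact: (measurable_int _ iF).
rewrite /F integralD// e1.
by rewrite integralZl ?integral_lap ?mule0 ?add0e//; exact: integrable_lap.
Qed.
End zero_density.

(** * The density of zeros *)

Section expectation.
Variable R : realType.
Local Notation mR := (measurableTypeR R).
Local Notation leb := (@lebesgue_measure R).
Local Notation leb2 := (@lebesgue_measure R \x @lebesgue_measure R)%E.

Lemma plane_integral (h : mR * mR -> \bar R) : (\int[@plane R]_z h z = \int[leb2]_z h z)%E.
Proof. by apply: eq_measure_integral. Qed.

Lemma cmeas_comp d1 d2 (T1 : measurableType d1) (T2 : measurableType d2) (h : T2 -> R[i]) (u : T1 -> T2) :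
  cmeas h -> measurable_fun setT u -> cmeas (fun t => h (u t)).
Proof. by move=> [h1 h2] mu; split; [exact: (measurableT_comp h1 mu)|exact: (measurableT_comp h2 mu)]. Qed.

Lemma continuous_pstar L N : continuous (pstar (R := R) L N).
Proof.
have Kp t : 0 <= t -> 0 < (Kpoly R L N).[t] by exact: Kpoly_gt0.
have [_ d2 c3] := derive_log_poly Kp.
move=> z; apply: cvgM; first exact: cvg_cst.
have cs := @continuous_sqdist R 0 0 z.
have s0 := sqdist_ge0 0 0 z.
apply: cvgD.
  apply: (@continuous_comp _ _ _ (sqdist 0 0) (fun t => (Kpoly R L N)^`().[t] / (Kpoly R L N).[t])) => //.
  by apply: differentiable_continuous; apply/derivable1_diffP; have := d2 _ s0; case.
apply: cvgM => //.
exact: (@continuous_comp _ _ _ (sqdist 0 0) (fun t => (Kpoly R L N)^`()^`().[t] / (Kpoly R L N).[t] - ((Kpoly R L N)^`().[t] / (Kpoly R L N).[t]) ^+ 2) z cs (c3 _ s0)).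
Qed.

Lemma continuous_lnK L N : continuous (fun z : R * R => ln (Kpoly R L N).[sqdist 0 0 z]).
Proof.
have Kp t : 0 <= t -> 0 < (Kpoly R L N).[t] by exact: Kpoly_gt0.
have [d1 _ _] := derive_log_poly Kp.
move=> z; apply: (@continuous_comp _ _ _ (sqdist 0 0) (fun t => ln (Kpoly R L N).[t])); first exact: continuous_sqdist.
by apply: differentiable_continuous; apply/derivable1_diffP; have := d1 _ (sqdist_ge0 0 0 z); case.
Qed.

Context d (Omega : measurableType d) (P : probability Omega R) (a : nat -> Omega -> R[i]).
Hypothesis ga : iid_std_complex_gaussian P a.
Variables (L N : nat).
Local Notation psi w := (su11_poly L N (fun m => a m w)).
Local Notation Kz z := (Kpoly R L N).[sqdist 0 0 z].

(** For fixed [z] the value [psi z] has the law of [sqrt K] times a standard complex Gaussian, so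
    the expectations are those of [gauss_log_scale]. *)
Lemma expectation_log (z : R * R) :
  [/\ measurable_fun setT (fun w => (ln (sqnormc (psi w).[Cpt z.1 z.2]))%:E),
   (\int[P]_w (ln (sqnormc (psi w).[Cpt z.1 z.2]))%:E = (ln (Kz z) + gauss_log_const R)%:E)%E &
   (\int[P]_w `|(ln (sqnormc (psi w).[Cpt z.1 z.2]))%:E| <= (`|ln (Kz z)| + gauss_log_abs R)%:E)%E].
Proof.
pose S w : mR * mR := let y := \sum_(m < N.+1) cvec L z m * a m w in (complex.Re y, complex.Im y).
have mS : measurable_fun setT S := (law_gaussian_sum ga (cvec L z) N.+1).1.
have k0 : 0 < Kz z by rewrite Kpoly_gt0// sqdist_ge0.
pose f (u : mR * mR) : \bar R := (ln ((u.1 : R) ^+ 2 + (u.2 : R) ^+ 2))%:E.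
have mf : measurable_fun setT f := measurable_int _ (integrable_gauss_ln R).
have mS' := measurable_scale2 (Num.sqrt (Kz z)).
have law A : measurable A -> P (S @^-1` A) =
    (@gauss1 R \x @gauss1 R)%E ((fun u : mR * mR => (Num.sqrt (Kz z) * u.1, Num.sqrt (Kz z) * u.2) : mR * mR) @^-1` A).
  by move=> mA; have e := law_gaussian_linear_form ga (cvec L z) N.+1 mA; rewrite sqnormc_cvec in e; exact: e.
have fS w : f (S w) = (ln (sqnormc (psi w).[Cpt z.1 z.2]))%:E by rewrite /f /S /= horner_su11.
have [_ e1 e2] := gauss_log_scale k0.
split.
- by rewrite -(funext fS : _ = (fun w => _)); exact: (measurableT_comp mf mS).
- rewrite -e1 -(eq_integral _ _ (fun w _ => fS w)).
  exact: (integral_same_law mS mS' mf law).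
- apply: le_trans e2; rewrite le_eqVlt; apply/orP; left; apply/eqP.
  have maf : measurable_fun setT (fun u => `|f u|)%E by exact: measurableT_comp.
  transitivity (\int[P]_w `|f (S w)|)%E; first by apply: eq_integral => w _; rewrite fS.
  exact: (ge0_integral_same_law mS mS' maf law (fun u => abse_ge0 _)).
Qed.

Variables (A : R) (f f1 f2 g g1 g2 : R -> R).
Hypotheses (A0 : 0 < A) (bf : bump2 A f f1 f2) (bg : bump2 A g g1 g2).
Local Notation W := (lap f f2 g g2).
Local Notation phi := (fun z : R[i] => f (complex.Re z) * g (complex.Im z)).

Definition log_kernel (q : Omega * (mR * mR)) : \bar R :=
  (ln (sqnormc (psi q.1).[Cpt q.2.1 q.2.2]) * W q.2)%:E.

Lemma cmeas_a m : cmeas (a m).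
Proof. by have [ma _] := ga; split; [exact: (ma (m, true))|exact: (ma (m, false))]. Qed.

Lemma measurable_log_kernel : measurable_fun setT log_kernel.
Proof.
apply/measurable_EFinP; apply: measurable_funM; last first.
  exact: (measurableT_comp (continuous_measurable2 (continuous_lap bf bg)) measurable_snd).
apply: (measurableT_comp (@measurable_ln R)); apply: measurable_sqnormc.
under eq_fun do rewrite (horner_su11 L N _ _).
apply: (@cmeas_sum R _ (Omega * (mR * mR))%type N.+1 (fun m q => cvec L q.2 m * a m q.1)) => m.
apply: (@cmeasM R _ _ (fun q : Omega * (mR * mR) => cvec L q.2 m) (fun q => a m q.1)).
  exact: (cmeas_comp (cmeas_cvec R L m) measurable_snd).
exact: (cmeas_comp (cmeas_a m) measurable_fst).
Qed.

(** Integrating over [Omega] first is what makes this easy: by [expectation_log] the inner integral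
    is at most [|ln K| + gauss_log_abs] times [|W z|], a continuous function of [z] with bounded
    support. *)
Lemma integrable_log_kernel : (P \x @plane R)%E.-integrable setT log_kernel.
Proof.
have mPsi := measurable_log_kernel.
apply: (integrable21ltyP _ _ mPsi).2.
pose b (z : R * R) : R := (`|ln (Kz z)| + gauss_log_abs R) * `|W z|.
have c1 : 0 <= gauss_log_abs R by apply: fine_ge0; apply: integral_ge0.
have cb : continuous b.
  move=> z; apply: cvgM.
    apply: cvgD; last exact: cvg_cst.
    by apply: cvg_norm; exact: continuous_lnK.
  by apply: cvg_norm; exact: (continuous_lap bf bg).
have ib : leb2.-integrable setT (EFin \o b).
  apply: (continuous_support_integrable2 (A := A)) => // z bz; apply: (lap_support bf bg).
  by apply: contraNneq bz => Wz; rewrite /b Wz normr0 mulr0.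
have b0 z : 0 <= b z by rewrite mulr_ge0// addr_ge0.
have mb : measurable_fun [set: mR * mR] (fun z : mR * mR => (b z)%:E) := measurable_int _ ib.
have fin : (\int[@plane R]_z (b z)%:E < +oo)%E.
  rewrite plane_integral; have /integrableP[_ ib'] := ib.
  apply: le_lt_trans ib'; rewrite le_eqVlt; apply/orP; left; apply/eqP.
  by apply: eq_integral => z _ /=; rewrite ger0_norm.
apply: le_lt_trans fin; apply: ge0_le_integral => //.
- by move=> z _; apply: integral_ge0.
- apply: (measurable_fun_fubini_tonelli_G (fun q => `|log_kernel q|)%E) => //.
  exact: measurableT_comp.
- move=> z _; have [m1 _ e2] := expectation_log z.
  have -> : (\int[P]_w `|log_kernel (w, z)| = (\int[P]_w `|(ln (sqnormc (psi w).[Cpt z.1 z.2]))%:E|) * `|W z|%:E)%E.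
    rewrite -ge0_integralZr//; first by apply: eq_integral => w _; rewrite /log_kernel EFinM abseM.
    exact: measurableT_comp.
  by rewrite /b EFinM; apply: lee_wpmul2r.
Qed.

Lemma integral_pstar : (\int[leb2]_z (ln (Kz z) * W z)%:E =
  \int[leb2]_z (4 * pi * (pstar L N z * (f z.1 * g z.2)))%:E)%E.
Proof.
have [df df1 cf2 fA _] := bf; have [dg dg1 cg2 gA _] := bg.
have Kp t : 0 <= t -> 0 < (Kpoly R L N).[t] by exact: Kpoly_gt0.
have [k1 k2 k3] := derive_log_poly Kp.
apply: (etrans (ibp_radial 0 0 A0 df df1 dg dg1 cf2 cg2 fA gA k1 k2 k3)).
apply: eq_integral => z _; congr EFin; rewrite /pstar.
move: (_ + _ * _) (f z.1 * g z.2) => u v.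
have p0 : pi != 0 :> R by rewrite gt_eqF// pi_gt0.
by rewrite -!mulrA; congr (_ * _); rewrite mulVKf.
Qed.

Lemma integrable_pstar : leb2.-integrable setT (fun z : mR * mR => (pstar L N z * (f z.1 * g z.2))%:E).
Proof.
have [_ _ _ fA _] := bf; have [_ _ _ gA _] := bg.
apply: (@continuous_support_integrable2 R (fun z => pstar L N z * (f z.1 * g z.2)) A).
  move=> z; apply: cvgM; first exact: continuous_pstar.
  by apply: continuous_tensor; [exact: continuous_bump2 bf|exact: continuous_bump2 bg].
move=> z nz; split; apply: contraNT nz; rewrite -ltNge => /ltW zA.
  by have [-> _ _] := fA _ zA; rewrite mul0r mulr0.
by have [-> _ _] := gA _ zA; rewrite !mulr0.
Qed.

Lemma expectation_log_kernel :
  (\int[P]_w \int[@plane R]_z log_kernel (w, z) =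
   \int[leb2]_z (4 * pi * (pstar L N z * (f z.1 * g z.2)))%:E)%E.
Proof.
have F := Fubini integrable_log_kernel.
apply: (etrans F); rewrite plane_integral -integral_pstar.
have ilap := integrable_lap bf bg.
have ilnK : leb2.-integrable setT (fun z : mR * mR => (ln (Kz z) * W z)%:E).
  apply: (@continuous_support_integrable2 R (fun z => ln (Kz z) * W z) A).
    by move=> z; apply: cvgM; [exact: continuous_lnK|exact: (continuous_lap bf bg)].
  by move=> z nz; apply: (lap_support bf bg); apply: contraNneq nz => ->; rewrite mulr0.
transitivity (\int[leb2]_z ((ln (Kz z) * W z)%:E + (gauss_log_const R)%:E * (W z)%:E))%E.
  apply: eq_integral => z _; have [m1 e1 e2] := expectation_log z.
  have i1 : P.-integrable setT (fun w => (ln (sqnormc (psi w).[Cpt z.1 z.2]))%:E).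
    by apply/integrableP; split => //; apply: le_lt_trans e2 _; rewrite ltry.
  rewrite (eq_integral (fun w => ((ln (sqnormc (psi w).[Cpt z.1 z.2]))%:E * (W z)%:E)%E)); last first.
    by move=> w _; rewrite /log_kernel EFinM.
  by rewrite integralZr// e1 -!EFinM -EFinD mulrDl.
rewrite integralD//; last exact: integrableZl.
by rewrite integralZl// (integral_lap A0 bf bg) mule0 adde0.
Qed.

Hypothesis L1 : (1 <= L)%N.

Lemma su11_coef_neq0 m : su11_coef R L m != 0.
Proof. by rewrite /su11_coef gt_eqF// sqrtr_gt0 ltr0n bin_gt0 -addnBA// leq_addr. Qed.

(** Expresses the exceptional event through a real-valued measurable function of the
    coefficients. *)
Lemma su11_poly_eq0 w : (psi w == 0) = (\sum_(m < N.+1) sqnormc (a m w) == 0).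
Proof.
rewrite psumr_eq0; last by move=> i _; exact: sqnormc_ge0.
apply/eqP/allP => [p0 i _|h].
  have := congr1 (fun q : {poly R[i]} => q`_i) p0; rewrite coef_poly ltn_ord coef0 /= => /eqP.
  rewrite mulf_eq0 sqnormc_eq0 => /orP[|//]; rewrite eq_complex => /andP[/eqP s0 _].
  by have := su11_coef_neq0 i; rewrite -[X in X != 0]/(complex.Re (su11_coef R L i)%:C%C) s0 eqxx.
apply/polyP => i; rewrite coef_poly coef0; case: ifP => // iN.
have := h (Ordinal iN) (mem_index_enum _); rewrite /= sqnormc_eq0 => /eqP ->.
by rewrite mulr0.
Qed.

Lemma expected_zero_sum :
  (\int[P]_w (zero_sum phi (psi w))%:E =
   \int[leb2]_z (pstar L N z * (f z.1 * g z.2))%:E)%E.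
Proof.
have [ma [_ na]] := ga.
have pi40 : 4 * pi != 0 :> R by rewrite mulf_neq0// gt_eqF// pi_gt0.
pose q w := (\int[@plane R]_z log_kernel (w, z))%E.
have mq : measurable_fun setT q := measurable_fubini_F integrable_log_kernel.
pose n w : R := \sum_(m < N.+1) sqnormc (a m w).
have mn : measurable_fun setT n.
  have -> : n = fun w => \sum_(m <- index_enum 'I_N.+1) sqnormc (a m w) by [].
  by apply: measurable_sum => m; apply: measurable_sqnormc; exact: cmeas_a.
pose h w : \bar R := ((4 * pi)^-1%:E * q w)%E.
have mh : measurable_fun setT h by apply: emeasurable_funM.
(* Measurability of [zero_sum], which goes through a chosen list of roots, is obtained here: it
   equals the measurable [h] when [psi] is nonzero and a constant otherwise. *)
have zsE w : (zero_sum phi (psi w))%:E = if n w == 0 then (zero_sum phi 0)%:E else h w.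
  have [nw|nw] := boolP (n w == 0).
    by have /eqP -> : psi w == 0 by rewrite su11_poly_eq0.
  have pw : psi w != 0 by rewrite su11_poly_eq0.
  rewrite /h /q plane_integral (zero_sum_log A0 bf bg pw) -EFinM; congr EFin.
  by rewrite mulKf.
have mzs : measurable_fun setT (fun w => (zero_sum phi (psi w))%:E).
  rewrite (funext zsE : (fun w => _) = _); apply: measurable_fun_ifT => //.
  exact: measurable_fun_eqr.
have ae : ae_eq P setT (fun w => (zero_sum phi (psi w))%:E) h.
  (* If [psi] vanishes identically then [Re (a 0) = 0], an event of Gaussian probability zero. *)
  exists (re_im_part a (0%N, true) @^-1` [set 0]); split.
  - by rewrite -[X in measurable X]setTI; apply: ma => //; exact: measurable_set1.
  - have e := na (0%N, true) [set 0] (measurable_set1 _); apply: (etrans e).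
    exact: gauss1_set1.
  - move=> w /= H; apply: contrapT => w0; apply: H => _; rewrite zsE ifF//; apply/negP => n0.
    move: n0; rewrite /n psumr_eq0; last by move=> i _; exact: sqnormc_ge0.
    move=> /allP/(_ ord0 (mem_index_enum _)); rewrite /= sqnormc_eq0 => /eqP a0.
    by apply: w0; rewrite /re_im_part /= a0.
transitivity (\int[P]_w h w)%E; first exact: ae_eq_integral.
rewrite /h.
have iq : P.-integrable setT q := integrable_fubini_F integrable_log_kernel.
rewrite integralZl// expectation_log_kernel.
transitivity ((4 * pi)^-1%:E * ((4 * pi)%:E * \int[leb2]_z (pstar L N z * (f z.1 * g z.2))%:E))%E.
  congr (_ * _)%E; apply: (etrans _ (integralZl measurableT integrable_pstar (4 * pi))).
  by apply: eq_integral => z _; rewrite EFinM.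
by rewrite muleA -EFinM mulVf// mul1e.
Qed.
End expectation.

(** * Identification of a continuous density from product bumps *)

Section uniqueness.
Variable R : realType.
Local Notation mR := (measurableTypeR R).
Local Notation leb := (@lebesgue_measure R).
Local Notation leb2 := (@lebesgue_measure R \x @lebesgue_measure R)%E.

Lemma continuous_square_nbhs (h : R * R -> R) (x0 y0 e : R) : continuous h -> 0 < e ->
  exists2 r, 0 < r & forall x y, `|x - x0| < r -> `|y - y0| < r -> `|h (x0, y0) - h (x, y)| < e.
Proof.
move=> ch e0; have /cvgrPdist_lt/(_ e e0) := ch (x0, y0).
move=> [[X Y] /= [/nbhs_ballP[r1 r10 h1] /nbhs_ballP[r2 r20 h2]] H].
exists (Num.min r1 r2); first by rewrite lt_min r10.
move=> x y; rewrite !lt_min => /andP[x1 _] /andP[_ y2].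
apply: (H (x, y)); split => /=; [apply: h1|apply: h2]; by rewrite /ball/= distrC.
Qed.

Lemma integral2_gt0 (h : R * R -> R) (x0 y0 : R) : continuous h -> (forall z, 0 <= h z) ->
  0 < h (x0, y0) -> (0 < \int[leb2]_z (h z)%:E)%E.
Proof.
move=> ch h0 hp; pose c := h (x0, y0) / 2.
have c0 : 0 < c by rewrite divr_gt0.
have [r r0 hr] := continuous_square_nbhs x0 y0 ch c0.
pose S : set (mR * mR) := [set` `]x0 - r, x0 + r[] `*` [set` `]y0 - r, y0 + r[].
have mS : measurable S by apply: measurableX; exact: measurable_itv.
have leb_itv (u : R) : leb [set` `](u - r)%R, (u + r)%R[] = (2 * r)%:E.
  rewrite lebesgue_measure_itv/= lte_fin ifT; last by lra.
  by rewrite -EFinB; congr EFin; ring.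
have SE : leb2 S = ((2 * r) * (2 * r))%:E.
  have e := product_measure1E leb leb (measurable_itv `]x0 - r, x0 + r[) (measurable_itv `]y0 - r, y0 + r[).
  by apply: (etrans e); apply: (etrans (congr2 (fun s t => s * t)%E (leb_itv x0) (leb_itv y0))); rewrite -EFinM.
have mI : measurable_fun [set: mR * mR] (fun z : mR * mR => (\1_S z)%:E : \bar R).
  exact/measurable_EFinP/measurable_indic.
apply: (@lt_le_trans _ _ (\int[leb2]_z (c%:E * (\1_S z)%:E))%E).
  rewrite ge0_integralZl//; last by rewrite lee_fin ltW.
  have I := etrans (integral_indicT leb2 mS) SE; rewrite I -EFinM lte_fin.
  by rewrite mulr_gt0// mulr_gt0// mulr_gt0.
apply: ge0_le_integral => //.
- by move=> z _; rewrite mule_ge0// lee_fin ltW.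
- exact: emeasurable_funM.
- by apply/measurable_EFinP; exact: continuous_measurable2.
- move=> [x y] _; rewrite -EFinM lee_fin indicE; have [|_] := boolP (_ \in S); last by rewrite mulr0.
  rewrite inE => -[/=]; rewrite !in_itv/= => /andP[x1 x2] /andP[y1 y2]; rewrite mulr1.
  have xr : `|x - x0| < r by rewrite ltr_norml; apply/andP; split; lra.
  have yr : `|y - y0| < r by rewrite ltr_norml; apply/andP; split; lra.
  have := hr x y xr yr; rewrite ltr_norml /c => /andP[]; lra.
Qed.

(** If [p] and [q] differ at a point, continuity keeps the sign of [p - q] on a small square; a
    product bump supported there would give the difference a nonzero integral. *)
Lemma density_unique (p q : R * R -> R) : continuous p -> continuous q ->
  (forall c d e : R, 0 < e ->
    (\int[leb2]_z (p z * (bumpf c e z.1 * bumpf d e z.2))%:E =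
     \int[leb2]_z (q z * (bumpf c e z.1 * bumpf d e z.2))%:E)%E) ->
  forall z, p z = q z.
Proof.
move=> cp cq H [x0 y0]; apply/eqP; rewrite -subr_eq0; apply/negPn/negP => ne0.
(* Multiplying by the sign at the point treats both signs at once. *)
pose s : R := Num.sg (p (x0, y0) - q (x0, y0)).
pose h z := s * (p z - q z).
have hz : 0 < h (x0, y0) by rewrite /h /s -normrEsg normr_gt0.
have ch : continuous h.
  by move=> z; apply: cvgM; [exact: cvg_cst|apply: cvgB; [exact: cp|exact: cq]].
have [r r0 hr] := continuous_square_nbhs x0 y0 ch hz.
pose ph (z : R * R) := bumpf x0 r z.1 * bumpf y0 r z.2.
have cb (c : R) : continuous (bumpf c r) by exact: smooth1_continuous (smooth1_bump c r 0).
have cph : continuous ph by exact: continuous_tensor.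
have ph0 z : 0 <= ph z by rewrite mulr_ge0// bump_ge0.
pose A := `|x0| + `|y0| + r.
have phA z : ph z != 0 -> `|z.1| <= A /\ `|z.2| <= A.
  move=> nz; split; apply: contraNT nz; rewrite -ltNge /A /ph => zA.
    rewrite bump_out ?mul0r//; have := ler_distD x0 z.1 0; rewrite !subr0; have := normr_ge0 y0; lra.
  rewrite (@bump_out _ y0) ?mulr0//; have := ler_distD y0 z.2 0; rewrite !subr0; have := normr_ge0 x0; lra.
have hph0 z : 0 <= h z * ph z.
  case: z => x y; have [xr|xr] := ltP `|x - x0| r; last by rewrite /ph /= bump_out// mul0r mulr0.
  have [yr|yr] := ltP `|y - y0| r; last by rewrite /ph /= (@bump_out _ y0)// !mulr0.
  rewrite mulr_ge0//; have := hr x y xr yr; rewrite ltr_norml => /andP[]; lra.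
have := integral2_gt0 (x0 := x0) (y0 := y0) (h := fun z => h z * ph z).
have int (u : R * R -> R) : continuous u -> leb2.-integrable setT (fun z : mR * mR => (u z * ph z)%:E).
  move=> cu; apply: (@continuous_support_integrable2 R (fun z => u z * ph z) A).
    by move=> z; apply: cvgM; [exact: cu|exact: cph].
  by move=> z nz; apply: phA; apply: contraNneq nz => ->; rewrite mulr0.
have ip := int p cp; have iq := int q cq.
have E : (\int[leb2]_z (h z * ph z)%:E = 0)%E.
  transitivity (\int[leb2]_z (s%:E * ((p z * ph z)%:E - (q z * ph z)%:E)))%E.
    by apply: eq_integral => z _; rewrite -EFinB -EFinM /h; congr EFin; ring.
  rewrite integralZl//; last exact: integrableB.
  rewrite integralB// (H x0 y0 r r0) subee ?mule0//.
  exact: (integrable_fin_num measurableT iq).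
rewrite E ltxx => /(_ _ hph0 _)/negP; apply => //.
  by move=> z; apply: cvgM; [exact: ch|exact: cph].
by rewrite mulr_gt0// /ph /= mulr_gt0// bump_gt0.
Qed.
End uniqueness.

(** The test-function identity fixes a density only almost everywhere; continuity of [p N] selects
    the representative whose value at a given point is meaningful. *)
Theorem theorem1 (R : realType) (L : nat) (A : R)
  (d : measure_display) (Omega : measurableType d) (P : probability Omega R)
  (a : nat -> Omega -> R[i]) (p : nat -> R[i] -> R) :
  (1 <= L)%N -> 0 < A ->
  iid_std_complex_gaussian P a ->
  (forall N : nat, (1 <= N)%N ->
     continuous (fun xy : R * R => p N (Cpt xy.1 xy.2)) /\
     is_zero_density P a L N (p N)) ->
  exists C : R, exists N0 : nat, forall N : nat, (1 <= N)%N -> (N0 <= N)%N ->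
    forall s theta : R, -A <= s <= A ->
      `| (N%:R ^+ 2)^-1 * p N (scaled_point N s theta)
         - pi^-1 * leading_term L s | <= C / N%:R.
Proof.
move=> L1 A0 ga hp.
have [C [N0 H]] := quotient_asymptotics L1 A0.
(* Besides the threshold of [quotient_asymptotics], [N > A] is imposed: it makes [1 + s / N]
   nonnegative, so that the squared modulus of [scaled_point] is indeed [1 + s / N]. *)
exists (pi^-1 * C), (maxn N0 (Num.truncn A).+1) => N N1 NN s theta sA.
have [cp dp] := hp N N1.
have pE z : p N (Cpt z.1 z.2) = pstar L N z.
  apply: (density_unique cp (@continuous_pstar R L N)) => c c' e e0.
  pose B := `|c| + `|c'| + e + 1.
  have B0 : 0 < B by rewrite /B; have := normr_ge0 c; have := normr_ge0 c'; lra.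
  have bf : bump2 B (bumpf c e) (derive1 (bumpf c e)) (derive1 (derive1 (bumpf c e))).
    by apply: bump2_bump; rewrite /B; have := normr_ge0 c'; lra.
  have bg : bump2 B (bumpf c' e) (derive1 (bumpf c' e)) (derive1 (derive1 (bumpf c' e))).
    by apply: bump2_bump; rewrite /B; have := normr_ge0 c; lra.
  have e1 := dp _ (test_function_bump c c' e).
  have e2 := expected_zero_sum ga N B0 bf bg L1.
  exact: (etrans (esym e1) e2).
have NR : 0 < N%:R :> R by rewrite ltr0n.
have AN : A < N%:R.
  by apply: (lt_le_trans (truncnS_gt _)); rewrite ler_nat (leq_trans _ NN)// leq_maxr.
have t0 : 0 <= 1 + s / N%:R.
  have -> : 1 + s / N%:R = (N%:R + s) / N%:R by rewrite mulrDl divff// gt_eqF.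
  by move: sA => /andP[s1 _]; apply: divr_ge0; [lra|exact: ltW].
pose r := Num.sqrt (1 + s / N%:R).
have -> : scaled_point N s theta = Cpt (r * cos theta, r * sin theta).1 (r * cos theta, r * sin theta).2.
  by rewrite /scaled_point /Cpt /=; apply/eqP; rewrite eq_complex /= !mul0r subr0 addr0 !eqxx.
rewrite pE /pstar.
have -> : sqdist 0 0 (r * cos theta, r * sin theta) = 1 + s / N%:R.
  by rewrite /sqdist /= !subr0 !exprMn -mulrDr cos2Dsin2 mulr1 sqr_sqrtr.
have := H N N1 (leq_trans (leq_maxl _ _) NN) s _ sA erefl.
rewrite mulrCA -mulrBr normrM ger0_norm ?invr_ge0 ?pi_ge0// -mulrA => h.
by rewrite ler_wpM2l ?invr_ge0 ?pi_ge0.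
Qed.
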